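(* Consider the continuous multiresource-job (MRJ) system with $d\ge 1$ resources, Poisson arrivals of rate $\lambda>0$, i.i.d. $\mathrm{Exp}(1)$ durations, and i.i.d. resource requirements distributed as $V$, where $V$ has a Lipschitz continuous probability density function $f_V$ over $(0,1]^d$. Then the family of $\vec K$-discretized MaxWeight ($\vec K$-MW) policies is throughput-optimal: if the system (with this $\lambda$ and $V$) is stable under some Markovian policy $\pi$, then there exists $\vec K=(K_1,\dots,K_d)$ with positive integer entries such that the system is stable under the $\vec K$-MW policy.
   Context: **Model (continuous MRJ system).** One server has $d$ resources, each with capacity $1$. Jobs arrive by a Poisson process of rate $\lambda$. Each job has a resource requirement vector in $(0,1]^d$, sampled i.i.d. from the law of $V$ (with density $f_V$), and an independent duration $\sim\mathrm{Exp}(1)$ not observed by the scheduler. A job leaves once it has received service for a total time equal to its duration. The state is the finite list $x=(\vec v_n)_{1\le n\le N}$ of requirements of the jobs present, in arrival order. Service is preempt-resume. A Markovian policy maps each state $x$ to a subset $x'$ of the jobs in $x$ with $\sum_{\vec v\in x'}\vec v\preceq \vec 1$ (entrywise); the jobs in $x'$ are served simultaneously, each at rate $1$. The system is *stable* under a policy if the empty state is positive recurrent. **$\vec K$-discretization.** For $\vec K=(K_1,\dots,K_d)$ with positive integer entries, let $\Gamma_{\vec K}=\{\vec i\in\mathbb N^d:\vec 1\preceq\vec i\preceq\vec K\}$ be the set of job types. For $\vec i\in\Gamma_{\vec K}$ let $I_{\vec i}=\prod_{l=1}^d\left(\frac{i_l-1}{K_l},\frac{i_l}{K_l}\right]$;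 a job with requirement in $I_{\vec i}$ is a type-$\vec i$ job. Let $q_{\vec i}(t)$ be the number of type-$\vec i$ jobs in the system at time $t$ and $q(t)=(q_{\vec i}(t))_{\vec i\in\Gamma_{\vec K}}$. The set of admissible service options is $$C_{\vec K}=\Big\{M\in\mathbb N^{\Gamma_{\vec K}}:\ \sum_{\vec i\in\Gamma_{\vec K}} i_l M^{(\vec i)}\le K_l\ \text{ for all }1\le l\le d\Big\},\qquad \mathbb N=\{0,1,2,\dots\}.$$ Using service option $M$ in a state with type counts $q$ means serving $\min(M^{(\vec i)},q_{\vec i})$ jobs of each type $\vec i$. **$\vec K$-MW.** At each time $t$ the policy uses a service option in $\arg\max_{M\in C_{\vec K}}\sum_{\vec i\in\Gamma_{\vec K}}q_{\vec i}(t)M^{(\vec i)}$ (ties broken by a fixed rule). *)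

(* Defs.v *)
From HB Require Import structures.
From mathcomp Require Import all_boot all_order all_algebra.
From mathcomp Require Import all_classical all_reals all_analysis.

Set Implicit Arguments.
Unset Strict Implicit.
Unset Printing Implicit Defensive.

Import Order.TTheory GRing.Theory Num.Theory.

Local Open Scope classical_set_scope.
Local Open Scope ring_scope.

(* Resource vectors are tuples, because the library equips [n.-tuple T] with
   its product sigma-algebra. *)
Notation rvec R d := (d.-tuple R).

Section Requirements.
Context {R : realType}.

Definition unit_cube d : set (rvec R d) :=
  [set v | forall l, 0 < tnth v l <= 1].

(* By Tonelli, the integral with respect to d-dimensional Lebesgue measure of a
   nonnegative measurable function. *)
Fixpoint lebesgue_iint d : (rvec R d -> \bar R) -> \bar R :=
  if d is d'.+1 then
    fun g => (\int[lebesgue_measure]_(t in [set: R])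
                lebesgue_iint (fun v : rvec R d' => g [tuple of t :: v]))%E
  else fun g => g [tuple].

Definition sup_dist d (u v : rvec R d) : R :=
  \big[Num.max/0]_(l < d) `|tnth u l - tnth v l|.

Definition lipschitz_on_cube d (f : rvec R d -> R) : Prop :=
  exists L : R, forall u v, unit_cube u -> unit_cube v ->
    `|f u - f v| <= L * sup_dist u v.

End Requirements.

Definition has_density_on_cube disp (Omega : measurableType disp)
    (R : realType) (P : probability Omega R) d
    (V : Omega -> rvec R d) (f : rvec R d -> R) : Prop :=
  (forall v, unit_cube v -> 0 <= f v) /\
  forall B, measurable B ->
    P (V @^-1` B) =
    lebesgue_iint (fun v => (\1_(B `&` @unit_cube R d) v * f v)%:E).

(* Job n (counted from 0) arrives at time
   interarrival 0 + ... + interarrival n, so that arrivals form a Poisson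
   process of rate lambda. *)
Record primitives disp (Omega : measurableType disp) (R : realType)
    (P : probability Omega R) d (lambda : R) (f : rvec R d -> R) := Primitives {
  interarrival : nat -> {RV P >-> R};
  requirement : nat -> {RV P >-> rvec R d};
  duration : nat -> {RV P >-> R};
  interarrival_law : forall n A, measurable A ->
    P (interarrival n @^-1` A) = exponential_prob lambda A;
  requirement_law : forall n, has_density_on_cube P (requirement n) f;
  duration_law : forall n A, measurable A ->
    P (duration n @^-1` A) = exponential_prob 1 A;
  (* mutual independence of the whole family; sub-families are covered by
     taking some of the sets to be full *)
  primitives_independent : forall (N : nat) (A : nat -> set R)
      (B : nat -> set (rvec R d)) (C : nat -> set R),
    (forall n, measurable (A n)) -> (forall n, measurable (B n)) ->
    (forall n, measurable (C n)) ->
    P [set w | forall n, (n < N)%N ->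
         [/\ A n (interarrival n w), B n (requirement n w)
           & C n (duration n w)]] =
    (\prod_(n < N) (P (interarrival n @^-1` A n) *
                    P (requirement n @^-1` B n) *
                    P (duration n @^-1` C n)))%E }.

Section Policies.
Context {R : realType} {d : nat}.

(* A state is the list, in arrival order, of the requirements of the jobs
   present; a policy selects the positions of the jobs that are served. *)
Definition policy := forall N : nat, N.-tuple (rvec R d) -> {set 'I_N}.

Definition is_state N (x : N.-tuple (rvec R d)) : Prop :=
  forall n, unit_cube (tnth x n).

Definition markovian_policy (pi : policy) : Prop :=
  (forall N (x : N.-tuple (rvec R d)), is_state x ->
     forall l, \sum_(n in pi N x) tnth (tnth x n) l <= 1) /\
  (forall N (S : {set 'I_N}),
     measurable [set x : N.-tuple (rvec R d) | is_state x /\ pi N x = S]).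

(* The component [i l : 'I_(K l)] stands for the 1-based index (i l).+1. *)
Definition job_type (K : 'I_d -> nat) := {dffun forall l : 'I_d, 'I_(K l)}.

Definition of_type (K : 'I_d -> nat) (i : job_type K) (v : rvec R d) : bool :=
  [forall l, (i l)%:R / (K l)%:R < tnth v l <= (i l).+1%:R / (K l)%:R].

Definition type_count (K : 'I_d -> nat) N (x : N.-tuple (rvec R d))
    (i : job_type K) : nat :=
  #|[set n | of_type i (tnth x n)]|.

Definition service_option (K : 'I_d -> nat) (M : job_type K -> nat) : Prop :=
  forall l, (\sum_(i : job_type K) (i l).+1 * M i <= K l)%N.

Definition max_weight (K : 'I_d -> nat) (q M : job_type K -> nat) : Prop :=
  service_option M /\
  forall M', service_option M' ->
    (\sum_(i : job_type K) q i * M' i <= \sum_(i : job_type K) q i * M i)%N.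

(* As [pi] is a function of the state, ties between maximizing options, and the
   choice of which jobs to serve within a type, are resolved by a fixed but
   arbitrary (measurable) rule. *)
Definition is_KMW (K : 'I_d -> nat) (pi : policy) : Prop :=
  markovian_policy pi /\
  forall N (x : N.-tuple (rvec R d)), is_state x ->
    exists M : job_type K -> nat,
      max_weight (type_count x) M /\
      forall i : job_type K,
        #|[set n in pi N x | of_type i (tnth x n)]| =
        minn (M i) (type_count x i).

End Policies.

Arguments policy R d : clear implicits.

Section Dynamics.
Context {disp : measure_display} {Omega : measurableType disp} {R : realType}.
Context {P : probability Omega R} {d : nat} {lambda : R} {f : rvec R d -> R}.
Variables (sys : primitives P lambda f) (pi : policy R d) (w : Omega).

(* [jobs] lists, in arrival order, the requirement and the remaining duration
   of each job present; the policy is only shown the requirements. *)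
Record config := Config {
  clock : R;
  arrived : nat;
  until_arrival : R;
  jobs : seq (rvec R d * R) }.

Definition served (js : seq (rvec R d * R)) : {set 'I_(size js)} :=
  pi (map_tuple fst (in_tuple js)).

(* Between events the state, hence the set of served jobs, is constant, so the
   next event is the next arrival or the first completion of a served job. *)
Definition time_to_event (c : config) : R :=
  \big[Num.min/until_arrival c]_(n in served (jobs c))
    (tnth (in_tuple (jobs c)) n).2.

Definition remaining_jobs (c : config) : seq (rvec R d * R) :=
  [seq j <- [seq let j := tnth (in_tuple (jobs c)) n in
                 (j.1, if n \in served (jobs c)
                       then j.2 - time_to_event c else j.2)
            | n <- enum 'I_(size (jobs c))]
  | 0 < j.2].

(* Since [time_to_event c <= until_arrival c], the test holds exactly when an
   arrival occurs; simultaneous events are all carried out. *)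
Definition next_event (c : config) : config :=
  let h := time_to_event c in
  let k := arrived c in
  if until_arrival c <= h then
    Config (clock c + h) k.+1 (interarrival sys k.+1 w)
      (rcons (remaining_jobs c) (requirement sys k w, duration sys k w))
  else
    Config (clock c + h) k (until_arrival c - h) (remaining_jobs c).

Definition config_after (k : nat) : config :=
  iter k next_event (Config 0 0 (interarrival sys 0 w) [::]).

(* The time of the first return to the empty state, starting empty at time 0;
   +oo if there is none. The first event is always an arrival. *)
Definition return_time : \bar R :=
  ereal_inf [set (clock (config_after k))%:E
            | k in [set k | (0 < k)%N /\ jobs (config_after k) = [::]]].

End Dynamics.

(* The empty state is positive recurrent: its mean return time is finite. *)
Definition stable disp (Omega : measurableType disp) (R : realType)
    (P : probability Omega R) d (lambda : R) (f : rvec R d -> R)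
    (sys : primitives P lambda f) (pi : policy R d) : Prop :=
  (\int[P]_w return_time sys pi w < +oo)%E.

(* Main.v *)
(* Stability of some policy bounds the load: by memorylessness the embedded
   jump chain of the job counts has explicit transition probabilities, and
   summing the drift of [sum over the jobs present of g] over one busy cycle,
   for a weight [g >= 0] whose value on any feasible set of jobs is at most [W],
   gives [lambda E g(V) <= (1 - 1 / (lambda E T)) W], where [E T] is the mean
   return time; the slack is the idle time that starts every cycle.

   To pass to the grid of mesh 1/N, take for [g] the queue lengths [q] shifted
   by one cell, [g v = q (i - 1)] for [v] of type [i]: rounding the shifted type
   up never exceeds [v], so [W] may be taken to be the MaxWeight value of [q].
   Undoing the shift costs O(1/N) times the MaxWeight value: neighbouring cells
   have probabilities within O(N^-(d+1)) because the density is Lipschitz, each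
   boundary cell has probability O(N^-d), and the MaxWeight value dominates
   every single queue. Hence for large [N] the load lies strictly inside the
   capacity region of the grid, and a quadratic Lyapunov function, corrected by
   a bounded term near the empty state, has drift at most -1 under MaxWeight.

   Memorylessness enters through exponential races. A history records which
   jobs are served and which clock rings first at each event; the requirements
   decide the former, the interarrival times and durations the latter, so the
   probability of a history is the probability of a requirement event times the
   product of [rate of the winner / total rate]. *)

From HB Require Import structures.
Require Import Defs.
From mathcomp Require Import all_boot all_order all_algebra.
From mathcomp Require Import all_classical all_reals all_analysis.
From mathcomp Require Import measurable_realfun ring lra.

Set Implicit Arguments.
Unset Strict Implicit.
Unset Printing Implicit Defensive.

Import Order.TTheory GRing.Theory Num.Theory.
Import numFieldNormedType.Exports.

Local Open Scope classical_set_scope.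
Local Open Scope ring_scope.

(** The requirements form a continuum and a policy may depend on their exact values, so the types do
    not determine which jobs are served; a history therefore records the served set as well. There
    are finitely many histories of each length. The probability [serving_prob] of serving a given
    set stays unknown, and two facts about it suffice: it sums to the probability of the history,
    and a set of positive probability is chosen by the policy in some actual state. All expectations
    become finite sums over a tree of histories cut at the first return, with no conditioning and no
    Markov chain on a general state space. The same tree serves the given stable policy and
    MaxWeight.

    The return time is an infimum whose measurability is never established. It is compared with the
    [holding] times instead: their partial sums lie below it almost surely, and their full sum lies
    above it off a null set once the probability of not having returned tends to 0. Both comparisons
    use only monotonicity of the integral of nonnegative functions. *)

(** * Real-valued probabilities and elementary limits *)

Section RealProbability.
Context {disp : measure_display} {Omega : measurableType disp} {R : realType}.
Variable P : probability Omega R.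
Implicit Types A B C : set Omega.

Definition Pr A : R := fine (P A).

Lemma PrE A : measurable A -> P A = (Pr A)%:E.
Proof. by move=> mA; rewrite /Pr fineK// fin_num_measure. Qed.

Lemma Pr_ge0 A : 0 <= Pr A.
Proof. by rewrite /Pr fine_ge0// measure_ge0. Qed.

Lemma PrT : Pr setT = 1.
Proof. by rewrite /Pr probability_setT. Qed.

Lemma Pr0 : Pr set0 = 0.
Proof. by rewrite /Pr measure0. Qed.

Lemma Pr_le A B : measurable A -> measurable B -> A `<=` B -> Pr A <= Pr B.
Proof.
move=> mA mB AB; rewrite -lee_fin -!PrE//.
by apply: le_measure => //; rewrite inE.
Qed.

Lemma PrU A B : measurable A -> measurable B -> (forall w, A w -> ~ B w) ->
  Pr (A `|` B) = Pr A + Pr B.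
Proof.
move=> mA mB AB; apply: EFin_inj; rewrite EFinD -!PrE//; last exact: measurableU.
by rewrite measureU//; apply/seteqP; split=> // w [/AB].
Qed.

Lemma Pr_subadd A B : measurable A -> measurable B ->
  Pr (A `|` B) <= Pr A + Pr B.
Proof.
move=> mA mB; rewrite -lee_fin EFinD -!PrE//; last exact: measurableU.
exact: measureU2.
Qed.

Lemma Pr_split A B : measurable A -> measurable B ->
  Pr A = Pr (A `&` B) + Pr (A `\` B).
Proof.
move=> mA mB; rewrite -PrU; [by rewrite setUIDK| exact: measurableI
  | exact: measurableD | by move=> w [? ?] []].
Qed.

Lemma measurable_bigU (I : eqType) (s : seq I) (F : I -> set Omega) :
  (forall i, i \in s -> measurable (F i)) ->
  measurable [set w | exists2 i, i \in s & F i w].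
Proof.
elim: s => [|i s IH] mF.
  rewrite (_ : mkset _ = set0)//; apply/seteqP; split=> // w [j].
  by rewrite in_nil.
rewrite (_ : mkset _ = F i `|` [set w | exists2 i, i \in s & F i w]).
  apply: measurableU; first by apply: mF; rewrite mem_head.
  by apply: IH => j js; apply: mF; rewrite inE js orbT.
apply/seteqP; split=> [w [j]|w [Fi|[j js Fj]]].
- by rewrite inE => /predU1P[->|js] Fj; [left|right; exists j].
- by exists i => //; rewrite mem_head.
- by exists j => //; rewrite inE js orbT.
Qed.

Lemma Pr_sum (I : eqType) (s : seq I) (F : I -> set Omega) :
  uniq s -> (forall i, i \in s -> measurable (F i)) ->
  (forall i j w, i \in s -> j \in s -> F i w -> F j w -> i = j) ->
  Pr [set w | exists2 i, i \in s & F i w] = \sum_(i <- s) Pr (F i).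
Proof.
elim: s => [|i s IH] us mF tF.
  rewrite big_nil (_ : mkset _ = set0) ?Pr0//; apply/seteqP.
  by split=> // w [j]; rewrite in_nil.
rewrite big_cons.
have -> : [set w | exists2 j, j \in i :: s & F j w] =
          F i `|` [set w | exists2 i, i \in s & F i w].
  apply/seteqP; split=> [w [j]|w [Fi|[j js Fj]]].
  - by rewrite inE => /predU1P[->|js] Fj; [left|right; exists j].
  - by exists i => //; rewrite mem_head.
  - by exists j => //; rewrite inE js orbT.
case/andP: us => nis us.
have mFs j : j \in s -> measurable (F j).
  by move=> js; apply: mF; rewrite inE js orbT.
rewrite PrU ?IH//.
- by move=> j k w js ks; apply: tF; rewrite inE ?js ?ks orbT.
- by apply: mF; rewrite mem_head.
- exact: measurable_bigU.
- move=> w Fi [j js Fj]; move: nis.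
  by rewrite (tF i j w) ?js//; rewrite inE ?eqxx// js orbT.
Qed.

Lemma Pr_subsum (n : nat) (F : nat -> set Omega) :
  (forall i, measurable (F i)) ->
  Pr [set w | exists2 i, (i < n)%N & F i w] <= \sum_(i < n) Pr (F i).
Proof.
move=> mF; elim: n => [|n IH].
  rewrite big_ord0 (_ : mkset _ = set0) ?Pr0//; apply/seteqP.
  by split=> // w [j].
have mn k : measurable [set w | exists2 i, (i < k)%N & F i w].
  have := @measurable_bigU _ (iota 0 k) F (fun i _ => mF i).
  congr (measurable _); apply/seteqP.
  by split=> w [i ik Fi]; exists i => //; move: ik; rewrite mem_iota add0n.
rewrite big_ord_recr /=; apply: le_trans (lerD IH (lexx _)).
apply: le_trans (Pr_subadd (mn n) (mF n)).
apply: Pr_le => //; first exact: measurableU.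
move=> w [i]; rewrite ltnS leq_eqVlt => /predU1P[->|ik] Fi; first by right.
by left; exists i.
Qed.
End RealProbability.

Section RealLimits.
Context {R : realType}.

Lemma geometric_small (r e : R) : 0 <= r < 1 -> 0 < e -> exists n, r ^+ n < e.
Proof.
move=> /andP[r0 r1] e0.
have : (fun n => r ^+ n) @ \oo --> (0 : R).
  by apply: cvg_expr; rewrite ger0_norm.
move=> /cvgrPdist_lt/(_ _ e0)[n _ /(_ n)] /=.
rewrite leqnn => /(_ isT) H; exists n.
by rewrite sub0r normrN ger0_norm// exprn_ge0 in H.
Qed.

Lemma le_of_geometric (a b c r : R) : 0 <= r < 1 -> 0 <= c ->
  (forall n, a <= b + c * r ^+ n) -> a <= b.
Proof.
move=> r01 c0 H; rewrite leNgt; apply/negP => ba.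
have p0 : 0 < (a - b) / (c + 1) by rewrite divr_gt0 ?subr_gt0// ltr_wpDl.
have c1 : 0 < c + 1 by rewrite ltr_wpDl.
have [n] := geometric_small r01 p0; rewrite ltr_pdivlMr// => Hn.
have := H n; have : 0 <= r ^+ n by rewrite exprn_ge0//; case/andP: r01.
nra.
Qed.

Lemma eq_of_linear_error (a b c : R) : 0 <= c ->
  (forall d, 0 < d -> a <= b + c * d) ->
  (forall d, 0 < d -> b <= a + c * d) -> a = b.
Proof.
move=> c0 H1 H2.
have key x y : (forall d, 0 < d -> x <= y + c * d) -> x <= y.
  move=> H; apply/ler_addgt0Pr => e e0.
  have c1 : 0 < c + 1 by rewrite ltr_wpDl.
  have d0 : 0 < e / (c + 1) by rewrite divr_gt0.
  apply: le_trans (H _ d0) _; rewrite lerD2l mulrA ler_pdivrMr// mulrC.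
  by rewrite ler_pM2l// lerDl.
by apply/eqP; rewrite eq_le !key.
Qed.
End RealLimits.

(** * Exponential races *)

Section MeasurableComparison.
Context {disp : measure_display} {Omega : measurableType disp} {R : realType}.

Lemma measurable_ltr_set (f g : Omega -> R) :
  measurable_fun setT f -> measurable_fun setT g ->
  measurable [set w | f w < g w].
Proof.
move=> mf mg.
have -> : [set w | f w < g w] = setT `&` (g \- f) @^-1` `]0, +oo[.
  rewrite setTI; apply/seteqP.
  by split=> w /=; rewrite in_itv/= andbT subr_gt0.
by apply: measurable_funB => //.
Qed.

Lemma measurable_all (I : eqType) (s : seq I) (F : I -> set Omega) :
  (forall i, i \in s -> measurable (F i)) ->
  measurable [set w | forall i, i \in s -> F i w].
Proof.
move=> mF.
have := @measurable_bigU _ Omega _ s (fun i => ~` F i)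
  (fun i si => measurableC (mF i si)).
move=> /measurableC; congr (measurable _); apply/seteqP; split=> w /= H.
- by move=> i si; apply: contrapT => nF; apply: H; exists i.
- by move=> [i si]; apply; exact: H.
Qed.

Lemma measurable_imply (b : Prop) (F : set Omega) :
  measurable F -> measurable [set w | b -> F w].
Proof.
move=> mF; have [Hb|nb] := pselect b.
  by rewrite (_ : mkset _ = F)//; apply/seteqP; split=> w /=; [apply|].
by rewrite (_ : mkset _ = setT)//; apply/seteqP; split=> w //= _ /nb.
Qed.
End MeasurableComparison.

Section RaceStep.
Context {disp : measure_display} {Omega : measurableType disp} {R : realType}.
Variables (P : probability Omega R) (X : eqType) (mu : X -> R).
Hypothesis mu_gt0 : forall x, 0 < mu x.
Local Notation Pr := (Pr P).

Definition surv (Y : X -> Omega -> R) (B : seq X) (t : X -> R) : set Omega :=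
  [set w | forall x, x \in B -> t x < Y x w].

Lemma measurable_surv Y B t : (forall x, measurable_fun setT (Y x)) ->
  measurable (surv Y B t).
Proof.
move=> mY; apply: measurable_all => x _; apply: measurable_ltr_set => //.
Qed.

(** Given [C], the alive clocks are independent exponentials. This is stated through joint survival
    functions and multiplied by the mass [c], so that nothing is conditioned on a null event; [B]
    empty forces [c] to be the probability of [C]. *)
Definition exp_clocks (C : set Omega) (c : R) (alive : pred X)
    (Y : X -> Omega -> R) : Prop :=
  forall B t, uniq B -> all alive B -> (forall x, 0 <= t x) ->
    Pr (C `&` surv Y B t) = c * expR (- \sum_(x <- B) mu x * t x).

Definition race_event (Z : seq X) (e : X) (Y : X -> Omega -> R) : set Omega :=
  [set w | forall x, x \in Z -> x != e -> Y e w < Y x w].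

(** Only the clocks of [Z] advance: a preempted job keeps its remaining duration. *)
Definition race_residual (Z : seq X) (e : X) (Y : X -> Omega -> R)
    (x : X) (w : Omega) : R :=
  if x \in Z then Y x w - Y e w else Y x w.

Lemma measurable_race_event Z e Y : (forall x, measurable_fun setT (Y x)) ->
  measurable (race_event Z e Y).
Proof.
move=> mY; apply: measurable_all => x _; apply: measurable_imply.
exact: measurable_ltr_set.
Qed.

Lemma measurable_race_residual Z e Y : (forall x, measurable_fun setT (Y x)) ->
  forall x, measurable_fun setT (race_residual Z e Y x).
Proof.
move=> mY x; rewrite /race_residual; case: (x \in Z) => //.
by apply: measurable_funB => //.
Qed.

Lemma cell_exists (y d : R) n : 0 < y -> y <= n%:R * d ->
  exists2 k, (k < n)%N & k%:R * d < y <= k.+1%:R * d.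
Proof.
move=> y0; elim: n => [|n IH] yn; first by move: yn; rewrite mul0r leNgt y0.
have [/IH[k kn H]|ny] := leP y (n%:R * d); last by exists n => //; rewrite ny.
by exists k => //; exact: ltnW.
Qed.

Variables (C : set Omega) (c : R) (alive : pred X) (Y : X -> Omega -> R).
Variables (Z : seq X) (e : X).
Hypotheses (mC : measurable C) (mY : forall x, measurable_fun setT (Y x)).
Hypothesis expY : exp_clocks C c alive Y.
Hypotheses (uZ : uniq Z) (aZ : all alive Z) (eZ : e \in Z).

Let c_ge0 : 0 <= c.
Proof.
have := @expY [::] (fun=> 0) isT isT (fun=> lexx _).
by rewrite big_nil oppr0 expR0 mulr1 => <-; exact: Pr_ge0.
Qed.

Section Cells.
Variables (B : seq X) (t : X -> R).
Hypotheses (uB : uniq B) (aB : all (predI alive (predC1 e)) B).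
Hypothesis t0 : forall x, 0 <= t x.

(** The clocks other than [e] that the race or the thresholds constrain. Those outside [B] only have
    to lose the race, whence their threshold 0 in [t']. *)
Let D := B ++ [seq x <- Z | (x \notin B) && (x != e)].
Let t' x := if x \in B then t x else 0.
Let sigma := \sum_(x <- Z | x != e) mu x.
Let K := expR (- \sum_(x <- B) mu x * t x).

Let neB x : x \in B -> x != e.
Proof. by move=> xB; have /allP/(_ _ xB)/andP[] := aB. Qed.

Let neD x : x \in D -> x != e.
Proof. by rewrite mem_cat mem_filter => /orP[/neB//|/andP[/andP[]]]. Qed.

Let uD : uniq D.
Proof.
rewrite cat_uniq uB filter_uniq// andbT; apply/hasPn => x.
by rewrite mem_filter => /andP[/andP[]].
Qed.

Let aD : all alive D.
Proof.
apply/allP => x; rewrite mem_cat mem_filter => /orP[xB|/andP[_ xZ]].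
  by have /allP/(_ _ xB)/andP[] := aB.
by have /allP/(_ _ xZ) := aZ.
Qed.

Let thr (k a : R) x := if x == e then k else t' x + if x \in Z then a else 0.

Let Pr_thr (k a : R) : 0 <= k -> 0 <= a ->
  Pr (C `&` surv Y (e :: D) (thr k a)) =
  c * (K * expR (- (mu e * k)) * expR (- (sigma * a))).
Proof.
move=> k0 a0; rewrite expY.
- congr (_ * _); rewrite /K -!expRD; congr expR.
  rewrite big_cons {1}/thr eqxx.
  have -> : \sum_(x <- D) mu x * thr k a x =
            \sum_(x <- D) mu x * t' x + \sum_(x <- D | x \in Z) mu x * a.
    rewrite [X in _ = _ + X]big_mkcond -big_split /= !big_seq.
    apply: eq_bigr => x xD; rewrite /thr (negbTE (neD xD)).
    by case: (x \in Z); rewrite ?addr0// mulrDr.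
  have -> : \sum_(x <- D) mu x * t' x = \sum_(x <- B) mu x * t x.
    rewrite big_cat /= [X in _ + X]big1_seq ?addr0.
      by rewrite !big_seq; apply: eq_bigr => x xB; rewrite /t' xB.
    move=> x /andP[_]; rewrite mem_filter => /andP[/andP[xB _] _].
    by rewrite /t' (negbTE xB) mulr0.
  have -> : \sum_(x <- D | x \in Z) mu x * a = sigma * a.
    rewrite -mulr_suml /sigma; congr (_ * _).
    rewrite -[LHS]big_filter -[RHS]big_filter; apply: perm_big; apply: uniq_perm; rewrite ?filter_uniq// => x.
    rewrite !mem_filter mem_cat mem_filter.
    have [xZ|] := boolP (x \in Z); rewrite ?andbF//= !andbT.
    by have [/neB->|//] := boolP (x \in B).
  ring.
- rewrite /= uD andbT; apply/negP => /neD; by rewrite eqxx.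
- by rewrite /= aD andbT; have /allP/(_ _ eZ) := aZ.
- move=> x; rewrite /thr /t'; case: (x == e) => //; apply: addr_ge0.
    by case: (x \in B).
  by case: (x \in Z).
Qed.

(* [Q d k a]: [e] rings in the [k]-th cell of length [d] and the other clocks of
   [Z] outlast [a] by their thresholds. Taking for [a] the two ends of the cell
   sandwiches the race event, and [d] then tends to 0. *)
Let Q (d : R) (k : nat) (a : R) : set Omega :=
  C `&` surv Y (e :: D) (thr (k%:R * d) a) `\` [set w | k.+1%:R * d < Y e w].

Let mQ d k a : measurable (Q d k a).
Proof.
apply: measurableD; last exact: measurable_ltr_set.
by apply: measurableI => //; exact: measurable_surv.
Qed.

Let Pr_Q (d : R) (k : nat) a : 0 <= d -> 0 <= a ->
  Pr (Q d k a) = c * K * expR (- (sigma * a)) *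
    (expR (- (mu e * d)) ^+ k - expR (- (mu e * d)) ^+ k.+1).
Proof.
move=> d0 a0; have kd0 n : 0 <= n%:R * d by rewrite mulr_ge0.
set A := C `&` surv Y (e :: D) (thr (k%:R * d) a).
have mA : measurable A by apply: measurableI => //; exact: measurable_surv.
have mG : measurable [set w | k.+1%:R * d < Y e w].
  exact: measurable_ltr_set.
have /eqP := Pr_split P mA mG; rewrite -/(Q d k a) addrC -subr_eq => /eqP <-.
have -> : A `&` [set w | k.+1%:R * d < Y e w] =
          C `&` surv Y (e :: D) (thr (k.+1%:R * d) a).
  apply/seteqP; split=> w.
  - move=> [[Cw Hw] /= He]; split=> // x; rewrite inE => /predU1P[->|xD].
      by rewrite /thr eqxx.
    by have := Hw x; rewrite inE xD orbT /thr (negbTE (neD xD)) => ->.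
  - move=> [Cw Hw].
    have He : k.+1%:R * d < Y e w.
      by have := Hw e; rewrite mem_head /thr eqxx => ->.
    split=> //; split=> // x; rewrite inE => /predU1P[->|xD].
      rewrite /thr eqxx; apply: le_lt_trans He.
      by rewrite ler_wpM2r// ler_nat.
    by have := Hw x; rewrite inE xD orbT /thr (negbTE (neD xD)) => ->.
rewrite !Pr_thr// -!expRM_natl.
rewrite (_ : mu e * (k%:R * d) = - (k%:R * - (mu e * d))); last by ring.
rewrite (_ : mu e * (k.+1%:R * d) = - (k.+1%:R * - (mu e * d))); last by ring.
by rewrite !opprK; ring.
Qed.

Let T := (C `&` race_event Z e Y) `&` surv (race_residual Z e Y) B t.

Let mT : measurable T.
Proof.
apply: measurableI; last by apply: measurable_surv; exact: measurable_race_residual.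
by apply: measurableI => //; exact: measurable_race_event.
Qed.

Let Q_sub_T d k : 0 <= d -> Q d k (k.+1%:R * d) `<=` T.
Proof.
move=> d0 w [[Cw Hw] /= /negP]; rewrite -leNgt => He.
have HD x : x \in D -> t' x + (if x \in Z then k.+1%:R * d else 0) < Y x w.
  by move=> xD; have := Hw x; rewrite inE xD orbT /thr (negbTE (neD xD)) => ->.
split; first split=> //.
- move=> x xZ xe; have xD : x \in D by rewrite mem_cat mem_filter xe xZ andbT; case: (x \in B).
  apply: le_lt_trans (HD _ xD); rewrite xZ; apply: le_trans He _.
  by rewrite lerDr /t'; case: ifP.
- move=> x xB; have xD : x \in D by rewrite mem_cat xB.
  have := HD _ xD; rewrite /t' xB /race_residual; case: ifP => _.
    by move: He; lra.
  by rewrite addr0.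
Qed.

Let T_sub_Q d k w : T w -> k%:R * d < Y e w <= k.+1%:R * d ->
  Q d k (k%:R * d) w.
Proof.
move=> [[Cw Rw] Sw] /andP[lo hi]; split; last first.
  by apply/negP; rewrite -leNgt.
split=> // x; rewrite inE => /predU1P[->|xD]; first by rewrite /thr eqxx.
rewrite /thr (negbTE (neD xD)); move: xD; rewrite mem_cat => /orP[xB|].
  have := Sw _ xB; rewrite /race_residual /t' xB; case: ifP => _.
    by move: lo; lra.
  by rewrite addr0.
rewrite mem_filter => /andP[/andP[xB xe] xZ].
rewrite /t' (negbTE xB) add0r xZ; apply: lt_trans lo _; exact: Rw.
Qed.

(** The cells cover only positive values of the winning clock; this disposes of the others. *)
Let Pr_neg : Pr (C `\` [set w | 0 < Y e w]) = 0.
Proof.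
have mG : measurable [set w | 0 < Y e w] by exact: measurable_ltr_set.
have := Pr_split P mC mG.
have -> : C `&` [set w | 0 < Y e w] = C `&` surv Y [:: e] (fun=> 0).
  congr (_ `&` _); apply/seteqP; split=> w /=.
    by move=> H x; rewrite inE => /eqP ->.
  by apply; rewrite mem_head.
have := @expY [::] (fun=> 0) isT isT (fun=> lexx _).
rewrite (_ : C `&` surv Y [::] (fun=> 0) = C); last first.
  by apply/seteqP; split=> [w []//|w Cw]; split=> // x; rewrite in_nil.
rewrite big_nil => ->.
rewrite expY//; last by rewrite /= andbT; have /allP/(_ _ eZ) := aZ.
rewrite big_seq1 mulr0 oppr0 expR0 => /eqP.
by rewrite -subr_eq0 opprD addNKr oppr_eq0 => /eqP.
Qed.

Let Pr_tail d n : 0 <= d ->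
  Pr (C `&` [set w | n%:R * d < Y e w]) = c * expR (- (mu e * d)) ^+ n.
Proof.
move=> d0.
have -> : C `&` [set w | n%:R * d < Y e w] =
          C `&` surv Y [:: e] (fun=> n%:R * d).
  congr (_ `&` _); apply/seteqP; split=> w /=.
    by move=> H x; rewrite inE => /eqP ->.
  by apply; rewrite mem_head.
rewrite expY//; last 2 first.
- by rewrite /= andbT; have /allP/(_ _ eZ) := aZ.
- by move=> _; rewrite mulr_ge0.
rewrite big_seq1 -expRM_natl; congr (_ * expR _); ring.
Qed.

Let total := \sum_(x <- Z) mu x.

Let totalE : total = mu e + sigma.
Proof.
rewrite /total /sigma (bigD1_seq e)//=.
Qed.

Let sigma_ge0 : 0 <= sigma.
Proof. by apply: sumr_ge0 => x _; exact: ltW. Qed.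

Let total_gt0 : 0 < total.
Proof. by rewrite totalE ltr_pwDl. Qed.

(** A geometric series: one cell further costs the factor [expR (- (total * d))]. The second factor
    on the left avoids a division. [a0 = 0] selects the left ends of the cells, [a0 = d] the right
    ends. *)
Let sumQ (d a0 : R) n (a := fun k : nat => a0 + k%:R * d) : 0 <= d -> 0 <= a0 ->
  \sum_(k < n) Pr (Q d k (a k)) * (1 - expR (- (total * d))) =
  c * K * expR (- (sigma * a0)) * (1 - expR (- (mu e * d))) *
  (1 - expR (- (total * d)) ^+ n).
Proof.
move=> d0 a00; have aa k : 0 <= a k by rewrite addr_ge0// mulr_ge0.
have rE : expR (- (total * d)) = expR (- (mu e * d)) * expR (- (sigma * d)).
  by rewrite -expRD totalE; congr expR; ring.
rewrite -mulr_suml.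
have -> : \sum_(k < n) Pr (Q d k (a k)) =
   c * K * expR (- (sigma * a0)) * (1 - expR (- (mu e * d))) *
   \sum_(k < n) expR (- (total * d)) ^+ k.
  rewrite mulr_sumr; apply: eq_bigr => k _; rewrite Pr_Q//.
  rewrite rE exprMn exprS.
  have -> : expR (- (sigma * a k)) =
            expR (- (sigma * a0)) * expR (- (sigma * d)) ^+ k.
    by rewrite -expRM_natl -expRD; congr expR; rewrite /a; ring.
  ring.
have := subrX1 (expR (- (total * d))) n.
set q := \sum_(_ < _) _; set r := expR _ => H.
rewrite (_ : 1 - r ^+ n = (1 - r) * q); first by ring.
by rewrite -opprB H; ring.
Qed.

Lemma race_step_aux : Pr T = c * (mu e / total) * K.
Proof.
have K0 : 0 < K by exact: expR_gt0.
have me := mu_gt0 e.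
have rP d : 0 < d -> 0 <= expR (- (total * d)) < 1.
  by move=> d0; rewrite expR_ge0/= -expR0 ltr_expR oppr_lt0 mulr_gt0.
have pP d : 0 < d -> 0 <= expR (- (mu e * d)) < 1.
  by move=> d0; rewrite expR_ge0/= -expR0 ltr_expR oppr_lt0 mulr_gt0.
(* Left ends: the events [Q] cover [T] up to a null set and the tail beyond [n%:R * d], which
   vanishes as [n] grows. *)
have upper d : 0 < d ->
    Pr T * (1 - expR (- (total * d))) <= c * K * (1 - expR (- (mu e * d))).
  move=> d0; have d0' := ltW d0.
  have /andP[r0 r1] := rP _ d0; have /andP[p0 p1] := pP _ d0.
  apply: (@le_of_geometric _ _ _ c _ (pP _ d0)) => // n.
  have H : Pr T <= \sum_(k < n) Pr (Q d k (0 + k%:R * d)) +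
                   c * expR (- (mu e * d)) ^+ n.
    pose U1 := C `\` [set w | 0 < Y e w].
    pose U2 := [set w | exists2 k, (k < n)%N & Q d k (0 + k%:R * d) w].
    pose U3 := C `&` [set w | n%:R * d < Y e w].
    apply: (@le_trans _ _ (Pr U1 + (Pr U2 + Pr U3))); last first.
      rewrite Pr_neg add0r Pr_tail// lerD2r.
      exact: (Pr_subsum P n (fun k => mQ d k (0 + k%:R * d))).
    have m1 : measurable U1 by apply: measurableD => //; exact: measurable_ltr_set.
    have m2 : measurable U2.
      have := @measurable_bigU _ Omega _ (iota 0 n) _ (fun i _ => mQ d i (0 + i%:R * d)).
      congr (measurable _); apply/seteqP.
      by split=> w [i ik Fi]; exists i => //; move: ik; rewrite mem_iota add0n.
    have m3 : measurable U3 by apply: measurableI => //; exact: measurable_ltr_set.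
    apply: le_trans (lerD (lexx _) (Pr_subadd P m2 m3)).
    apply: le_trans (Pr_subadd P m1 (measurableU _ _ m2 m3)).
    apply: Pr_le => //; first by apply: measurableU => //; exact: measurableU.
    move=> w Tw; have [[Cw _] _] := Tw.
    have [y0|y0] := leP (Y e w) 0; first by left; split=> //; apply/negP; rewrite -leNgt.
    right; have [yn|yn] := leP (Y e w) (n%:R * d); last by right.
    have [k kn Hk] := cell_exists y0 yn.
    by left; exists k => //; rewrite add0r; exact: T_sub_Q.
  have H1 : (1 - expR (- (total * d))) <= 1 by rewrite lerBlDr lerDl.
  have H2 : 0 <= 1 - expR (- (total * d)) by rewrite subr_ge0 ltW.
  apply: le_trans (ler_wpM2r H2 H) _; rewrite mulrDl mulr_suml sumQ//.
  apply: lerD; last first.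
    by rewrite ler_piMr// mulr_ge0// exprn_ge0.
  rewrite mulr0 oppr0 expR0 mulr1; apply: ler_piMr.
    by rewrite !mulr_ge0// ?subr_ge0 ltW.
  by rewrite lerBlDr lerDl exprn_ge0.
(* Right ends: the events [Q] are disjoint parts of [T], and the missing end of the geometric series
   vanishes as [n] grows. *)
have lower d : 0 < d -> c * K * expR (- (sigma * d)) *
    (1 - expR (- (mu e * d))) <= Pr T * (1 - expR (- (total * d))).
  move=> d0; have d0' := ltW d0.
  have /andP[r0 r1] := rP _ d0; have /andP[p0 p1] := pP _ d0.
  set L := (X in X <= _).
  have L0 : 0 <= L by rewrite !mulr_ge0 ?expR_ge0 ?subr_ge0// ltW.
  apply: (@le_of_geometric _ _ _ L _ (rP _ d0)) => // n.
  have H : \sum_(k < n) Pr (Q d k (d + k%:R * d)) <= Pr T.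
    have <- : \sum_(k <- iota 0 n) Pr (Q d k (d + k%:R * d)) =
              \sum_(k < n) Pr (Q d k (d + k%:R * d)).
      by rewrite -{1}(subn0 n) -/(index_iota 0 n) big_mkord.
    rewrite -Pr_sum ?iota_uniq//.
    - apply: Pr_le => //; first exact: measurable_bigU.
      move=> w [k _]; have -> : d + k%:R * d = k.+1%:R * d by rewrite -natr1; ring.
      exact: Q_sub_T.
    - have lt_cell i j w : Q d i (d + i%:R * d) w -> Q d j (d + j%:R * d) w ->
          ~~ (i < j)%N.
        move=> [_ /= /negP]; rewrite -leNgt => hi [[_ Hj] _].
        have := Hj e; rewrite mem_head /thr eqxx => /(_ isT) lo.
        have := lt_le_trans lo hi; rewrite ltr_pM2r// ltr_nat ltnS.
        by rewrite -leqNgt.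
      move=> i j w _ _ Hi Hj; apply/eqP; rewrite eqn_leq.
      by apply/andP; split; rewrite leqNgt; apply: lt_cell; eassumption.
  rewrite -lerBlDr -{1}(mulr1 L) -mulrBr.
  have H2 : 0 <= 1 - expR (- (total * d)) by rewrite subr_ge0 ltW.
  apply: le_trans (ler_wpM2r H2 H); rewrite [leRHS]mulr_suml.
  by have /= -> := sumQ n d0' d0'.
have A0 : 0 <= c * K * (mu e / total).
  by rewrite mulr_ge0 ?divr_ge0 ?mulr_ge0// ltW.
have muT : mu e / total * total = mu e by rewrite divfK// gt_eqF.
(* [1 - expR (- x)] lies between [x / (1 + x)] and [x], so after division by [total * d] both bounds
   are within a constant multiple of [d] of the claim. *)
apply: (@eq_of_linear_error _ _ _ (c * K * (mu e / total) * total)).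
- by rewrite mulr_ge0// ltW.
- move=> d d0; have := upper d d0; have /andP[r0 r1] := rP _ d0.
  have p1 : 1 - expR (- (mu e * d)) <= mu e * d.
    by have := expR_ge1Dx (- (mu e * d)); lra.
  have r2 : expR (- (total * d)) * (1 + total * d) <= 1.
    by rewrite expRN mulrC ler_pdivrMr ?expR_gt0// mul1r expR_ge1Dx.
  have td : 0 < total * d by rewrite mulr_gt0.
  have cK : 0 <= c * K by rewrite mulr_ge0// ltW.
  have T0 := Pr_ge0 P T.
  move=> H; have {}H := le_trans H (ler_wpM2l cK p1).
  have H3 : Pr T * (total * d) <= c * K * (mu e * d) * (1 + total * d).
    have : Pr T * (total * d) <= Pr T * (1 - expR (- (total * d))) * (1 + total * d).
      rewrite -mulrA; apply: ler_wpM2l => //; move: r2; lra.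
    move=> /le_trans; apply; apply: ler_wpM2r => //; lra.
  rewrite -(ler_pM2r td); apply: le_trans H3 _; rewrite le_eqVlt; apply/orP; left.
  apply/eqP; move: muT; set m := mu e / total => muT; rewrite -muT; ring.
- move=> d d0; have := lower d d0; have /andP[r0 r1] := rP _ d0.
  have td : 0 < total * d by rewrite mulr_gt0.
  have T0 := Pr_ge0 P T.
  have r2 : 1 - expR (- (total * d)) <= total * d.
    by have := expR_ge1Dx (- (total * d)); lra.
  have sE : expR (- (total * d)) = expR (- (sigma * d)) * expR (- (mu e * d)).
    by rewrite -expRD totalE; congr expR; ring.
  have p1 : expR (- (mu e * d)) * (1 + mu e * d) <= 1.
    by rewrite expRN mulrC ler_pdivrMr ?expR_gt0// mul1r expR_ge1Dx.
  have s0 : 0 <= expR (- (sigma * d)) by exact: expR_ge0.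
  have cK : 0 <= c * K by rewrite mulr_ge0// ltW.
  have p2 : (1 - total * d) * (mu e * d) <=
            expR (- (sigma * d)) * (1 - expR (- (mu e * d))).
    apply: (@le_trans _ _ (expR (- (total * d)) * (mu e * d))).
      by apply: ler_wpM2r; [rewrite mulr_ge0// ltW|lra].
    rewrite sE -mulrA; apply: ler_wpM2l => //; lra.
  move=> H; have H4 := le_trans H (ler_wpM2l T0 r2).
  rewrite -(ler_pM2r td) mulrDl -lerBlDr.
  have H6 : c * K * ((1 - total * d) * (mu e * d)) <= Pr T * (total * d).
    by apply: le_trans (ler_wpM2l cK p2) _; rewrite [leLHS]mulrA.
  apply: le_trans _ H6; rewrite le_eqVlt; apply/orP; left; apply/eqP.
  move: muT; set m := mu e / total => muT; rewrite -muT; ring.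
Qed.
End Cells.

(** Memorylessness: [e] wins with probability its share of the total rate, and the residuals of the
    other clocks start afresh, independently of that win. A race is not a box in the clocks, so the
    joint survival functions do not evaluate it directly; it is approximated by cutting the value of
    the winning clock into cells. *)
Lemma race_step :
  exp_clocks (C `&` race_event Z e Y) (c * (mu e / \sum_(x <- Z) mu x))
    (predI alive (predC1 e)) (race_residual Z e Y).
Proof. by move=> B t uB aB t0; exact: race_step_aux. Qed.
End RaceStep.

(** * Independence of the primitives *)

Section DynkinIndependence.
Context {disp : measure_display} {Omega : measurableType disp} {R : realType}.
Variable P : probability Omega R.
Local Notation Pr := (Pr P).

(** The sets independent of [F] form a Dynkin class, so independence passes from a pi-system to the
    sigma-algebra it generates. *)
Lemma dynkin_independence (G : set (set Omega)) (F : set Omega) (c : R) :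
  setI_closed G -> G setT -> (forall E, G E -> measurable E) ->
  measurable F -> (forall E, G E -> Pr (E `&` F) = Pr E * c) ->
  forall E, <<s G >> E -> measurable E /\ Pr (E `&` F) = Pr E * c.
Proof.
move=> GI GT mG mF GF E.
(* As [setT] lies in [G], the factor [c] is the probability of [F]; closure under complements rests
   on this. *)
have cE : Pr F = c by have := GF _ GT; rewrite setTI PrT mul1r.
have c0 : 0 <= c by rewrite -cE; exact: Pr_ge0.
rewrite -(setI_closed_g_dynkin_g_sigma_algebra GI).
pose H := [set E | measurable E /\ Pr (E `&` F) = Pr E * c].
apply: (smallest_sub (_ : dynkin H)) => {E}; last first.
  by move=> E GE; split; [exact: mG|exact: GF].
split.
- by split => //; exact: GF.
- move=> E [mE HE]; split; first exact: measurableC.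
  have := Pr_split P mF mE; have := Pr_split P measurableT mE.
  rewrite setTI setTD PrT setIC HE setDE [F `&` _]setIC cE.
  by move=> H1 H2; rewrite -[LHS](addKr (Pr E * c)) -H2; nra.
- move=> E tE HE; have mE k : measurable (E k) by case: (HE k).
  split; first exact: bigcup_measurable.
  apply: EFin_inj; rewrite EFinM -!PrE; last 2 first.
  + exact: bigcup_measurable.
  + by apply: measurableI => //; exact: bigcup_measurable.
  have m1 : measurable (\bigcup_n E n) by exact: bigcup_measurable.
  have m3 k : measurable (E k `&` F) by exact: measurableI.
  have m2 : measurable (\bigcup_n (E n `&` F)) by exact: bigcup_measurable.
  have t3 : trivIset setT (fun k => E k `&` F) by exact: trivIset_setIr.
  rewrite setI_bigcupl !measure_semi_bigcup//.
  rewrite muleC -nneseriesZl//; apply: eq_eseriesr => k _.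
  transitivity (Pr (E k `&` F))%:E; first by apply: PrE.
  by rewrite (HE k).2 mulrC EFinM; congr (_ * _)%E; rewrite -PrE.
Qed.
End DynkinIndependence.

Section ExponentialTail.
Context {disp : measure_display} {Omega : measurableType disp} {R : realType}.
Variable P : probability Omega R.

Lemma exponential_tail (Y : Omega -> R) (mu t : R) : measurable_fun setT Y ->
  0 < mu -> (forall A, measurable A -> P (Y @^-1` A) = exponential_prob mu A) ->
  0 <= t -> Pr P [set w | t < Y w] = expR (- (mu * t)).
Proof.
move=> mY mu0 lawY t0.
have mA A : measurable A -> measurable (Y @^-1` A).
  by move=> ?; rewrite -[X in measurable X]setTI; exact: mY.
have neg : Pr P (Y @^-1` `]-oo, 0[) = 0.
  rewrite /Pr lawY// /exponential_prob integral0_eq// => x /=.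
  by rewrite in_itv/= => x0; rewrite lt0_exponential_pdf.
have pos s : 0 < s -> Pr P (Y @^-1` `[0, s]) = 1 - expR (- (mu * s)).
  move=> s0; rewrite /Pr lawY// exponential_prob_itv0c// mulNr.
  by rewrite -EFinB.
have zero : Pr P (Y @^-1` [set 0]) = 0.
  by rewrite /Pr lawY// /exponential_prob integral_set1.
have half : Pr P (Y @^-1` `]-oo, t]) = 1 - expR (- (mu * t)).
  (* The formula [pos] asks for a positive right end, so [t = 0] is pieced together from the
     negative half-line and the null point 0. *)
  have [->|tn0] := eqVneq t 0.
    rewrite mulr0 oppr0 expR0 subrr.
    transitivity (Pr P (Y @^-1` `]-oo, 0[ `|` Y @^-1` [set 0])).
      congr (Pr _ _); apply/seteqP; split=> w /=; rewrite !in_itv/= le_eqVlt.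
        by move=> /predU1P[->|->]; [right|left].
      by case=> [->|->]; rewrite ?orbT ?eqxx.
    rewrite PrU; [by rewrite neg zero addr0|exact: mA|exact: mA|].
    by move=> w /=; rewrite in_itv/= => lt0 e0; move: lt0; rewrite e0 ltxx.
  have tp : 0 < t by rewrite lt_def tn0.
  transitivity (Pr P (Y @^-1` `]-oo, 0[ `|` Y @^-1` `[0, t])).
    congr (Pr _ _); apply/seteqP; split=> w /=; rewrite !in_itv/=.
      by move=> ->; rewrite andbT; case: (ltP (Y w) 0); [left|right].
    by case=> [/ltW/le_trans->//|/andP[]//]; exact: ltW.
  rewrite PrU; [by rewrite neg pos// add0r|exact: mA|exact: mA|].
  by move=> w /=; rewrite !in_itv/= ltNge => /negP h /andP[].
have mE : measurable [set w | t < Y w] by exact: measurable_ltr_set.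
have := Pr_split P (@measurableT _ Omega) mE; rewrite PrT setTI.
have -> : setT `\` [set w | t < Y w] = Y @^-1` `]-oo, t].
  apply/seteqP; split=> w /=; rewrite in_itv/=.
    by move=> [_ /negP]; rewrite -leNgt.
  by move=> h; split=> //; apply/negP; rewrite -leNgt.
rewrite half; lra.
Qed.
End ExponentialTail.

Section PrimitiveIndependence.
Context {disp : measure_display} {Omega : measurableType disp} {R : realType}.
Context {P : probability Omega R} {d : nat} {lambda : R} {f : rvec R d -> R}.
Variable sys : primitives P lambda f.
Hypothesis lambda_gt0 : 0 < lambda.
Local Notation Pr := (Pr P).
Local Notation V := (requirement sys).

(* [inl j] is the service clock of job [j], [inr n] the [n]-th arrival clock. *)
Definition clk := (nat + nat)%type.

Definition clock0 (x : clk) : Omega -> R :=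
  match x with inl j => duration sys j | inr n => interarrival sys n end.

Definition rate (x : clk) : R := if x is inl _ then 1 else lambda.

Lemma rate_gt0 x : 0 < rate x.
Proof. by case: x => //= _. Qed.

Lemma measurable_clock0 x : measurable_fun setT (clock0 x).
Proof. by case: x => n /=; exact: measurable_funPT. Qed.

Definition cylinder (m : nat) (B : nat -> set (rvec R d)) : set Omega :=
  [set w | forall n, (n < m)%N -> B n (V n w)].

Definition cylinders m : set (set Omega) :=
  [set E | exists2 B, (forall n, measurable (B n)) & E = cylinder m B].

Definition sigV m := <<s cylinders m >>.

Lemma measurable_V n B : measurable B -> measurable (V n @^-1` B).
Proof.
by move=> mB; rewrite -[X in measurable X]setTI; exact: measurable_funPT.
Qed.

Lemma measurable_cylinder m B : (forall n, measurable (B n)) ->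
  measurable (cylinder m B).
Proof.
move=> mB.
have := @measurable_all _ Omega _ (iota 0 m) (fun n => V n @^-1` B n)
  (fun n _ => measurable_V n (mB n)).
congr (measurable _); apply/seteqP.
by split=> w H n; have := H n; rewrite /= mem_iota add0n.
Qed.

Lemma cylindersI m : setI_closed (cylinders m).
Proof.
move=> _ _ [B mB ->] [B' mB' ->]; exists (fun n => B n `&` B' n).
  by move=> n; exact: measurableI.
apply/seteqP; split=> w.
  by move=> [H H'] n nm; split; [exact: H|exact: H'].
by move=> H; split=> n /H [].
Qed.

Lemma cylindersT m : cylinders m setT.
Proof. by exists (fun=> setT) => //; apply/seteqP; split. Qed.

Lemma sigV_V m n B : (n < m)%N -> measurable B -> sigV m (V n @^-1` B).
Proof.
move=> nm mB; apply: sub_sigma_algebra.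
exists (fun k => if k == n then B else setT); first by move=> k; case: eqP.
apply/seteqP; split=> w /=.
  by move=> H k _; case: eqP => [->|].
by move=> /(_ n nm); rewrite eqxx.
Qed.

Lemma sigV_mono m m' : (m <= m')%N -> sigV m `<=` sigV m'.
Proof.
move=> mm'; apply: smallest_sub; first exact: smallest_sigma_algebra.
move=> _ [B mB ->]; apply: sub_sigma_algebra.
exists (fun n => if (n < m)%N then B n else setT).
  by move=> n; case: ifP.
apply/seteqP; split=> w H n nm; first by case: ifP => // nm'; exact: H.
by have := H n (leq_trans nm mm'); rewrite nm.
Qed.

Let a (Bs : seq clk) (t : clk -> R) x : set R :=
  if x \in Bs then `]t x, +oo[%classic else setT.

Let Pr_a Bs t x : (forall x, 0 <= t x) ->
  Pr (clock0 x @^-1` a Bs t x) =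
  if x \in Bs then expR (- (rate x * t x)) else 1.
Proof.
move=> t0; rewrite /a; case: ifP => _; last by rewrite preimage_setT PrT.
have -> : clock0 x @^-1` `]t x, +oo[ = [set w | t x < clock0 x w].
  by apply/seteqP; split=> w /=; rewrite in_itv/= andbT.
apply: exponential_tail => //; first exact: measurable_clock0.
  exact: rate_gt0.
by case: x => n A mA /=; [exact: duration_law|exact: interarrival_law].
Qed.

Let ma Bs t x : measurable (a Bs t x).
Proof. by rewrite /a; case: ifP. Qed.

Let mca Bs t x : measurable (clock0 x @^-1` a Bs t x).
Proof.
rewrite -[X in measurable X]setTI; apply: measurable_clock0 => //.
Qed.

Lemma Pr_cylinder_surv m B Bs t : (forall n, measurable (B n)) ->
  uniq Bs -> (forall x, 0 <= t x) ->
  Pr (cylinder m B `&` surv clock0 Bs t) =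
  (\prod_(n < m) Pr (V n @^-1` B n)) * expR (- \sum_(x <- Bs) rate x * t x).
Proof.
move=> mB uBs t0.
pose idx (x : clk) := match x with inl j => j | inr n => n end.
(* [N] exceeds every index that occurs, so the finite product law sees all constraints; the
   remaining coordinates receive the full set. *)
pose N := (m + (\max_(x <- Bs) idx x).+1)%N.
have ltN x : x \in Bs -> (idx x < N)%N.
  by move=> xB; rewrite /N addnS ltnS (leq_trans _ (leq_addl _ _))// leq_bigmax_seq.
pose B' n := if (n < m)%N then B n else setT.
have mB' n : measurable (B' n) by rewrite /B'; case: ifP.
have := primitives_independent sys N (fun n => ma Bs t (inr n)) mB'
  (fun n => ma Bs t (inl n)).
set E := (X in P X = _); move=> HE.
have -> : cylinder m B `&` surv clock0 Bs t = E.
  apply/seteqP; split=> w.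
  - move=> [Hc Hs] n nN; split.
    + by rewrite /a; case: ifP => // /Hs /=; rewrite in_itv/= andbT.
    + by rewrite /B'; case: ifP => // /Hc.
    + by rewrite /a; case: ifP => // /Hs /=; rewrite in_itv/= andbT.
  - move=> H; split=> [n nm|x xB].
      have nN : (n < N)%N by rewrite (leq_trans nm)// leq_addr.
      by have [_ + _] := H n nN; rewrite /B' nm.
    have := H _ (ltN _ xB); case: x xB => n xB [/= H1 _ H2].
      by move: H2; rewrite /a xB /= in_itv/= andbT.
    by move: H1; rewrite /a xB /= in_itv/= andbT.
rewrite /Pr HE.
have -> : (\prod_(n < N) (P (interarrival sys n @^-1` a Bs t (inr (nat_of_ord n))) *
   P (V n @^-1` B' n) * P (duration sys n @^-1` a Bs t (inl (nat_of_ord n)))))%E =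
   (\prod_(n < N) (Pr (clock0 (inr (nat_of_ord n)) @^-1` a Bs t (inr (nat_of_ord n))) *
      Pr (V n @^-1` B' n) * Pr (clock0 (inl (nat_of_ord n)) @^-1` a Bs t (inl (nat_of_ord n)))))%:E.
  rewrite -prodEFin; apply: eq_bigr => n _; rewrite !EFinM.
  congr (_ * _ * _)%E; apply: PrE; first exact: (mca Bs t (inr (nat_of_ord n))).
    exact: measurable_V.
  exact: (mca Bs t (inl (nat_of_ord n))).
rewrite /= !big_split/= mulrAC mulrC; congr (_ * _).
  rewrite /N big_split_ord /= [X in _ * X]big1 ?mulr1.
    by apply: eq_bigr => i _; rewrite /B' ltn_ord.
  by move=> i _; rewrite /B' ltnNge leq_addr/= preimage_setT PrT.
pose S := map (@inr nat nat) (iota 0 N) ++ map (@inl nat nat) (iota 0 N).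
transitivity (\prod_(x <- S) (if x \in Bs then expR (- (rate x * t x)) else 1)).
  have -> : S = map (@inr nat nat) (index_iota 0 N) ++
              map (@inl nat nat) (index_iota 0 N) by rewrite /index_iota subn0.
  rewrite big_cat !big_map !big_mkord.
  by congr (_ * _); apply: eq_bigr => i _;
    [exact: (Pr_a _ (inr _))|exact: (Pr_a _ (inl _))].
rewrite -big_mkcond -big_filter.
transitivity (\prod_(x <- Bs) expR (- (rate x * t x))); last first.
  rewrite -sumrN; elim: (Bs) => [|x s IH]; first by rewrite !big_nil expR0.
  by rewrite !big_cons expRD IH.
apply: perm_big; apply: uniq_perm => //.
  rewrite filter_uniq// cat_uniq !map_inj_uniq ?iota_uniq; last 2 first.
  - by move=> ? ? [].
  - by move=> ? ? [].
  by rewrite andbT; apply/hasPn => _ /mapP[n _ ->]; apply/mapP => -[].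
move=> x; rewrite mem_filter; case xB: (x \in Bs) => //=.
have := ltN _ xB; rewrite mem_cat; case: x xB => n /= xB nN; apply/orP.
  by right; apply: map_f; rewrite mem_iota.
by left; apply: map_f; rewrite mem_iota.
Qed.

Lemma Pr_cylinder m B : (forall n, measurable (B n)) ->
  Pr (cylinder m B) = \prod_(n < m) Pr (V n @^-1` B n).
Proof.
move=> mB; have := @Pr_cylinder_surv m B [::] (fun=> 0) mB isT (fun=> lexx _).
rewrite big_nil oppr0 expR0 mulr1 => <-; congr Pr.
by apply/seteqP; split=> [w ?|w []//]; split=> // x; rewrite in_nil.
Qed.

Lemma measurable_sigV m E : sigV m E -> measurable E.
Proof.
move=> /(_ measurable); apply; split; first exact: sigma_algebra_measurable.
by move=> _ [B mB ->]; exact: measurable_cylinder.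
Qed.

(** An event about requirements leaves all clocks exponential and independent: this is the starting
    point of every sequence of races. *)
Lemma sigV_exp_clocks m E : sigV m E ->
  exp_clocks P rate E (Pr E) predT clock0.
Proof.
move=> sE B t uB _ t0.
apply: (dynkin_independence (@cylindersI m) (@cylindersT m) _ _ _ sE).2.
- by move=> _ [C mC ->]; exact: measurable_cylinder.
- by apply: measurable_surv; exact: measurable_clock0.
- by move=> _ [C mC ->]; rewrite Pr_cylinder_surv// Pr_cylinder.
Qed.

Lemma sigV_next m E B : sigV m E -> measurable B ->
  Pr (E `&` V m @^-1` B) = Pr E * Pr (V m @^-1` B).
Proof.
move=> sE mB.
apply: (dynkin_independence (@cylindersI m) (@cylindersT m) _ _ _ sE).2.
- by move=> _ [C mC ->]; exact: measurable_cylinder.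
- exact: measurable_V.
- move=> _ [C mC ->].
  pose C' n := if (n < m)%N then C n else B.
  have mC' n : measurable (C' n) by rewrite /C'; case: ifP.
  have -> : cylinder m C `&` V m @^-1` B = cylinder m.+1 C'.
    apply/seteqP; split=> w.
      move=> [H Hm] n; rewrite ltnS leq_eqVlt => /predU1P[->|nm].
        by rewrite /C' ltnn.
      by rewrite /C' nm; exact: H.
    move=> H; split=> [n nm|].
      by have := H n (leqW nm); rewrite /C' nm.
    by have := H m (ltnSn m); rewrite /C' ltnn.
  rewrite !Pr_cylinder// big_ord_recr /= /C' ltnn; congr (_ * _).
  by apply: eq_bigr => i _; rewrite ltn_ord.
Qed.

Lemma sigVI m E F : sigV m E -> sigV m F -> sigV m (E `&` F).
Proof.
move=> sE sF; exact: (@measurableI _ (g_sigma_algebraType (cylinders m))).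
Qed.
End PrimitiveIndependence.

(** * Successive races and their weights *)

Section Races.
Context {disp : measure_display} {Omega : measurableType disp} {R : realType}.
Variables (P : probability Omega R) (X : eqType) (mu : X -> R).
Hypothesis mu_gt0 : forall x, 0 < mu x.
Variable Y0 : X -> Omega -> R.
Hypothesis mY0 : forall x, measurable_fun setT (Y0 x).
Local Notation Pr := (Pr P).

(* A race record is the list, latest race first, of the clocks that ran and of
   the one that rang first. *)
Definition race_record := seq (seq X * X).

Fixpoint residual (r : race_record) : X -> Omega -> R :=
  if r is (Z, e) :: r' then race_residual Z e (residual r') else Y0.

Fixpoint races (r : race_record) : set Omega :=
  if r is (Z, e) :: r' then races r' `&` race_event Z e (residual r') else setT.

Fixpoint weight (r : race_record) : R :=
  if r is (Z, e) :: r' then weight r' * (mu e / \sum_(x <- Z) mu x) else 1.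

Definition winners (r : race_record) : seq X := map snd r.

(** A clock that has won is spent and may enter no later race. *)
Fixpoint valid_record (r : race_record) : bool :=
  if r is (Z, e) :: r' then
    [&& valid_record r', uniq Z, e \in Z & all [predC winners r'] Z]
  else true.

Lemma measurable_residual r x : measurable_fun setT (residual r x).
Proof.
elim: r x => [|[Z e] r IH] x //=; exact: measurable_race_residual.
Qed.

Lemma measurable_races r : measurable (races r).
Proof.
elim: r => [|[Z e] r IH] //=; apply: measurableI => //.
by apply: measurable_race_event; exact: measurable_residual.
Qed.

Lemma races_exp_clocks E r : measurable E ->
  exp_clocks P mu E (Pr E) predT Y0 -> valid_record r ->
  exp_clocks P mu (E `&` races r) (Pr E * weight r) [predC winners r]
    (residual r).
Proof.
move=> mE expE; elim: r => [|[Z e] r IH] /=.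
  by move=> _ B t uB _ t0; rewrite setIT mulr1; apply: expE => //; apply/allP.
move=> /and4P[vr uZ eZ aZ] B t uB aB t0.
rewrite setIA mulrA.
apply: (race_step mu_gt0 _ _ (IH vr) uZ aZ eZ) => //.
- by apply: measurableI => //; exact: measurable_races.
- exact: measurable_residual.
- apply/allP => x xB; have /allP/(_ _ xB) := aB.
  by rewrite /= inE negb_or => /andP[-> ->].
Qed.
End Races.

(** * Histories *)

Section Histories.
Context {disp : measure_display} {Omega : measurableType disp} {R : realType}.
Context {P : probability Omega R} {d : nat} {lambda : R} {f : rvec R d -> R}.
Variables (sys : primitives P lambda f) (pi : policy R d).
Variables (K : 'I_d -> nat) (i0 : job_type K).
Local Notation V := (requirement sys).
Local Notation Y := (residual (clock0 sys)).

(* A history lists the events, latest first. An event records the indices of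
   the jobs in service just before it, and either the index of the departing
   job or the type of the arriving one. *)
Definition label := (seq nat * (nat + job_type K))%type.
Definition history := seq label.

Fixpoint arrival_types (p : history) : seq (job_type K) :=
  match p with
  | (_, inr i) :: p' => rcons (arrival_types p') i
  | (_, inl _) :: p' => arrival_types p'
  | [::] => [::]
  end.

Definition arrivals p := size (arrival_types p).

Fixpoint ids (p : history) : seq nat :=
  match p with
  | (_, inl j) :: p' => [seq x <- ids p' | x != j]
  | (_, inr _) :: p' => rcons (ids p') (arrivals p')
  | [::] => [::]
  end.

Definition typ p j := nth i0 (arrival_types p) j.

Definition racers p (s : seq nat) : seq clk := inr (arrivals p) :: map inl s.

Definition winner p (e : nat + job_type K) : clk :=
  if e is inl j then inl j else inr (arrivals p).

Fixpoint record (p : history) : race_record clk :=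
  if p is (s, e) :: p' then (racers p' s, winner p' e) :: record p' else [::].

Definition sel (l : seq (rvec R d)) : seq nat :=
  [seq val i | i <- enum (pi (in_tuple l))].

(** The policy answers with positions in the current list; these are the corresponding job indices,
    still in arrival order. *)
Definition served_ids p w : seq nat :=
  [seq j <- ids p | index j (ids p) \in sel [seq V j w | j <- ids p]].

Fixpoint choices (p : history) : set Omega :=
  match p with
  | (s, e) :: p' =>
    (choices p' `&` [set w | served_ids p' w = s]) `&`
    (if e is inr i then [set w | of_type i (V (arrivals p') w)] else setT)
  | [::] => setT
  end.

Definition follows p := choices p `&` races (clock0 sys) (record p).

(** The third condition stops a history at the first return to the empty state: only the empty
    history or one with jobs present may be extended. *)
Fixpoint hist_ok (p : history) : bool :=
  if p is (s, e) :: p' then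
    [&& hist_ok p', subseq s (ids p'), (p' == [::]) || (ids p' != [::])
      & if e is inl j then j \in s else true]
  else true.

Fixpoint hclock (p : history) (w : Omega) : R :=
  if p is (_, e) :: p' then hclock p' w + Y (record p') (winner p' e) w else 0.

Definition cfg p w : config :=
  Config (hclock p w) (arrivals p) (Y (record p) (inr (arrivals p)) w)
    [seq (V j w, Y (record p) (inl j) w) | j <- ids p].

Lemma ids_lt p j : j \in ids p -> (j < arrivals p)%N.
Proof.
elim: p => [|[s [k|i]] p IH] //=.
  by rewrite mem_filter => /andP[_ /IH].
rewrite mem_rcons inE /arrivals /= size_rcons ltnS => /predU1P[->//|/IH].
exact: ltnW.
Qed.

Lemma ids_uniq p : uniq (ids p).
Proof.
elim: p => [|[s [k|i]] p IH] //=; first exact: filter_uniq.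
rewrite rcons_uniq IH andbT; apply/negP => /ids_lt; by rewrite ltnn.
Qed.

Lemma winners_lt p : hist_ok p ->
  (forall j, inl j \in winners (record p) -> (j < arrivals p)%N) /\
  (forall n, inr n \in winners (record p) -> (n < arrivals p)%N).
Proof.
elim: p => [|[s e] p IH] //= /and4P[ok sub _ eS].
have [IH1 IH2] := IH ok; split=> n; rewrite inE => /predU1P[].
- case: e eS => [j jS [->]|//]; rewrite /arrivals /=.
  by apply: ids_lt; exact: (mem_subseq sub jS).
- by move=> /IH1; rewrite /arrivals; case: e eS => //= i _; rewrite size_rcons; exact: ltnW.
- by case: e eS => [//|i _ [->]]; rewrite /arrivals /= size_rcons.
- by move=> /IH2; rewrite /arrivals; case: e eS => //= i _; rewrite size_rcons; exact: ltnW.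
Qed.

Lemma arrivals_alive p : hist_ok p -> inr (arrivals p) \notin winners (record p).
Proof.
by move=> ok; apply/negP => /(winners_lt ok).2; rewrite ltnn.
Qed.

Lemma ids_alive p j : hist_ok p -> j \in ids p -> inl j \notin winners (record p).
Proof.
elim: p => [|[s e] p IH] //= /and4P[ok sub _ eS].
case: e eS => [k kS|i _] /=; rewrite inE negb_or.
  by rewrite mem_filter => /andP[jk /(IH ok) ->]; rewrite andbT.
rewrite mem_rcons inE => /predU1P[->|/(IH ok) -> //].
by rewrite /=; apply/negP => /(winners_lt ok).1; rewrite ltnn.
Qed.

Lemma racers_uniq p s : subseq s (ids p) -> uniq (racers p s).
Proof.
move=> sub; rewrite /= map_inj_uniq ?(subseq_uniq sub) ?ids_uniq//; last by move=> ? ? [].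
by rewrite andbT; apply/mapP => -[].
Qed.

Lemma racers_alive p s : hist_ok p -> subseq s (ids p) ->
  all [predC winners (record p)] (racers p s).
Proof.
move=> ok sub; rewrite /= arrivals_alive//=; apply/allP => _ /mapP[j jS ->] /=.
by apply: ids_alive => //; exact: (mem_subseq sub).
Qed.

Lemma winner_racer p s e : (if e is inl j then j \in s else true) ->
  winner p e \in racers p s.
Proof.
case: e => [j jS|i _] /=; last exact: mem_head.
by rewrite inE; apply: map_f.
Qed.

Lemma record_valid p : hist_ok p -> valid_record (record p).
Proof.
elim: p => [|[s e] p IH] //= /and4P[ok sub _ eS]; rewrite IH//=.
have := racers_uniq sub; rewrite /= => ->.
have := racers_alive ok sub; rewrite /= => ->.
by rewrite andbT; exact: winner_racer.
Qed.

(** The clocks of jobs yet to arrive and of later interarrival times have taken part in no race. *)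
Lemma residual_future p : hist_ok p ->
  (forall j w, (arrivals p <= j)%N -> Y (record p) (inl j) w = duration sys j w) /\
  (forall n w, (arrivals p < n)%N -> Y (record p) (inr n) w = interarrival sys n w).
Proof.
elim: p => [|[s e] p IH] //= /and4P[ok sub _ eS].
have [IH1 IH2] := IH ok.
have le : (arrivals p <= arrivals ((s, e) :: p))%N.
  by rewrite /arrivals; case: (e) => //= i; rewrite size_rcons.
split=> n w lt; rewrite /race_residual ifF.
- by rewrite IH1// (leq_trans le).
- apply/negP; rewrite inE => /=/mapP[j jS [nj]].
  have := ids_lt (mem_subseq sub jS); rewrite -nj ltnNge => /negP; apply.
  exact: leq_trans lt.
- by rewrite IH2// (leq_ltn_trans le).
- apply/negP; rewrite inE => /predU1P[[nE]|/mapP[]//].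
  by move: (leq_ltn_trans le lt); rewrite nE ltnn.
Qed.

Lemma typ_cons s e p j : (j < arrivals p)%N -> typ ((s, e) :: p) j = typ p j.
Proof. by move=> jp; rewrite /typ; case: e => //= i; rewrite nth_rcons jp. Qed.

Lemma typ_arrival s i p : typ ((s, inr i) :: p) (arrivals p) = i.
Proof. by rewrite /typ /= nth_rcons ltnn eqxx. Qed.

Lemma choices_types p w j : choices p w -> (j < arrivals p)%N -> of_type (typ p j) (V j w).
Proof.
elim: p j => [|[s e] p IH] j //= [[pw _] ew].
have [jp|jp] := ltnP j (arrivals p); first by rewrite typ_cons// => _; exact: IH.
case: e ew => [k|i] /= ew; rewrite /arrivals /= => jp'.
  by move: (leq_ltn_trans jp jp'); rewrite ltnn.
move: jp'; rewrite size_rcons ltnS -/(arrivals p) => jp'.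
have -> : j = arrivals p by apply/eqP; rewrite eqn_leq jp' jp.
by rewrite typ_arrival.
Qed.

Lemma sel_mem N (x : N.-tuple (rvec R d)) (n : 'I_N) :
  (n \in pi x) = (val n \in sel x).
Proof.
case: x => l Hl; have E := eqP Hl; subst N.
have -> : Tuple Hl = in_tuple l by apply: val_inj.
by rewrite /sel /= mem_map ?mem_enum//; exact: val_inj.
Qed.

Lemma served_ids_subseq p w : subseq (served_ids p w) (ids p).
Proof. exact: filter_subseq. Qed.

Lemma served_served_ids p w (js := jobs (cfg p w)) (n : 'I_(size js)) :
  (n \in served pi js) = (nth 0%N (ids p) n \in served_ids p w).
Proof.
have sz : (n < size (ids p))%N.
  by apply: leq_trans (ltn_ord n) _; rewrite /js /= size_map.
rewrite /served sel_mem /= /served_ids mem_filter mem_nth// andbT.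
rewrite index_uniq ?ids_uniq//; congr (_ \in sel _).
by rewrite /js /= -map_comp; apply: eq_map.
Qed.

Lemma tnth_cfg p w (js := jobs (cfg p w)) (n : 'I_(size js)) :
  tnth (in_tuple js) n =
  (V (nth 0%N (ids p) n) w, Y (record p) (inl (nth 0%N (ids p) n)) w).
Proof.
have sz : (n < size (ids p))%N.
  by apply: leq_trans (ltn_ord n) _; rewrite /js /= size_map.
rewrite (tnth_nth (V 0%N w, 0)) /= /js /=.
by rewrite (nth_map 0%N).
Qed.

Lemma ids_nth p w (js := jobs (cfg p w)) :
  [seq nth 0%N (ids p) (val n) | n <- enum 'I_(size js)] = ids p.
Proof.
rewrite (map_comp (nth 0%N (ids p)) val) val_enum_ord /js /= size_map.
by rewrite map_nth_iota0// take_size.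
Qed.

Definition positive_clocks : set Omega := [set w | forall x, 0 < clock0 sys x w].

Lemma racers_min p s e w : follows ((s, e) :: p) w -> hist_ok ((s, e) :: p) ->
  forall x, x \in racers p s ->
  Y (record p) (winner p e) w <= Y (record p) x w.
Proof.
move=> [_ [_ Hr]] _ x xS; have [->//|xe] := eqVneq x (winner p e).
by apply: ltW; exact: Hr.
Qed.

Lemma time_to_event_cfg p s e w : follows ((s, e) :: p) w -> hist_ok ((s, e) :: p) ->
  time_to_event pi (cfg p w) = Y (record p) (winner p e) w.
Proof.
move=> Hev ok; have Hmin := racers_min Hev ok.
have srvS : served_ids p w = s by case: Hev => [[[_ ->]]].
apply/eqP; rewrite eq_le; apply/andP; split.
- apply/bigmin_leP => /=; case: e Hev ok Hmin => [j|i] Hev ok Hmin; last by left.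
  right; have jS : j \in s by case/and4P: ok.
  have jids : j \in ids p by case/and4P: ok => _ /mem_subseq/(_ _ jS).
  have lt : (index j (ids p) < size (jobs (cfg p w)))%N.
    by rewrite size_map index_mem.
  exists (Ordinal lt).
    by rewrite served_served_ids srvS /= nth_index.
  by rewrite tnth_cfg /= nth_index.
- apply/bigmin_geP; split=> [|n]; first by apply: Hmin; exact: mem_head.
  rewrite served_served_ids srvS tnth_cfg /= => nS; apply: Hmin.
  by rewrite inE; apply: map_f.
Qed.

Lemma remaining_jobs_cfg p w : remaining_jobs pi (cfg p w) =
  [seq j <- [seq (V j w, if j \in served_ids p w
                  then Y (record p) (inl j) w - time_to_event pi (cfg p w)
                  else Y (record p) (inl j) w) | j <- ids p] | 0 < j.2].
Proof.
rewrite /remaining_jobs; apply: congr1.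
rewrite -[in RHS](ids_nth p w) -map_comp; apply: eq_map => n.
by rewrite tnth_cfg served_served_ids.
Qed.

Lemma positive_residual p w : positive_clocks w -> hist_ok p -> follows p w ->
  forall x, x \notin winners (record p) -> 0 < Y (record p) x w.
Proof.
move=> pos; elim: p => [|[s e] p IH]; first by move=> _ _ x _; exact: pos.
move=> ok [[[pw _] _] [rw rew]] x; rewrite /= inE negb_or => /andP[xe xw].
rewrite /race_residual; case: ifP => xS.
  by rewrite subr_gt0; exact: rew.
by apply: IH => //; case/and4P: ok.
Qed.

(** The actual dynamics agree with the bookkeeping of the history: strict races make the winner the
    only event of its step, and positive clocks keep every other job in the list. *)
Lemma config_afterE p w : positive_clocks w -> hist_ok p -> follows p w ->
  config_after sys pi w (size p) = cfg p w.
Proof.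
move=> pos; elim: p => [|[s e] p IH] // ok Hev.
have Hev' : follows p w by case: Hev => [[[pw _] _] [rw _]].
have okp : hist_ok p by case/and4P: ok.
rewrite -[LHS]/(next_event sys pi w (config_after sys pi w (size p))).
rewrite IH//.
have hE := time_to_event_cfg Hev ok.
have srvS : served_ids p w = s by case: Hev => [[[_ ->]]].
have posp := positive_residual pos okp Hev'.
have sub : subseq s (ids p) by case/and4P: ok.
have remE : remaining_jobs pi (cfg p w) =
    [seq (V j w, Y (record ((s, e) :: p)) (inl j) w) | j <- ids p &
       (inl j != winner p e)].
  rewrite remaining_jobs_cfg srvS hE filter_map.
  rewrite (eq_in_filter (a2 := fun j => inl j != winner p e)); last first.
    move=> j jids /=; have jA := ids_alive okp jids.
    case: ifP => jS.
      have [->|ne] := eqVneq (inl j) (winner p e); first by rewrite subrr ltxx.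
      rewrite subr_gt0; case: Hev => _ [_]; apply => //.
      by rewrite inE; apply: map_f.
    rewrite posp//; apply/esym.
    case: e ok Hev hE => //= k /and4P[_ _ _ kS] _ _.
    by apply/eqP => -[jk]; move: jS; rewrite jk kS.
  apply: eq_map => j /=; rewrite /race_residual inE /=.
  by rewrite mem_map// => ? ? [].
rewrite /next_event hE /= remE.
case: e ok Hev hE remE => [j|i] ok Hev hE remE /=.
- rewrite ifF; last first.
    apply/negP; rewrite leNgt => /negP; apply.
    by case: Hev => _ [_] /(_ (inr (arrivals p))); apply => //; exact: mem_head.
  rewrite /cfg /=; congr Config.
  by rewrite /race_residual mem_head.
- rewrite lexx /cfg /=.
  have Hc : arrivals ((s, inr i) :: p) = (arrivals p).+1 by rewrite /arrivals /= size_rcons.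
  have [F1 F2] := residual_future okp.
  congr Config.
  + by rewrite Hc.
  + rewrite Hc /race_residual ifF ?F2//.
    apply/negP; rewrite inE => /predU1P[[/eqP]|/mapP[]//].
    by rewrite gtn_eqF.
  + rewrite map_rcons; congr rcons.
    * have -> : [seq j <- ids p | (inl j : clk) != inr (arrivals p)] = ids p.
        by apply/all_filterP/allP.
      by [].
    * congr (_, _); rewrite /race_residual ifF; last first.
        apply/negP; rewrite inE /= => /mapP[j jS [nj]].
        by have := ids_lt (mem_subseq sub jS); rewrite -nj ltnn.
      by have [-> //] := residual_future okp.
Qed.

End Histories.

(** * Law of the history *)

Definition subseqs (T : eqType) (l : seq T) : seq (seq T) :=
  undup [seq mask (val m) l | m <- enum {: (size l).-tuple bool}].

Lemma mem_subseqs (T : eqType) (s l : seq T) :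
  (s \in subseqs l) = subseq s l.
Proof.
rewrite mem_undup; apply/mapP/subseqP => [[m _ ->]|[m sm ->]].
  by exists (val m) => //; rewrite size_tuple.
have Hm : size m == size l by rewrite sm.
by exists (Tuple Hm) => //; rewrite mem_enum.
Qed.

Lemma subseqs_uniq (T : eqType) (l : seq T) : uniq (subseqs l).
Proof. exact: undup_uniq. Qed.

(** * Cells of the grid as job types *)

Section JobTypes.
Context {R : realType} {d : nat}.
Variable K : 'I_d -> nat.
Hypothesis K_gt0 : forall l, (0 < K l)%N.

(** Serving a single job of type [i] is admissible, because its 1-based index never exceeds
    [K l]. *)
Lemma max_weight_ge (q M : job_type K -> nat) i : max_weight q M ->
  (q i <= \sum_i q i * M i)%N.
Proof.
move=> qM.
have sumi (c : job_type K -> nat) : (\sum_k c k * (k == i) = c i)%N.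
  rewrite (bigD1 i)//= eqxx muln1 big1 ?addn0// => k /negbTE ->.
  by rewrite muln0.
rewrite -(sumi q); apply: qM.2 => l.
by rewrite (sumi (fun k => (k l).+1)).
Qed.

Lemma measurable_of_type (i : job_type K) :
  measurable [set v : rvec R d | of_type i v].
Proof.
have := @measurable_all _ (rvec R d) _ (enum 'I_d)
  (fun l => (@tnth d R ^~ l) @^-1` `](i l)%:R / (K l)%:R, (i l).+1%:R / (K l)%:R]).
move=> H; have {}H := H (fun l _ => _); move: H.
rewrite (_ : mkset _ = [set v : rvec R d | of_type i v]).
  apply=> l; rewrite -[X in measurable X]setTI.
  by apply: measurable_tnth.
apply/seteqP; split=> v /=.
  by move=> H; apply/forallP => l; have := H l; rewrite mem_enum in_itv/= => ->.
by move=> /forallP H l _; rewrite in_itv/=; exact: H.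
Qed.

Lemma of_type_cube (i : job_type K) (v : rvec R d) : of_type i v -> unit_cube v.
Proof.
move=> /forallP H l; have /andP[lo hi] := H l.
have Kl : (0 : R) < (K l)%:R by rewrite ltr0n.
rewrite (le_lt_trans _ lo) ?divr_ge0//=; apply: le_trans hi _.
by rewrite ler_pdivrMr// mul1r ler_nat.
Qed.

Lemma cell_unique (n : nat) (a b : nat) (x : R) : (0 < n)%N ->
  a%:R / n%:R < x <= a.+1%:R / n%:R -> b%:R / n%:R < x <= b.+1%:R / n%:R ->
  a = b.
Proof.
move=> n0 /andP[a1 a2] /andP[b1 b2]; have n0' : (0 : R) < n%:R by rewrite ltr0n.
have := lt_le_trans a1 b2; have := lt_le_trans b1 a2.
rewrite !ltr_pM2r ?invr_gt0// !ltr_nat !ltnS => ba ab.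
by apply/eqP; rewrite eqn_leq ba ab.
Qed.

Lemma of_type_unique (i j : job_type K) (v : rvec R d) :
  of_type i v -> of_type j v -> i = j.
Proof.
move=> /forallP Hi /forallP Hj; apply/ffunP => l; apply: val_inj => /=.
exact: (cell_unique (K_gt0 l) (Hi l) (Hj l)).
Qed.

Lemma of_type_exists (v : rvec R d) : unit_cube v ->
  exists i : job_type K, of_type i v.
Proof.
move=> Hv.
have H l : exists a : 'I_(K l), (a%:R / (K l)%:R < tnth v l <= a.+1%:R / (K l)%:R).
  have /andP[v0 v1] := Hv l; have Kl : (0 : R) < (K l)%:R by rewrite ltr0n.
  have Kv : tnth v l <= (K l)%:R * (K l)%:R^-1 by rewrite divff ?gt_eqF.
  have [a aK Ha] := cell_exists v0 Kv.
  by exists (Ordinal aK).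
exists [ffun l => projT1 (cid (H l))]; apply/forallP => l.
by rewrite ffunE; exact: projT2 (cid (H l)).
Qed.
End JobTypes.

Section HistoryProbabilities.
Context {disp : measure_display} {Omega : measurableType disp} {R : realType}.
Context {P : probability Omega R} {d : nat} {lambda : R} {f : rvec R d -> R}.
Variables (sys : primitives P lambda f) (pi : policy R d).
Variables (K : 'I_d -> nat) (i0 : job_type K).
Hypothesis lambda_gt0 : 0 < lambda.
Hypothesis K_gt0 : forall l, (0 < K l)%N.
Hypothesis pi_ok : markovian_policy pi.
Local Notation Pr := (Pr P).
Local Notation V := (requirement sys).
Local Notation history := (history K).
Local Notation Y := (residual (clock0 sys)).
Local Notation record := (@record _ K).
Local Notation follows := (follows sys pi).
Local Notation choices := (choices sys pi).
Local Notation served_ids := (served_ids sys pi).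
Implicit Types (p : history) (s : seq nat).

Definition type_prob (i : job_type K) : R :=
  Pr (V 0%N @^-1` [set v | of_type i v]).

Lemma Pr_V n B : measurable B -> Pr (V n @^-1` B) = Pr (V 0%N @^-1` B).
Proof.
move=> mB; rewrite /Pr; have [_ ->] := requirement_law sys n => //.
by have [_ ->] := requirement_law sys 0%N.
Qed.

(** The density formula integrates over the cube only, so it gives the cube and the whole space the
    same probability. *)
Lemma Pr_cube n : Pr (V n @^-1` (@unit_cube R d)) = 1.
Proof.
have mc : measurable (@unit_cube R d).
  have := @measurable_all _ (rvec R d) _ (enum 'I_d)
    (fun l => (@tnth d R ^~ l) @^-1` `]0, 1]).
  move=> H; have {}H := H (fun l _ => _); move: H.
  rewrite (_ : mkset _ = @unit_cube R d).
    apply=> l; rewrite -[X in measurable X]setTI.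
    by apply: measurable_tnth.
  apply/seteqP; split=> v /=.
    by move=> H l; have := H l; rewrite mem_enum in_itv/= => ->.
  by move=> H l _; rewrite in_itv/=; exact: H.
have [_ law] := requirement_law sys n.
rewrite /Pr law// setIid.
have := law setT (@measurableT _ _).
by rewrite preimage_setT probability_setT setTI => <-.
Qed.

Lemma type_prob_ge0 i : 0 <= type_prob i.
Proof. exact: Pr_ge0. Qed.

Lemma type_prob_sum : \sum_(i : job_type K) type_prob i = 1.
Proof.
rewrite /type_prob -(@Pr_sum _ _ _ P _ _
  (fun i => V 0%N @^-1` [set v | of_type i v])) ?index_enum_uniq//.
- rewrite -(Pr_cube 0); congr Pr; apply/seteqP; split=> w.
    by move=> [i _]; exact: of_type_cube.
  by move=> /(of_type_exists K_gt0)[i Hi]; exists i => //; rewrite mem_index_enum.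
- by move=> i _; apply: measurable_V; exact: measurable_of_type.
- by move=> i j w _ _; exact: of_type_unique.
Qed.

Lemma sum_racers p s : \sum_(x <- racers p s) @rate R lambda x = lambda + (size s)%:R.
Proof.
rewrite big_cons big_map /=; congr (_ + _).
by rewrite big_const_seq count_predT iter_addr_0.
Qed.

Let tup p w : (size (ids p)).-tuple (rvec R d) :=
  map_tuple (fun j => V j w) (in_tuple (ids p)).

Let sigV_tup p G : measurable G -> sigV sys (arrivals p) (tup p @^-1` G).
Proof.
move=> mG.
have mt : measurable_fun setT
    (tup p : g_sigma_algebraType (cylinders sys (arrivals p)) -> _).
  apply/measurable_fun_tnthP => i _ B mB; rewrite setTI.
  have -> : (@tnth _ _ ^~ i \o tup p) @^-1` B =
            V (nth 0%N (ids p) i) @^-1` B.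
    apply/seteqP; split=> w /=; rewrite tnth_map (tnth_nth 0%N)//.
  apply: sigV_V => //; apply: ids_lt; exact: mem_nth.
by have := mt (@measurableT _ _) G mG; rewrite setTI.
Qed.

Let served_ids_of p (I : {set 'I_(size (ids p))}) : seq nat :=
  [seq j <- ids p | index j (ids p) \in [seq val i | i <- enum I]].

Let served_idsE p w : served_ids p w = served_ids_of (pi (tup p w)).
Proof.
apply: eq_in_filter => j jp.
have lt : (index j (ids p) < size (ids p))%N by rewrite index_mem.
have := sel_mem pi (tup p w) (Ordinal lt); rewrite /= => <-.
by rewrite -[index j (ids p)]/(val (Ordinal lt)) mem_map ?mem_enum//; exact: val_inj.
Qed.

(** On [choices p] every job present has a type, so the list of requirements is a genuine state, and
    only there is the policy known to be measurable. The event is then a finite union over the sets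
    of positions that translate to [s]. *)
Lemma sigV_served_ids p s : sigV sys (arrivals p) (choices p) ->
  sigV sys (arrivals p) (choices p `&` [set w | served_ids p w = s]).
Proof.
move=> sp.
pose F (I : {set 'I_(size (ids p))}) : set Omega :=
  tup p @^-1` [set x | is_state x /\ pi x = I].
have -> : choices p `&` [set w | served_ids p w = s] =
    choices p `&` [set w | exists2 I, I \in [seq I <- index_enum _ | served_ids_of I == s] & F I w].
  apply/seteqP; split=> w [pw].
  - move=> sw; split=> //; exists (pi (tup p w)).
      by rewrite mem_filter mem_index_enum -served_idsE andbT; apply/eqP.
    split=> // n; rewrite tnth_map (tnth_nth 0%N).
    apply: (of_type_cube K_gt0); apply: (choices_types i0 pw).
    by apply: ids_lt; exact: mem_nth.
  - move=> [I]; rewrite mem_filter => /andP[/eqP <- _] [_ <-].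
    by split=> //=; rewrite served_idsE.
apply: sigVI => //.
apply: (@measurable_bigU _ (g_sigma_algebraType (cylinders sys (arrivals p)))) => I _.
by apply: sigV_tup; exact: pi_ok.2.
Qed.

Lemma sigV_choices p : sigV sys (arrivals p) (choices p).
Proof.
elim: p => [|[s e] p IH] /=; first by apply: sub_sigma_algebra; exact: cylindersT.
case: e => [j|i].
  by rewrite setIT; exact: (sigV_served_ids s IH).
have c : arrivals ((s, inr i) :: p) = (arrivals p).+1 by rewrite /arrivals /= size_rcons.
rewrite c; apply: sigVI.
  by apply: (sigV_mono (leqnSn (arrivals p))); exact: (sigV_served_ids s IH).
exact: (sigV_V (ltnSn (arrivals p)) (measurable_of_type i)).
Qed.

Lemma sigV_races m E p : sigV sys m E -> hist_ok p ->
  exp_clocks P (@rate R lambda) (E `&` races (clock0 sys) (record p))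
    (Pr E * weight (@rate R lambda) (record p))
    [predC winners (record p)] (Y (record p)).
Proof.
move=> sE ok; apply: races_exp_clocks.
- exact: rate_gt0.
- exact: measurable_clock0.
- exact: (measurable_sigV sE).
- exact: (sigV_exp_clocks lambda_gt0 sE).
- exact: record_valid.
Qed.

Lemma Pr_sigV_races m E p : sigV sys m E -> hist_ok p ->
  Pr (E `&` races (clock0 sys) (record p)) =
  Pr E * weight (@rate R lambda) (record p).
Proof.
move=> sE ok.
have := sigV_races sE ok (B := [::]) (t := fun=> 0) isT isT (fun=> lexx _).
rewrite big_nil oppr0 expR0 mulr1 => <-; congr Pr.
by apply/seteqP; split=> [w ?|w []//]; split=> // x; rewrite in_nil.
Qed.

Lemma measurable_follows p : measurable (follows p).
Proof.
rewrite /follows; apply: measurableI.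
  exact: (measurable_sigV (@sigV_choices p)).
by apply: measurable_races; exact: measurable_clock0.
Qed.

Definition follows_serving p s := follows p `&` [set w | served_ids p w = s].

Let follows_servingE p s : follows_serving p s =
  (choices p `&` [set w | served_ids p w = s]) `&` races (clock0 sys) (record p).
Proof. by rewrite /follows_serving /follows setIAC. Qed.

Lemma measurable_follows_serving p s : measurable (follows_serving p s).
Proof.
rewrite follows_servingE; apply: measurableI.
  exact: (measurable_sigV (sigV_served_ids s (@sigV_choices p))).
by apply: measurable_races; exact: measurable_clock0.
Qed.

Definition hist_prob p := Pr (follows p).
Definition serving_prob p s := Pr (follows_serving p s).

Lemma hist_prob_ge0 p : 0 <= hist_prob p. Proof. exact: Pr_ge0. Qed.
Lemma serving_prob_ge0 p s : 0 <= serving_prob p s. Proof. exact: Pr_ge0. Qed.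

Lemma hist_prob_nil : hist_prob [::] = 1.
Proof. by rewrite /hist_prob /follows /= setIT PrT. Qed.

Lemma serving_prob_sum p : \sum_(s <- subseqs (ids p)) serving_prob p s = hist_prob p.
Proof.
rewrite /serving_prob -Pr_sum ?subseqs_uniq//.
- congr Pr; apply/seteqP; split=> [w [s _ []]//|w Ew].
  by exists (served_ids p w) => //; rewrite mem_subseqs served_ids_subseq.
- by move=> s _; exact: measurable_follows_serving.
- by move=> s s' w _ _ [_ <-] [_ <-].
Qed.

Lemma hist_prob_departure p s j : hist_ok ((s, inl j) :: p) ->
  hist_prob ((s, inl j) :: p) = serving_prob p s / (lambda + (size s)%:R).
Proof.
move=> ok; have okp : hist_ok p by case/and4P: ok.
rewrite /hist_prob /serving_prob follows_servingE (Pr_sigV_races (sigV_served_ids s (@sigV_choices p)) okp).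
rewrite /follows [choices (_ :: _)]/= setIT (Pr_sigV_races (sigV_served_ids s (@sigV_choices p)) ok).
by rewrite /= -[lambda + _](sum_racers p s) /= mul1r mulrA.
Qed.

(** The arriving requirement has the first index outside the sigma-algebra of [choices p], so its
    type is independent of the choices made so far. *)
Lemma hist_prob_arrival p s i : hist_ok ((s, inr i) :: p) ->
  hist_prob ((s, inr i) :: p) =
  serving_prob p s * (lambda * type_prob i) / (lambda + (size s)%:R).
Proof.
move=> ok; have okp : hist_ok p by case/and4P: ok.
rewrite /hist_prob /serving_prob follows_servingE (Pr_sigV_races (sigV_served_ids s (@sigV_choices p)) okp).
rewrite /follows (Pr_sigV_races (@sigV_choices ((s, inr i) :: p)) ok) [choices (_ :: _)]/=.
have mi := @measurable_of_type R d K i.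
rewrite (sigV_next lambda_gt0 (sigV_served_ids s (@sigV_choices p)) mi).
by rewrite (Pr_V _ mi) -/(type_prob i) /= -[lambda + _](sum_racers p s) /=; ring.
Qed.

(** With one common threshold for all racers the joint survival function becomes the tail of their
    minimum, exponential with the total rate. *)
Lemma holding_tail p s t : hist_ok p -> subseq s (ids p) -> 0 <= t ->
  Pr (follows_serving p s `&` surv (Y (record p)) (racers p s) (fun=> t)) =
  serving_prob p s * expR (- ((lambda + (size s)%:R) * t)).
Proof.
move=> ok sub t0; rewrite /serving_prob follows_servingE (Pr_sigV_races (sigV_served_ids s (@sigV_choices p)) ok).
rewrite (sigV_races (sigV_served_ids s (@sigV_choices p)) ok)//.
- by rewrite -mulr_suml sum_racers.
- exact: racers_uniq.
- exact: racers_alive.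
Qed.
End HistoryProbabilities.

(* The library's monotonicity lemma asks for measurability; the integral of a
   nonnegative function, a supremum over simple functions, does not need it. *)
Lemma ge0_le_integral_any disp (T : measurableType disp) (R : realType)
    (mu : {measure set T -> \bar R}) (g h : T -> \bar R) :
  (forall w, (0 <= g w)%E) -> (forall w, (g w <= h w)%E) ->
  (\int[mu]_w g w <= \int[mu]_w h w)%E.
Proof.
move=> g0 gh; rewrite !ge0_integralTE//; last first.
  by move=> w; exact: le_trans (gh w).
apply: le_ereal_sup => _ [k /= Hk <-]; exists k => //= w.
exact: le_trans (gh w).
Qed.

Section IntegralFacts.
Context {disp : measure_display} {Omega : measurableType disp} {R : realType}.
Variable P : probability Omega R.

(** The mean is the integral of the tail, and the tail [c * expR (- (mu * t))] is [c / mu] times the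
    exponential density. *)
Lemma mean_of_tail (F : set Omega) (Y : Omega -> R) (c mu : R) :
  measurable F -> measurable_fun setT Y -> 0 < mu -> 0 <= c ->
  (forall t, 0 <= t ->
     Pr P (F `&` [set w | t < Y w]) = c * expR (- (mu * t))) ->
  (\int[P]_w (Y w * \1_(F `&` [set w | 0 < Y w]) w)%:E = (c / mu)%:E)%E.
Proof.
move=> mF mY mu0 c0 tail.
set F' := F `&` _.
have mF' : measurable F' by apply: measurableI => //; exact: measurable_ltr_set.
pose g w := Y w * \1_F' w.
have mg : measurable_fun setT g by apply: measurable_funM.
have g0 w : 0 <= g w.
  rewrite /g indicE; case: (boolP (w \in F')); rewrite ?mulr0// inE mulr1.
  by move=> [_ /= /ltW].
pose X : {RV P >-> R} := HB.pack g (isMeasurableFun.Build _ _ _ _ g mg).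
transitivity ('E_P[X])%E; first by rewrite unlock.
rewrite ge0_expectation_ccdf// integral_mkcond.
transitivity (\int[lebesgue_measure]_r
    ((c / mu)%:E * (exponential_pdf mu r)%:E))%E; last first.
  rewrite ge0_integralZl//=.
  - by rewrite integral_exponential_pdf// mule1.
  - by apply/measurable_EFinP; exact: measurable_exponential_pdf.
  - by move=> r _; rewrite lee_fin exponential_pdf_ge0// ltW.
  - by rewrite lee_fin divr_ge0// ltW.
apply: eq_integral => r _; rewrite patchE; case: ifPn => [|/negP].
  rewrite inE/= in_itv/= andbT => r0.
  rewrite -EFinM exponential_pdfE// mulNr mulrA divfK ?gt_eqF//.
  rewrite -tail// /ccdf /distribution /pushforward /= -PrE; last first.
    by apply: measurableI => //; exact: measurable_ltr_set.
  congr (P _); apply/seteqP; split=> w /=; rewrite in_itv/= andbT /g indicE.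
    case: (boolP (w \in F')); rewrite ?mulr0 ?mulr1; last by rewrite ltNge r0.
    by rewrite inE => -[].
  by move=> [Fw rw]; rewrite mem_set ?mulr1//; split=> //=; exact: le_lt_trans rw.
rewrite inE/= in_itv/= andbT => /negP; rewrite -ltNge => r0.
by rewrite lt0_exponential_pdf// mule0.
Qed.
End IntegralFacts.

(** * Holding times and the return time *)

Section Trees.
Context {disp : measure_display} {Omega : measurableType disp} {R : realType}.
Context {P : probability Omega R} {d : nat} {lambda : R} {f : rvec R d -> R}.
Variables (sys : primitives P lambda f) (pi : policy R d).
Variables (K : 'I_d -> nat) (i0 : job_type K).
Hypothesis lambda_gt0 : 0 < lambda.
Hypothesis K_gt0 : forall l, (0 < K l)%N.
Hypothesis pi_ok : markovian_policy pi.
Local Notation Pr := (Pr P).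
Local Notation V := (requirement sys).
Local Notation history := (history K).
Local Notation Y := (residual (clock0 sys)).
Local Notation record := (@record _ K).
Local Notation follows := (follows sys pi).
Local Notation follows_serving := (follows_serving sys pi).
Local Notation choices := (choices sys pi).
Local Notation served_ids := (served_ids sys pi).
Local Notation hist_prob := (hist_prob sys pi).
Local Notation serving_prob := (serving_prob sys pi).
Local Notation config_after := (config_after sys pi).
Implicit Types (p : history) (s : seq nat) (w : Omega).

Definition going p : bool := (p == [::]) || (ids p != [::]).

Definition outcomes s : seq (nat + job_type K) :=
  map inl s ++ map inr (index_enum (job_type K)).

Definition children p : seq history :=
  [seq (s, e) :: p | s <- subseqs (ids p), e <- outcomes s].

(* The histories of [m] events in which the system did not empty before the
   last event. *)
Fixpoint tree (m : nat) : seq history :=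
  if m is m'.+1 then [seq c | p <- [seq p <- tree m' | going p], c <- children p]
  else [:: [::]].

Definition gtree m := [seq p <- tree m | going p].

Lemma mem_outcomes s e :
  (e \in outcomes s) = (if e is inl j then j \in s else true).
Proof.
rewrite mem_cat; case: e => [j|i].
  rewrite mem_map; last by move=> ? ? [].
  by rewrite (_ : _ \in map inr _ = false) ?orbF//; apply/mapP => -[].
by rewrite orbC map_f// mem_index_enum.
Qed.

Lemma mem_children p c : reflect
  (exists s e, [/\ subseq s (ids p), e \in outcomes s & c = (s, e) :: p])
  (c \in children p).
Proof.
apply: (iffP allpairsPdep) => [[s [e [H1 H2 ->]]]|[s [e [H1 H2 ->]]]].
  by exists s, e; rewrite mem_subseqs in H1.
by exists s, e; rewrite mem_subseqs.
Qed.

Lemma tree_ok m p : p \in tree m -> hist_ok p /\ size p = m.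
Proof.
elim: m p => [|m IH] p /=; first by rewrite inE => /eqP ->.
move=> /allpairsPdep[q [c [qt /mem_children[s [e [sub es ->]]] ->]]].
move: qt; rewrite mem_filter => /andP[gq /IH[okq <-]]; split=> //=.
by rewrite okq sub -/(going q) gq /=; rewrite mem_outcomes in es.
Qed.

Lemma mem_tree p : hist_ok p -> p \in tree (size p).
Proof.
elim: p => [|[s e] p IH] //= /and4P[ok sub gp es].
apply/allpairsPdep; exists p, ((s, e) :: p); split => //.
  by rewrite mem_filter IH// andbT.
by apply/mem_children; exists s, e; rewrite mem_outcomes.
Qed.

Lemma children_uniq p : uniq (children p).
Proof.
apply: allpairs_uniq_dep; first exact: subseqs_uniq.
  move=> s; rewrite mem_subseqs => sub; rewrite cat_uniq !map_inj_uniq.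
  - rewrite (subseq_uniq sub (ids_uniq p)) index_enum_uniq andbT /=.
    by apply/hasPn => _ /mapP[i _ ->]; apply/mapP => -[].
  - by move=> ? ? [].
  - by move=> ? ? [].
by move=> [s e] [s' e'] _ _ /= [-> ->].
Qed.

Lemma tree_uniq m : uniq (tree m).
Proof.
elim: m => [//|m IH] /=; apply: allpairs_uniq_dep.
- exact: filter_uniq.
- by move=> p _; exact: children_uniq.
- move=> [p c] [p' c'] /allpairsPdep[q [b [_ bq E]]] /allpairsPdep[q' [b' [_ bq' E']]].
  move: E E' => [-> ->] [-> ->] /= bb'; subst b'.
  move: bq bq' => /mem_children[s [e [_ _ ->]]] /mem_children[s' [e' [_ _ [_ _ ->]]]].
  by [].
Qed.

Lemma gtree_uniq m : uniq (gtree m).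
Proof. exact/filter_uniq/tree_uniq. Qed.

Lemma gtree_ok m p : p \in gtree m -> [/\ hist_ok p, size p = m & going p].
Proof. by rewrite mem_filter => /andP[gp /tree_ok[]]. Qed.

Lemma mem_gtree p : hist_ok p -> going p -> p \in gtree (size p).
Proof. by move=> ok gp; rewrite mem_filter gp mem_tree. Qed.

Lemma sum_children (M : nmodType) p (F : history -> M) :
  \sum_(c <- children p) F c = \sum_(s <- subseqs (ids p))
    (\sum_(j <- s) F ((s, inl j) :: p) + \sum_i F ((s, inr i) :: p)).
Proof.
rewrite big_allpairs_dep; apply: eq_bigr => s _.
by rewrite big_cat !big_map.
Qed.

Lemma child_ok p s e : hist_ok p -> going p -> subseq s (ids p) ->
  e \in outcomes s -> hist_ok ((s, e) :: p).
Proof.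
by move=> ok gp sub es /=; rewrite ok sub -/(going p) gp -mem_outcomes.
Qed.

Lemma sum_children_prob p (F : history -> R) : hist_ok p -> going p ->
  \sum_(c <- children p) hist_prob c * F c =
  \sum_(s <- subseqs (ids p)) serving_prob p s / (lambda + (size s)%:R) *
    (\sum_(j <- s) F ((s, inl j) :: p) +
     lambda * \sum_i type_prob sys i * F ((s, inr i) :: p)).
Proof.
move=> ok gp; rewrite sum_children !big_seq; apply: eq_bigr => s.
rewrite mem_subseqs => sub; rewrite mulrDr; congr (_ + _).
  rewrite mulr_sumr !big_seq; apply: eq_bigr => j js.
  by rewrite hist_prob_departure//; apply: child_ok => //; rewrite mem_outcomes.
rewrite !mulr_sumr; apply: eq_bigr => i _.
rewrite hist_prob_arrival//; last by apply: child_ok => //; rewrite mem_outcomes.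
ring.
Qed.

Lemma sum_tree (M : nmodType) m (F : history -> M) :
  \sum_(c <- tree m.+1) F c = \sum_(p <- gtree m) \sum_(c <- children p) F c.
Proof. by rewrite /= big_allpairs_dep. Qed.

Lemma rate_pos s : 0 < lambda + (size s)%:R.
Proof. by rewrite ltr_wpDr. Qed.

(** The rates of the possible outcomes add up to the total rate, so the children carry the whole
    mass of their parent. *)
Lemma children_prob p : hist_ok p -> going p ->
  \sum_(c <- children p) hist_prob c = hist_prob p.
Proof.
move=> ok gp; have := sum_children_prob (fun=> 1) ok gp.
under eq_bigr do rewrite mulr1.
move=> ->; rewrite -[RHS](serving_prob_sum sys i0 K_gt0 pi_ok).
apply: eq_bigr => s _.
under [X in lambda * X]eq_bigr do rewrite mulr1.
rewrite type_prob_sum// mulr1 big_const_seq count_predT iter_addr_0.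
by rewrite [X in _ * X]addrC divfK// (gt_eqF (rate_pos s)).
Qed.

(** The outcome determines the served set, a strict race has one winner, and distinct types are
    disjoint. *)
Lemma follows_inj p p' w : hist_ok p -> hist_ok p' -> size p = size p' ->
  follows p w -> follows p' w -> p = p'.
Proof.
elim: p p' => [|[s e] p IH] [|[s' e'] p'] //= ok ok' [sz] Hp Hp'.
have okp : hist_ok p by case/and4P: ok.
have okp' : hist_ok p' by case/and4P: ok'.
have E1 : follows p w by case: Hp => [[[pw _] _] [rw _]].
have E2 : follows p' w by case: Hp' => [[[pw _] _] [rw _]].
have E := IH _ okp okp' sz E1 E2; subst p'.
have [/= [[_ S1] T1] [_ R1]] := Hp; have [/= [[_ S2] T2] [_ R2]] := Hp'.
have ss : s = s' by rewrite -S1 -S2.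
have [_ _ _ eS] := and4P ok; have [_ _ _ eS'] := and4P ok'.
rewrite -ss in R2 eS' *; congr (_ :: _); congr (_, _).
have es := winner_racer p eS; have es' := winner_racer p eS'.
have we : winner p e = winner p e'.
  apply/eqP; apply: contrapT => /negP ne.
  have := R1 _ es'; rewrite eq_sym => /(_ ne) lt1.
  by have := lt_trans lt1 (R2 _ es ne); rewrite ltxx.
case: e e' we T1 T2 {ok ok' Hp Hp' R1 R2 es es' eS eS'} => [j|i] [j'|i'] //=.
  by move=> [->].
by move=> _ T1 T2; rewrite (of_type_unique K_gt0 T1 T2).
Qed.

Definition min_residual p s w : R :=
  \big[Num.min/Y (record p) (inr (arrivals p)) w]_(j <- s) Y (record p) (inl j) w.

Lemma lt_min_residual p s w t : t < min_residual p s w <->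
  forall x, x \in racers p s -> t < Y (record p) x w.
Proof.
rewrite /min_residual; elim: s => [|j s IH].
  rewrite big_nil; split; first by move=> H x; rewrite inE => /eqP ->.
  by apply; rewrite mem_head.
rewrite big_cons lt_min; split.
- move=> /andP[H1 /IH H2] x; rewrite /= !inE => /or3P[/eqP ->|/eqP ->//|xs].
    by apply: H2; exact: mem_head.
  by apply: H2; rewrite inE xs orbT.
- move=> H; rewrite H ?inE ?eqxx ?orbT//=; apply/IH => x.
  by rewrite inE => /predU1P[->|xs]; apply: H; rewrite /= !inE ?eqxx// xs !orbT.
Qed.

Lemma measurable_min_residual p s : measurable_fun setT (min_residual p s).
Proof.
rewrite /min_residual; elim: s => [|j s IH].
  rewrite (_ : (fun w => _) = Y (record p) (inr (arrivals p))).
    by apply: measurable_residual; exact: measurable_clock0.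
  by apply/funext => w; rewrite big_nil.
rewrite (_ : (fun w => _) = Y (record p) (inl j) \min min_residual p s); last first.
  by apply/funext => w; rewrite big_cons.
apply: measurable_minr => //.
by apply: measurable_residual; exact: measurable_clock0.
Qed.

(** Two reals with the same strict lower bounds agree, and those of either minimum are the strict
    lower bounds of all racing clocks. *)
Lemma min_residual_cfg p w : min_residual p (served_ids p w) w = time_to_event pi (cfg sys p w).
Proof.
have key t : (t < min_residual p (served_ids p w) w) = (t < time_to_event pi (cfg sys p w)).
  apply/idP/idP.
  - move=> /lt_min_residual H; apply/bigmin_gtP; split; first by apply: H; exact: mem_head.
    move=> n; rewrite served_served_ids tnth_cfg /= => ns; apply: H.
    by rewrite inE; apply: map_f.
  - move=> /bigmin_gtP[H1 H2]; apply/lt_min_residual => x; rewrite inE => /predU1P[->//|].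
    move=> /mapP[j js ->].
    have jp : j \in ids p by move: js; rewrite mem_filter => /andP[].
    have lt : (index j (ids p) < size (jobs (cfg sys p w)))%N.
      by rewrite size_map index_mem.
    have := H2 (Ordinal lt); rewrite served_served_ids tnth_cfg /= nth_index//.
    exact.
apply/eqP; rewrite eq_le !leNgt key ltxx /=.
by rewrite -key ltxx.
Qed.

(** The positivity condition in the indicator makes the term nonnegative at every outcome, including
    those with nonpositive clocks. *)
Definition hold_term p s w : R :=
  min_residual p s w * \1_(follows_serving p s `&` [set w | 0 < min_residual p s w]) w.

(** For positive clocks, the time between the events [m] and [m.+1] along the followed history, and
    0 once the system has returned. As a finite sum it is measurable. *)
Definition holding m w : R :=
  \sum_(p <- gtree m) \sum_(s <- subseqs (ids p)) hold_term p s w.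

Definition mean_holding m : R :=
  \sum_(p <- gtree m) \sum_(s <- subseqs (ids p))
    serving_prob p s / (lambda + (size s)%:R).

Lemma hold_term_ge0 p s w : 0 <= hold_term p s w.
Proof.
rewrite /hold_term indicE; case: (boolP (w \in _)); rewrite ?mulr0// inE mulr1.
by move=> [_ /= /ltW].
Qed.

Lemma holding_ge0 m w : 0 <= holding m w.
Proof. by do 2!apply: sumr_ge0 => ? _; exact: hold_term_ge0. Qed.

Lemma mean_holding_ge0 m : 0 <= mean_holding m.
Proof.
do 2!apply: sumr_ge0 => ? _.
by apply: divr_ge0; [exact: serving_prob_ge0|exact/ltW/rate_pos].
Qed.

Lemma measurable_hold_term p s : measurable_fun setT (hold_term p s).
Proof.
apply: measurable_funM; first exact: measurable_min_residual.
apply: measurable_indic; apply: measurableI.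
  exact: (measurable_follows_serving sys i0 K_gt0 pi_ok).
by apply: measurable_ltr_set => //; exact: measurable_min_residual.
Qed.

Lemma measurable_holding m : measurable_fun setT (holding m).
Proof.
rewrite /holding; apply: measurable_sum => p; apply: measurable_sum => s.
exact: measurable_hold_term.
Qed.

Lemma int_hold_term p s : hist_ok p -> subseq s (ids p) ->
  (\int[P]_w (hold_term p s w)%:E =
   (serving_prob p s / (lambda + (size s)%:R))%:E)%E.
Proof.
move=> ok sub; apply: mean_of_tail.
- exact: (measurable_follows_serving sys i0 K_gt0 pi_ok).
- exact: measurable_min_residual.
- exact: rate_pos.
- exact: serving_prob_ge0.
- move=> t t0; rewrite -(holding_tail sys i0 lambda_gt0 K_gt0 pi_ok ok sub t0).
  congr (Pr (_ `&` _)); apply/seteqP; split=> w /=.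
    by move/lt_min_residual.
  by move=> H; apply/lt_min_residual.
Qed.

Lemma int_holding m : (\int[P]_w (holding m w)%:E = (mean_holding m)%:E)%E.
Proof.
rewrite /mean_holding -sumEFin.
under eq_integral do rewrite -sumEFin.
rewrite ge0_integral_sum//.
- rewrite !big_seq; apply: eq_bigr => p /gtree_ok[ok _ _].
  rewrite -sumEFin; under eq_integral do rewrite -sumEFin.
  rewrite ge0_integral_sum//.
  + rewrite !big_seq; apply: eq_bigr => s; rewrite mem_subseqs => sub.
    exact: int_hold_term.
  + by move=> s; apply/measurable_EFinP; exact: measurable_hold_term.
  + by move=> s w _; rewrite lee_fin hold_term_ge0.
- move=> p; apply/measurable_EFinP; apply: measurable_sum => s.
  exact: measurable_hold_term.
- by move=> p w _; rewrite lee_fin; apply: sumr_ge0 => s _; exact: hold_term_ge0.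
Qed.
End Trees.

Section ReturnTime.
Context {disp : measure_display} {Omega : measurableType disp} {R : realType}.
Context {P : probability Omega R} {d : nat} {lambda : R} {f : rvec R d -> R}.
Variables (sys : primitives P lambda f) (pi : policy R d).
Hypothesis lambda_gt0 : 0 < lambda.
Hypothesis pi_ok : markovian_policy pi.
Local Notation Pr := (Pr P).
Local Notation Pos := (positive_clocks sys).
Local Notation cfa := (config_after sys pi).
Local Notation T := (return_time sys pi).

Definition live (c : config) : Prop :=
  0 < until_arrival c /\ all (fun j : rvec R d * R => 0 < j.2) (jobs c).

Lemma live_time c : live c -> 0 < time_to_event pi c.
Proof.
move=> [u0 /allP j0]; apply/bigmin_gtP; split=> // n _.
by apply: j0; exact: mem_tnth.
Qed.

Lemma live_next w c : Pos w -> live c -> live (next_event sys pi w c).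
Proof.
move=> pos lc; have h0 := live_time lc; rewrite /next_event.
have rem : all (fun j : rvec R d * R => 0 < j.2) (remaining_jobs pi c).
  exact: filter_all.
case: ifPn => [_|nle]; split=> //=.
- exact: (pos (inr _)).
- by rewrite all_rcons rem andbT; exact: (pos (inl _)).
- by rewrite subr_gt0 ltNge.
Qed.

Lemma live_config_after w k : Pos w -> live (cfa w k).
Proof.
move=> pos; elim: k => [|k IH]; last exact: live_next.
by split=> //; exact: (pos (inr _)).
Qed.

Lemma clock_next w k :
  clock (cfa w k.+1) = clock (cfa w k) + time_to_event pi (cfa w k).
Proof.
rewrite -[cfa w k.+1]/(next_event sys pi w (cfa w k)) /next_event.
by case: ifP.
Qed.

Lemma clock_ge0 w k : Pos w -> 0 <= clock (cfa w k).
Proof.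
move=> pos; elim: k => [//|k IH].
by rewrite clock_next addr_ge0// ltW// live_time//; exact: live_config_after.
Qed.

Lemma positive_clocks_ae : measurable Pos /\ P (~` Pos) = 0%E.
Proof.
have E : ~` Pos = (\bigcup_n ~` [set w | 0 < clock0 sys (inl n) w]) `|`
                  (\bigcup_n ~` [set w | 0 < clock0 sys (inr n) w]).
  apply/seteqP; split=> w.
    move=> H; apply: contrapT => H'; apply: H => x; apply: contrapT => H2.
    by apply: H'; case: x H2 => n H2; [left|right]; exists n.
  by move=> [[n _ Hn]|[n _ Hn]] H; apply: Hn; exact: H.
have mx x : measurable [set w | 0 < clock0 sys x w].
  by apply: measurable_ltr_set => //; exact: measurable_clock0.
have nx x : P (~` [set w | 0 < clock0 sys x w]) = 0%E.
  rewrite PrE; last exact: measurableC.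
  have := Pr_split P measurableT (mx x); rewrite PrT setTI setTD.
  have -> : Pr [set w | 0 < clock0 sys x w] = 1.
    rewrite (@exponential_tail _ _ _ P _ (@rate R lambda x)) ?mulr0 ?oppr0 ?expR0//.
    - exact: measurable_clock0.
    - exact: rate_gt0.
    - by case: x {mx} => n A mA; [exact: duration_law|exact: interarrival_law].
  by move=> H; congr (_%:E); lra.
have mN : measurable (~` Pos).
  rewrite E; apply: measurableU; apply: bigcup_measurable => n _;
  exact: measurableC.
split; first by rewrite -(setCK Pos); exact: measurableC.
apply/negligibleP => //; rewrite E; apply: negligibleU;
  apply: negligible_bigcup => n; apply/negligibleP; [exact: measurableC|exact: nx
    |exact: measurableC|exact: nx].
Qed.

Lemma int_infty_null (N : set Omega) : measurable N -> P N = 0%E ->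
  (\int[P]_w ((cst +oo : Omega -> \bar R) \_ N) w = 0)%E.
Proof.
move=> mN PN; rewrite -integral_mkcond integral_cst//.
by rewrite [X in (_ * X)%E](_ : _ = 0%E) ?mule0.
Qed.

Definition mean_return : \bar R := (\int[P]_w (T ^\+)%E w)%E.

Lemma return_time_ge0 w : Pos w -> (0 <= T w)%E.
Proof.
move=> pos; apply/ereal_infP => _ [k _ <-].
by rewrite lee_fin clock_ge0.
Qed.

(** A negative return time requires a nonpositive clock, so the negative part lives on a null
    set. *)
Lemma int_return_time : (\int[P]_w T w = mean_return)%E.
Proof.
have [mPos nPos] := positive_clocks_ae.
rewrite integralE -/mean_return (_ : (\int[P]_w _ w)%E = 0%E) ?sube0//.
apply/eqP; rewrite eq_le; apply/andP; split; last first.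
  by apply: integral_ge0 => w _; exact: funeneg_ge0.
rewrite -(int_infty_null (measurableC mPos) nPos).
apply: ge0_le_integral_any => w; first exact: funeneg_ge0.
rewrite patchE; case: ifPn => [_|]; first exact: leey.
rewrite notin_setE /= => /contrapT pos.
rewrite funenegE ge_max lexx andbT leeNl oppe0; exact: return_time_ge0.
Qed.

Section Typed.
Variables (K : 'I_d -> nat) (i0 : job_type K).
Hypothesis K_gt0 : forall l, (0 < K l)%N.
Local Notation follows := (follows sys pi (K := K)).
Local Notation served_ids := (served_ids sys pi (K := K)).
Local Notation hist_prob := (hist_prob sys pi (K := K)).
Local Notation serving_prob := (serving_prob sys pi (K := K)).
Local Notation holding := (holding sys pi K).
Local Notation hold_term := (hold_term sys pi (K := K)).
Local Notation mean_holding := (mean_holding sys pi K).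
Local Notation gtree := (gtree K).
Implicit Types (p : history K) (w : Omega).

Lemma nonempty_before p w k : Pos w -> hist_ok p -> going p -> follows p w ->
  (0 < k <= size p)%N -> jobs (cfa w k) != [::].
Proof.
move=> pos; elim: p k => [|[s e] p IH] k.
  by move=> _ _ _ /andP[k0]; rewrite leqNgt k0.
move=> ok gp Hev /andP[k0]; rewrite leq_eqVlt => /predU1P[->|lt].
  rewrite (config_afterE pos ok Hev) -size_eq0.
  have -> : size (jobs (cfg sys ((s, e) :: p) w)) = size (ids ((s, e) :: p)).
    exact: size_map.
  by rewrite size_eq0.
have Hev' : follows p w by case: Hev => [[[pw _] _] [rw _]].
have [okp _ gp' _] := and4P ok.
by apply: IH => //; rewrite k0.
Qed.

Lemma holding0 w k : (forall p, p \in gtree k -> ~ follows p w) -> holding k w = 0.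
Proof.
move=> H; rewrite /holding big_seq big1// => p /H nE.
rewrite big1// => s _; rewrite /hold_term indicE memNset ?mulr0//.
by move=> [[]].
Qed.

Lemma holdingE w p : Pos w -> hist_ok p -> going p -> follows p w ->
  holding (size p) w = clock (cfa w (size p).+1) - clock (cfa w (size p)).
Proof.
move=> pos ok gp Hev.
rewrite clock_next addrC addKr.
rewrite /holding (bigD1_seq p) ?gtree_uniq ?mem_gtree//=.
rewrite [X in _ + X]big1_seq ?addr0; last first.
  move=> q /andP[qp /gtree_ok[okq szq _]]; rewrite big1// => s _.
  rewrite /hold_term indicE memNset ?mulr0// => -[[Hq _] _].
  by move/eqP: qp; apply; exact: (follows_inj K_gt0 okq ok szq Hq Hev).
rewrite (bigD1_seq (served_ids p w)) ?subseqs_uniq ?mem_subseqs ?served_ids_subseq//=.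
rewrite [X in _ + X]big1 ?addr0; last first.
  move=> s /eqP ns; rewrite /hold_term indicE memNset ?mulr0// => -[[_ /= sE] _].
  exact: ns.
rewrite /hold_term indicE mem_set ?mulr1.
  by rewrite min_residual_cfg (config_afterE pos ok Hev).
split=> //=; rewrite min_residual_cfg -(config_afterE pos ok Hev).
exact/live_time/live_config_after.
Qed.

(** Only an inequality: an outcome with a tie may follow no history of length [k], and then
    contributes 0. *)
Lemma holding_bound w k k' : Pos w -> (0 < k')%N -> jobs (cfa w k') = [::] ->
  holding k w <=
  if (k < k')%N then clock (cfa w k.+1) - clock (cfa w k) else 0.
Proof.
move=> pos k0 je.
have [[p [pk Hev]]|nE] := pselect (exists p, p \in gtree k /\ follows p w).
  have [ok szp gp] := gtree_ok pk; subst k.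
  rewrite (holdingE pos ok gp Hev).
  case: ltnP => // lek.
  have := nonempty_before pos ok gp Hev (k := k').
  by rewrite k0 lek je => /(_ isT).
rewrite holding0; last by move=> p pk Hp; apply: nE; exists p.
case: ifP => // _; rewrite clock_next addrC addKr ltW// live_time//.
exact: live_config_after.
Qed.

Lemma sum_holding_le w m : Pos w -> ((\sum_(k < m) holding k w)%:E <= T w)%E.
Proof.
move=> pos; apply/ereal_infP => _ [k' [k0 je] <-]; rewrite lee_fin.
(* The range is padded to [m + k'] so that it contains both the first [m] holding times and the [k']
   clock increments, which telescope. *)
apply: (@le_trans _ _ (\sum_(k < m + k' | (k < k')%N)
   (clock (cfa w k.+1) - clock (cfa w k)))).
  apply: (@le_trans _ _ (\sum_(k < m + k') holding k w)).
    rewrite big_split_ord /= lerDl; apply: sumr_ge0 => i _.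
    exact: holding_ge0.
  rewrite [leRHS]big_mkcond; apply: ler_sum => k _; exact: holding_bound.
rewrite -(big_mkord (fun k => (k < k')%N)
  (fun k => clock (cfa w k.+1) - clock (cfa w k))).
rewrite (big_cat_nat (n := k'))//= ?leq_addl//.
rewrite [X in _ + X]big_nat_cond [X in _ + X]big1 ?addr0; last first.
  by move=> i /andP[/andP[ki _] ik]; move: (leq_ltn_trans ki ik); rewrite ltnn.
rewrite (_ : \sum_(0 <= k < k' | _) _ =
  \sum_(0 <= k < k') (clock (cfa w k.+1) - clock (cfa w k))); last first.
  by rewrite big_nat_cond [RHS]big_nat_cond; apply: eq_bigl => i; rewrite andbT andbb.
rewrite (telescope_sumr (fun k => clock (cfa w k)))//.
by rewrite subr0.
Qed.

Lemma mean_holding_le_mean_return m : ((\sum_(k < m) mean_holding k)%:E <= mean_return)%E.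
Proof.
have [mPos nPos] := positive_clocks_ae.
rewrite -sumEFin.
have mh k : measurable_fun setT (fun w => (holding k w)%:E).
  by apply/measurable_EFinP; apply: measurable_holding.
rewrite (eq_bigr (fun k : 'I_m => \int[P]_w (holding k w)%:E)%E); last first.
  by move=> k _; rewrite (int_holding sys i0 lambda_gt0 K_gt0 pi_ok).
have <- : (\int[P]_w (\sum_(k < m) (holding k w)%:E) =
           \sum_(k < m) \int[P]_w (holding k w)%:E)%E.
  by rewrite ge0_integral_sum// => k w _; rewrite lee_fin holding_ge0.
rewrite (ge0_negligible_integral (N := ~` Pos))//; last 3 first.
- exact: measurableC.
- by apply: emeasurable_sum.
- by move=> w _; apply: sume_ge0 => k _; rewrite lee_fin holding_ge0.
rewrite integral_mkcond; apply: ge0_le_integral_any => w.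
  rewrite patchE; case: ifP => // _.
  by apply: sume_ge0 => k _; rewrite lee_fin holding_ge0.
rewrite patchE; case: ifPn => [|_]; last exact: funepos_ge0.
rewrite inE setTD setCK => pos; rewrite sumEFin funeposE le_max.
by rewrite sum_holding_le.
Qed.

Definition busy_prob m : R := \sum_(p <- gtree m) hist_prob p.

Definition returned w : Prop :=
  exists p, [/\ hist_ok p, (0 < size p)%N, ids p = [::] & follows p w].

(** Outcomes that drop out of the tree within [m] events: they follow a history but none of its
    children, as in a tie. They are null because the disjoint children exhaust the mass of their
    parent. *)
Fixpoint uncovered (m : nat) : set Omega :=
  if m is m'.+1 then uncovered m' `|`
    [set w | exists2 p, p \in gtree m' &
       (follows p `\` [set w | exists2 c, c \in children p & follows c w]) w]
  else set0.

Let mEv p : measurable (follows p).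
Proof. exact: (measurable_follows sys i0 K_gt0 pi_ok). Qed.

Let mgap p : measurable (follows p `\` [set w | exists2 c, c \in children p & follows c w]).
Proof.
by apply: measurableD; [exact: mEv|apply: measurable_bigU => c _; exact: mEv].
Qed.

Lemma measurable_uncovered m : measurable (uncovered m).
Proof.
elim: m => [|m IH] //=; apply: measurableU => //.
by apply: measurable_bigU => p _; exact: mgap.
Qed.

Let child_of p c : hist_ok p -> going p -> c \in children p ->
  hist_ok c /\ size c = (size p).+1.
Proof.
move=> ok gp /mem_children[s [e [sub es ->]]]; split=> //.
exact: child_ok.
Qed.

Lemma gap_null p : hist_ok p -> going p ->
  Pr (follows p `\` [set w | exists2 c, c \in children p & follows c w]) = 0.
Proof.
move=> ok gp; have mU : measurable [set w | exists2 c, c \in children p & follows c w].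
  by apply: measurable_bigU => c _; exact: mEv.
have := Pr_split P (mEv p) mU.
have -> : follows p `&` [set w | exists2 c, c \in children p & follows c w] =
          [set w | exists2 c, c \in children p & follows c w].
  apply/seteqP; split=> [w []//|w [c cp cw]]; split=> //; last by exists c.
  move: cp cw => /mem_children[s [e [_ _ ->]]].
  by case=> [[[pw _] _] [rw _]].
rewrite Pr_sum ?children_uniq//; last first.
  move=> c c' w cp cp' Hc Hc'.
  have [okc sc] := child_of ok gp cp; have [okc' sc'] := child_of ok gp cp'.
  by apply: (follows_inj K_gt0 okc okc' _ Hc Hc'); rewrite sc sc'.
have := children_prob sys i0 lambda_gt0 K_gt0 pi_ok ok gp.
rewrite /hist_prob => ->; lra.
Qed.

Lemma uncovered_null m : Pr (uncovered m) = 0.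
Proof.
elim: m => [|m IH] /=; first exact: Pr0.
have mU := measurable_bigU (s := gtree m) (fun p _ => mgap p).
apply/eqP; rewrite eq_le Pr_ge0 andbT.
apply: le_trans (Pr_subadd P (measurable_uncovered m) mU) _.
rewrite IH add0r.
have key (l : seq (history K)) : {subset l <= gtree m} ->
   Pr [set w | exists2 p, p \in l &
       (follows p `\` [set w | exists2 c, c \in children p & follows c w]) w] <= 0.
  elim: l => [|p l IHl] sub.
    rewrite (_ : mkset _ = set0) ?Pr0//; apply/seteqP; split=> // w [q].
    by rewrite in_nil.
  have [ok _ gp] := gtree_ok (sub _ (mem_head _ _)).
  have mUl := measurable_bigU (s := l) (fun p _ => mgap p).
  apply: (@le_trans _ _ (Pr (follows p `\` [set w | exists2 c, c \in children p & follows c w]) +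
     Pr [set w | exists2 p, p \in l &
       (follows p `\` [set w | exists2 c, c \in children p & follows c w]) w])).
    apply: le_trans (Pr_subadd P (mgap p) mUl).
    apply: Pr_le; first by apply: measurable_bigU => q _; exact: mgap.
      exact: measurableU.
    move=> w [q]; rewrite inE => /predU1P[->|ql] Hq; first by left.
    by right; exists q.
  rewrite gap_null// add0r; apply: IHl => q ql; apply: sub.
  by rewrite inE ql orbT.
exact: key.
Qed.

Lemma coveredP m w : ~ uncovered m w ->
  returned w \/ exists2 p, p \in gtree m & follows p w.
Proof.
elim: m => [|m IH] /=.
  move=> _; right; exists [::] => //.
move=> nU; have /IH[|[p pm Hp]] : ~ uncovered m w by move=> H; apply: nU; left.
  by left.
have [ok szp gp] := gtree_ok pm.
have [c cp Hc] : exists2 c, c \in children p & follows c w.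
  apply: contrapT => nc; apply: nU; right; exists p => //.
have [okc sc] := child_of ok gp cp.
have [ic|ic] := eqVneq (ids c) [::].
  by left; exists c; split=> //; rewrite sc.
by right; exists c => //; rewrite -szp -sc mem_gtree// /going ic orbT.
Qed.

Lemma returned_time w : Pos w -> returned w ->
  exists m, (T w <= (\sum_(k < m) holding k w)%:E)%E.
Proof.
move=> pos [p [ok sp ip Hev]]; exists (size p).
have H q : hist_ok q -> follows q w ->
    clock (cfa w (size q)) <= \sum_(k < size q) holding k w.
  elim: q => [|[s e] q IH] okq Hq; first by rewrite big_ord0.
  have Hq' : follows q w by case: Hq => [[[pw _] _] [rw _]].
  have [okq' _ gq _] := and4P okq.
  rewrite big_ord_recr /= -/(cfa w (size q).+1) (holdingE pos okq' gq Hq').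
  by rewrite -lerBlDr opprB addrCA subrr addr0; exact: IH.
apply: (@le_trans _ _ (clock (cfa w (size p)))%:E); last first.
  by rewrite lee_fin; exact: H.
apply: ereal_inf_lbound; exists (size p) => //; split=> //.
by rewrite (config_afterE pos ok Hev) /cfg /= ip.
Qed.

Lemma mean_return_finite (B : R) :
  (forall m, \sum_(k < m) mean_holding k <= B) ->
  (forall eps, 0 < eps -> exists m, busy_prob m < eps) -> (mean_return < +oo)%E.
Proof.
move=> HB Htail; have [mPos nPos] := positive_clocks_ae.
pose A m := [set w | exists2 p, p \in gtree m & follows p w].
have mA m : measurable (A m) by apply: measurable_bigU => p _; exact: mEv.
(* The exceptional outcomes: some clock is not positive, or at every [m] the outcome is off the tree
   or still busy. The latter have probability at most [busy_prob m] for every [m]. On [N] the return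
   time is bounded by [+oo], elsewhere by the sum [g] of the holding times. *)
pose N := ~` Pos `|` \bigcap_m (uncovered m `|` A m).
have mU m : measurable (uncovered m `|` A m).
  by apply: measurableU => //; exact: measurable_uncovered.
have mcap : measurable (\bigcap_m (uncovered m `|` A m)).
  exact: bigcapT_measurable.
have mN : measurable N by apply: measurableU => //; exact: measurableC.
have PrA m : Pr (A m) = busy_prob m.
  rewrite /A Pr_sum ?gtree_uniq// => p q w /gtree_ok[ok sp _] /gtree_ok[okq sq _].
  by move=> Hp Hq; apply: (follows_inj K_gt0 ok okq _ Hp Hq); rewrite sp sq.
have PN : P N = 0%E.
  apply/negligibleP => //; apply: negligibleU; first by apply/negligibleP; [exact: measurableC|exact: nPos].
  apply/negligibleP => //; transitivity (Pr (\bigcap_m (uncovered m `|` A m)))%:E.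
    exact: PrE.
  congr (_%:E).
  apply/eqP; rewrite eq_le Pr_ge0 andbT; apply/ler_addgt0Pr => e e0.
  have [m Hm] := Htail _ e0; rewrite add0r; apply: le_trans (ltW Hm).
  rewrite -PrA -[leRHS]add0r -(uncovered_null m).
  apply: le_trans (Pr_subadd P (measurable_uncovered m) (mA m)).
  by apply: Pr_le => // w; apply.
pose g (w : Omega) : \bar R := (\sum_(0 <= k <oo) (holding k w)%:E)%E.
have g0 w : (0 <= g w)%E.
  by apply: nneseries_ge0 => k _ _; rewrite lee_fin holding_ge0.
have mh k : measurable_fun setT (fun w => (holding k w)%:E).
  by apply/measurable_EFinP; apply: measurable_holding.
have mg : measurable_fun setT g.
  by apply: ge0_emeasurable_sum => // k w _ _; rewrite lee_fin holding_ge0.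
pose inf_on_N := (cst +oo : Omega -> \bar R)%E \_ N.
have minf : measurable_fun setT inf_on_N.
  apply/(measurable_restrictT _ mN). exact: measurable_cst.
have inf0 w : (0 <= inf_on_N w)%E.
  by rewrite /inf_on_N patchE; case: ifP => _ //; exact: le0y.
apply: (@le_lt_trans _ _ (\int[P]_w (g w + inf_on_N w))%E).
  apply: ge0_le_integral_any => w; first exact: funepos_ge0.
  have [Nw|nN] := pselect (N w).
    rewrite /inf_on_N patchE mem_set// addey ?leey//.
    by rewrite gt_eqF// (lt_le_trans _ (g0 w))// ltNy0.
  rewrite /inf_on_N patchE memNset// adde0 funeposE ge_max g0 andbT.
  have pos : Pos w by apply: contrapT => h; apply: nN; left.
  have [m Hm] : exists m, ~ (uncovered m `|` A m) w.
    apply: contrapT => h; apply: nN; right => m _; apply: contrapT => h'.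
    by apply: h; exists m.
  have ret : returned w.
    have [//|Am] := @coveredP m w (fun h => Hm (or_introl h)).
    by exfalso; apply: Hm; right.
  have [k Hk] := returned_time pos ret; apply: le_trans Hk _.
  rewrite -sumEFin -(big_mkord xpredT (fun k => (holding k w)%:E)).
  by apply: nneseries_lim_ge => j _; rewrite lee_fin holding_ge0.
rewrite ge0_integralD// int_infty_null// adde0.
rewrite integral_nneseries//; last by move=> k w _; rewrite lee_fin holding_ge0.
apply: (@le_lt_trans _ _ B%:E); last exact: ltry.
apply: lime_le.
  by apply: is_cvg_nneseries => k _ _; apply: integral_ge0 => w _; rewrite lee_fin holding_ge0.
apply: nearW => m; rewrite big_mkord.
rewrite (eq_bigr (fun k : 'I_m => (mean_holding k)%:E)); last first.
  by move=> k _; rewrite (int_holding sys i0 lambda_gt0 K_gt0 pi_ok).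
by rewrite sumEFin lee_fin; exact: HB.
Qed.
End Typed.
End ReturnTime.

(** * Drift and the necessary load condition *)

Section Drift.
Context {disp : measure_display} {Omega : measurableType disp} {R : realType}.
Context {P : probability Omega R} {d : nat} {lambda : R} {f : rvec R d -> R}.
Variables (sys : primitives P lambda f) (pi : policy R d).
Variables (K : 'I_d -> nat) (i0 : job_type K).
Hypothesis lambda_gt0 : 0 < lambda.
Hypothesis K_gt0 : forall l, (0 < K l)%N.
Hypothesis pi_ok : markovian_policy pi.
Local Notation Pr := (Pr P).
Local Notation V := (requirement sys).
Local Notation history := (history K).
Local Notation follows := (follows sys pi (K := K)).
Local Notation follows_serving := (follows_serving sys pi (K := K)).
Local Notation served_ids := (served_ids sys pi (K := K)).
Local Notation hist_prob := (hist_prob sys pi (K := K)).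
Local Notation serving_prob := (serving_prob sys pi (K := K)).
Local Notation mean_holding := (mean_holding sys pi K).
Local Notation busy_prob := (busy_prob sys pi K).
Local Notation gtree := (gtree K).
Local Notation typ := (typ i0).
Local Notation pt := (type_prob sys (K := K)).
Implicit Types (p : history) (s : seq nat) (w : Omega).

(** The bracket is the generator applied to [F] while [s] is served, and the factor before it is the
    mean time spent serving [s] after [p]. *)
Lemma drift p (F : history -> R) : hist_ok p -> going p ->
  \sum_(c <- children p) hist_prob c * F c = hist_prob p * F p +
  \sum_(s <- subseqs (ids p)) serving_prob p s / (lambda + (size s)%:R) *
    (\sum_(j <- s) (F ((s, inl j) :: p) - F p) +
     lambda * \sum_i pt i * (F ((s, inr i) :: p) - F p)).
Proof.
move=> ok gp; rewrite (sum_children_prob sys i0 lambda_gt0 K_gt0 pi_ok)//.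
rewrite -(serving_prob_sum sys i0 K_gt0 pi_ok p) mulr_suml -big_split /=.
apply: eq_bigr => s _.
have r0 := gt_eqF (rate_pos lambda_gt0 s).
have -> : \sum_(j <- s) (F ((s, inl j) :: p) - F p) =
          \sum_(j <- s) F ((s, inl j) :: p) - (size s)%:R * F p.
  by rewrite sumrB big_const_seq count_predT iter_addr_0 mulr_natl.
have -> : \sum_i pt i * (F ((s, inr i) :: p) - F p) =
          \sum_i pt i * F ((s, inr i) :: p) - F p.
  under eq_bigr do rewrite mulrBr.
  by rewrite sumrB -mulr_suml type_prob_sum// mul1r.
field.
by rewrite r0.
Qed.

Definition mean_at (F : history -> R) m : R := \sum_(p <- gtree m) hist_prob p * F p.

(* [F] is only required to be nonnegative on the histories that emptied the
   system: these are dropped by [gtree]. *)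
Lemma mean_at_next m (F : history -> R) :
  (forall p, hist_ok p -> ids p = [::] -> 0 <= F p) ->
  mean_at F m.+1 <= mean_at F m +
  \sum_(p <- gtree m) \sum_(s <- subseqs (ids p))
    serving_prob p s / (lambda + (size s)%:R) *
    (\sum_(j <- s) (F ((s, inl j) :: p) - F p) +
     lambda * \sum_i pt i * (F ((s, inr i) :: p) - F p)).
Proof.
move=> F0.
apply: (@le_trans _ _ (\sum_(p <- tree K m.+1) hist_prob p * F p)).
  rewrite /mean_at big_filter [leRHS](bigID (@going d K)) lerDl.
  rewrite big_seq_cond; apply: sumr_ge0 => p /andP[/tree_ok[ok _] +].
  rewrite /going andTb negb_or negbK => /andP[_ /eqP ip].
  by rewrite mulr_ge0 ?hist_prob_ge0// F0.
rewrite sum_tree /mean_at -big_split /= !big_seq.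
by apply: ler_sum => p /gtree_ok[ok _ gp]; rewrite drift.
Qed.

Lemma mean_at_next_eq m (F : history -> R) :
  (forall p, hist_ok p -> ids p = [::] -> F p = 0) ->
  mean_at F m.+1 = mean_at F m +
  \sum_(p <- gtree m) \sum_(s <- subseqs (ids p))
    serving_prob p s / (lambda + (size s)%:R) *
    (\sum_(j <- s) (F ((s, inl j) :: p) - F p) +
     lambda * \sum_i pt i * (F ((s, inr i) :: p) - F p)).
Proof.
move=> F0.
transitivity (\sum_(p <- tree K m.+1) hist_prob p * F p).
  rewrite /mean_at big_filter [RHS](bigID (@going d K)).
  rewrite [X in _ = _ + X]big_seq_cond [X in _ = _ + X]big1 ?addr0//.
  move=> p /andP[/tree_ok[ok _] +].
  by rewrite /going andTb negb_or negbK => /andP[_ /eqP ip]; rewrite F0// mulr0.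
rewrite sum_tree /mean_at -big_split /= !big_seq.
by apply: eq_bigr => p /gtree_ok[ok _ gp]; rewrite drift.
Qed.

Lemma mean_holding0 : mean_holding 0 = lambda^-1.
Proof.
rewrite /mean_holding /gtree /= big_seq1.
transitivity (\sum_(s <- subseqs (ids ([::] : history))) serving_prob [::] s / lambda).
  rewrite !big_seq; apply: eq_bigr => s; rewrite mem_subseqs subseq0 => /eqP ->.
  by rewrite addr0.
by rewrite -mulr_suml (serving_prob_sum sys i0 K_gt0 pi_ok) hist_prob_nil mul1r.
Qed.

Lemma mean_at0 F : mean_at F 0 = F [::].
Proof. by rewrite /mean_at /gtree /= big_seq1 hist_prob_nil mul1r. Qed.

Lemma arrivals_departure s j p : arrivals ((s, inl j) :: p) = arrivals p. Proof. by []. Qed.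

Lemma arrivals_arrival s i p : arrivals ((s, inr i) :: p) = (arrivals p).+1.
Proof. by rewrite /arrivals /= size_rcons. Qed.

Lemma arrivals_le_size p : (arrivals p <= size p)%N.
Proof.
elim: p => [//|[s [j|i]] p IH]; first by rewrite arrivals_departure ltnW.
by rewrite arrivals_arrival.
Qed.

Lemma size_rem_ids p j : j \in ids p ->
  size [seq x <- ids p | x != j] = (size (ids p)).-1.
Proof.
by move=> jp; rewrite -rem_filter ?ids_uniq// size_rem.
Qed.

(* Each arrival is matched by a departure or by a job still present. *)
Lemma size_events p : hist_ok p -> (size p + size (ids p) = (arrivals p).*2)%N.
Proof.
elim: p => [//|[s [j|i]] p IH] /= /and4P[ok sub _ es]; have {}IH := IH ok.
  have jp := mem_subseq sub es.
  rewrite arrivals_departure -IH size_rem_ids// addSnnS prednK//.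
  by rewrite lt0n size_eq0; apply: contraTneq jp => ->; rewrite in_nil.
by rewrite arrivals_arrival size_rcons addSnnS -addSnnS doubleS -IH !addSn addnS.
Qed.

Lemma size_ids_le_arrivals p : hist_ok p -> (size (ids p) <= arrivals p)%N.
Proof.
move=> ok; have := size_events ok; have := arrivals_le_size p; rewrite -addnn => H1 H2.
by rewrite -(leq_add2l (arrivals p)) -H2 leq_add2r.
Qed.

Lemma size_le_double_arrivals p : hist_ok p -> (size p <= (arrivals p).*2)%N.
Proof. by move=> ok; rewrite -(size_events ok) leq_addr. Qed.

Let excess m0 p : R := (arrivals p - m0)%N%:R.

(** Arrivals accrue at rate at most [lambda] per unit of holding time. The truncated difference
    vanishes after [m0] events, which contain at most [m0] arrivals. *)
Lemma excess_le m0 n : mean_at (excess m0) (m0 + n) <=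
  lambda * \sum_(m0 <= k < m0 + n) mean_holding k.
Proof.
elim: n => [|n IH].
  rewrite addn0 big_geq// mulr0 /mean_at big_seq big1// => p /gtree_ok[_ sp _].
  by rewrite /excess (eqP (_ : (arrivals p - m0)%N == 0%N)) ?mulr0// subn_eq0 -sp arrivals_le_size.
rewrite addnS big_nat_recr ?leq_addr//= mulrDr.
apply: le_trans (mean_at_next _ _) _; first by move=> p _ _; rewrite ler0n.
apply: lerD => //; rewrite /mean_holding mulr_sumr; apply: ler_sum => p _.
rewrite mulr_sumr; apply: ler_sum => s _; rewrite mulrC; apply: ler_wpM2r.
  by apply: divr_ge0; [exact: serving_prob_ge0|exact/ltW/rate_pos].
rewrite big1 ?add0r; last by move=> j _; rewrite /excess arrivals_departure subrr.
rewrite -[leRHS]mulr1 -(type_prob_sum sys K_gt0); apply: ler_wpM2l; first exact: ltW.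
apply: ler_sum => i _; rewrite -[leRHS]mulr1; apply: ler_wpM2l.
  exact: type_prob_ge0.
rewrite /excess arrivals_arrival lerBlDl natr1 ler_nat.
by rewrite leq_subLR addnS ltnS -leq_subLR.
Qed.

Variable B : R.
Hypothesis mean_holding_bound : forall m, \sum_(k < m) mean_holding k <= B.

Let B_ge0 : 0 <= B.
Proof. by have := mean_holding_bound 0; rewrite big_ord0. Qed.

(** Markov's inequality: [m] events contain at least [m / 2] arrivals, and the mean number of
    arrivals on the surviving histories is at most [lambda * B]. *)
Lemma busy_prob_bound m : m%:R * busy_prob m <= 2 * (lambda * B).
Proof.
have H := excess_le 0 m; rewrite add0n big_mkord in H.
have := le_trans H (ler_wpM2l (ltW lambda_gt0) (mean_holding_bound m)).
rewrite -(ler_pM2l (ltr0n R 2)); apply: le_trans.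
rewrite /busy_prob /mean_at !mulr_sumr !big_seq; apply: ler_sum => p /gtree_ok[ok sp _].
rewrite mulrCA mulrC; apply: ler_wpM2l; first exact: hist_prob_ge0.
by rewrite /excess subn0 -natrM ler_nat -sp mul2n size_le_double_arrivals.
Qed.

Lemma busy_prob_small eps : 0 < eps ->
  exists m0, forall m, (m0 <= m)%N -> busy_prob m < eps.
Proof.
move=> e0; pose x := 2 * (lambda * B) / eps.
have x0 : 0 <= x by rewrite divr_ge0 ?mulr_ge0// ltW.
exists (Num.truncn x).+1 => m hm; have mx : x < m%:R.
  by apply: lt_le_trans (truncnS_gt x) _; rewrite ler_nat.
have m0 : 0 < (m%:R : R) by exact: le_lt_trans mx.
rewrite -(ltr_pM2l m0); apply: le_lt_trans (busy_prob_bound m) _.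
by rewrite -ltr_pdivrMr.
Qed.

Lemma mean_holding_cauchy eps : 0 < eps ->
  exists m0, forall n, \sum_(m0 <= k < m0 + n) mean_holding k <= eps.
Proof.
move=> e0; pose A := range (fun m => \sum_(k < m) mean_holding k).
have supA : has_sup A.
  by split; [exists (\sum_(k < 0) mean_holding k); exists 0%N|exists B => _ [m _ <-]].
have [_ [m0 _ <-] Hm0] := sup_adherent e0 supA.
exists m0 => n.
have : \sum_(k < m0 + n) mean_holding k <= sup A.
  by apply: ub_le_sup; [exact: supA.2|exists (m0 + n)%N].
rewrite -(big_mkord xpredT mean_holding) (big_cat_nat (n := m0)) ?leq_addr//= big_mkord.
by move: Hm0; lra.
Qed.

(** This makes the weight still present at step [m] negligible when a drift is summed over a cycle;
    smallness of [busy_prob] would not do, as the number of jobs is unbounded. *)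
Lemma mean_arrivals_small eps : 0 < eps ->
  exists2 m, (0 < m)%N & mean_at (fun p => (arrivals p)%:R) m <= eps.
Proof.
move=> e0; have e4 : 0 < eps / (2 * lambda) by rewrite divr_gt0// mulr_gt0.
have [m0 Hm0] := mean_holding_cauchy e4.
have e2 : 0 < eps / 2 / (m0%:R + 1) by rewrite !divr_gt0// ltr_wpDl.
have [m1 Hm1] := busy_prob_small e2.
exists (m0 + m1.+1)%N; first by rewrite addnS.
have mt := Hm1 (m0 + m1.+1)%N (leq_trans (leqnSn _) (leq_addl _ _)).
(* The first [m0] arrivals are multiplied by a small probability; the excess is paid for by the tail
   of the holding times. *)
apply: (@le_trans _ _ (m0%:R * busy_prob (m0 + m1.+1) + mean_at (excess m0) (m0 + m1.+1))).
  rewrite /mean_at /busy_prob mulr_sumr -big_split /=; apply: ler_sum => p _.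
  rewrite [m0%:R * _]mulrC -mulrDr; apply: ler_wpM2l; first exact: hist_prob_ge0.
  by rewrite /excess -natrD ler_nat -leq_subLR.
have H1 := le_trans (excess_le m0 m1.+1) (ler_wpM2l (ltW lambda_gt0) (Hm0 m1.+1)).
have -> : eps = eps / 2 + lambda * (eps / (2 * lambda)).
  by field; rewrite gt_eqF.
apply: lerD => //; have m00 : 0 <= (m0%:R : R) by [].
have m01 : 0 < (m0%:R + 1 : R) by rewrite ltr_wpDl.
apply: le_trans (ler_wpM2l m00 (ltW mt)) _.
rewrite mulrA ler_pdivrMr// mulrC; apply: ler_wpM2l; last by rewrite lerDl.
by rewrite divr_ge0// ltW.
Qed.

Lemma sum_served_ids (F : nat -> R) p w : \sum_(j <- served_ids p w) F j =
  \sum_(n in pi (map_tuple (fun j => V j w) (in_tuple (ids p))))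
    F (nth 0%N (ids p) n).
Proof.
rewrite /served_ids big_filter (big_nth 0%N) big_mkord; apply: eq_bigl => n.
by rewrite index_uniq ?ids_uniq// sel_mem.
Qed.

Lemma serving_prob_witness p s : serving_prob p s != 0 -> exists2 w, follows p w & served_ids p w = s.
Proof.
move=> H; apply: contrapT => nE; move/eqP: H; apply.
rewrite /serving_prob (_ : follows_serving p s = set0) ?Pr0//; apply/seteqP; split=> // w [Ew sw].
by apply: nE; exists w.
Qed.

Lemma is_state_ids p w : follows p w ->
  is_state (map_tuple (fun j => V j w) (in_tuple (ids p))).
Proof.
move=> [pw _] n; rewrite tnth_map (tnth_nth 0%N).
apply: (of_type_cube K_gt0); apply: (choices_types i0 pw).
by apply: ids_lt; exact: mem_nth.
Qed.

Variables (g : job_type K -> R) (W : R).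
Hypothesis g_ge0 : forall i, 0 <= g i.
Hypothesis g_feasible : forall s (v : nat -> rvec R d) (ty : nat -> job_type K),
  (forall j, j \in s -> of_type (ty j) (v j)) ->
  (forall l, \sum_(j <- s) tnth (v j) l <= 1) ->
  \sum_(j <- s) g (ty j) <= W.

Let Eg : R := \sum_i pt i * g i.

Let G p : R := \sum_(j <- ids p) g (typ p j).

Let W_ge0 : 0 <= W.
Proof.
have := @g_feasible [::] (fun=> [tuple of nseq d 0]) (fun=> i0).
by rewrite big_nil; apply=> // l; rewrite big_nil.
Qed.

(** A set of positive probability is served at some outcome, where the policy respects the
    capacities. *)
Let served_value p s : serving_prob p s != 0 -> \sum_(j <- s) g (typ p j) <= W.
Proof.
move=> /serving_prob_witness[w Ew sw]; apply: (@g_feasible s (fun j => V j w)).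
  move=> j js; have [pw _] := Ew; apply: (choices_types i0 pw).
  by apply: ids_lt; move: js; rewrite -sw mem_filter => /andP[].
move=> l; rewrite -sw (sum_served_ids (fun j => tnth (V j w) l)).
have := pi_ok.1 _ _ (is_state_ids Ew) l.
apply: le_trans; rewrite le_eqVlt; apply/orP; left; apply/eqP.
by apply: eq_bigr => n _; rewrite tnth_map (tnth_nth 0%N).
Qed.

Let G_departure p s j : j \in ids p -> G ((s, inl j) :: p) = G p - g (typ p j).
Proof.
move=> jp; rewrite /G [in RHS](bigD1_seq j) ?ids_uniq//= [RHS]addrC addKr big_filter.
by apply: eq_bigr.
Qed.

Let G_arrival p s i : G ((s, inr i) :: p) = G p + g i.
Proof.
rewrite /G /= big_rcons /=; congr (_ + _); last first.
  by rewrite typ_arrival.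
by rewrite !big_seq; apply: eq_bigr => j jp; rewrite typ_cons// ids_lt.
Qed.

Let G_drift p s : subseq s (ids p) ->
  \sum_(j <- s) (G ((s, inl j) :: p) - G p) +
     lambda * \sum_i pt i * (G ((s, inr i) :: p) - G p) =
  lambda * Eg - \sum_(j <- s) g (typ p j).
Proof.
move=> sub; rewrite addrC; congr (_ + _).
  by congr (_ * _); apply: eq_bigr => i _; rewrite G_arrival addrC addKr.
rewrite -[RHS]sumrN; apply: eq_big_seq => j js.
by rewrite G_departure ?(mem_subseq sub)// addrC addKr.
Qed.

Let G_mean m : (lambda * Eg - W) * \sum_(k < m.+1) mean_holding k + W / lambda <=
  mean_at G m.+1.
Proof.
have G0 p : hist_ok p -> ids p = [::] -> G p = 0.
  by move=> _ ip; rewrite /G ip big_nil.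
elim: m => [|m IH].
  (* Nothing is served in the empty state, so the drift there is [lambda * Eg] in full during a mean
     time [lambda^-1]. Charging [W] for this period as well leaves the surplus [W / lambda]. *)
  rewrite big_ord1 mean_holding0 mean_at_next_eq// mean_at0.
  rewrite G0// add0r /gtree /= big_seq1.
  rewrite (eq_big_seq (fun s => serving_prob [::] s * Eg)); last first.
    move=> s; rewrite mem_subseqs => sub; rewrite G_drift//.
    move: sub; rewrite subseq0 => /eqP ->; rewrite big_nil subr0 addr0.
    by rewrite mulrA divfK// gt_eqF.
  rewrite -mulr_suml (serving_prob_sum sys i0 K_gt0 pi_ok) hist_prob_nil mul1r.
  by rewrite mulrBl addrNK mulrAC divff ?gt_eqF// mul1r.
rewrite big_ord_recr /= mulrDr addrAC mean_at_next_eq//.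
apply: lerD => //; rewrite mulr_sumr; apply: ler_sum => p _.
rewrite mulr_sumr !big_seq; apply: ler_sum => s; rewrite mem_subseqs => sub.
rewrite G_drift// mulrC.
(* A set of probability 0 may be infeasible, but its term vanishes. *)
have [->|b0] := eqVneq (serving_prob p s) 0; first by rewrite !mul0r.
apply: ler_wpM2l.
  by apply: divr_ge0; [exact: serving_prob_ge0|exact/ltW/rate_pos].
by rewrite lerD2l lerN2; exact: served_value.
Qed.

Lemma necessary_load : (lambda * Eg - W) * B + W / lambda <= 0.
Proof.
pose gmax := \sum_i g i.
have gle i : g i <= gmax.
  by rewrite /gmax (bigD1 i)//= lerDl; apply: sumr_ge0.
have gmax0 : 0 <= gmax by exact: sumr_ge0.
have GC p : hist_ok p -> G p <= gmax * (arrivals p)%:R.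
  move=> ok; apply: (@le_trans _ _ (\sum_(j <- ids p) gmax)); first exact: ler_sum.
  rewrite big_const_seq count_predT iter_addr_0 -[leLHS]mulr_natr.
  by apply: ler_wpM2l => //; rewrite ler_nat size_ids_le_arrivals.
pose x := lambda * Eg - W.
(* [Th] is a partial sum of mean holding times, taken far enough for the remaining weight, at most
   [gmax] per arrival, to have mean at most [e]. *)
have key e : 0 < e ->
    exists2 Th, lambda^-1 <= Th <= B & x * Th + W / lambda <= e.
  move=> e0; have e1 : 0 < e / (gmax + 1) by rewrite divr_gt0// ltr_wpDl.
  have [[//|m] _ Hm] := mean_arrivals_small e1.
  exists (\sum_(k < m.+1) mean_holding k).
    rewrite mean_holding_bound andbT big_ord_recl /= mean_holding0 lerDl.
    by apply: sumr_ge0 => k _; exact: mean_holding_ge0.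
  apply: le_trans (G_mean m) _.
  apply: (@le_trans _ _ (gmax * mean_at (fun p => (arrivals p)%:R) m.+1)).
    rewrite /mean_at mulr_sumr !big_seq; apply: ler_sum => p /gtree_ok[ok _ _].
    by rewrite mulrCA; apply: ler_wpM2l; [exact: hist_prob_ge0|exact: GC].
  apply: le_trans (ler_wpM2l gmax0 Hm) _.
  have g1 : 0 < gmax + 1 by rewrite ltr_wpDl.
  rewrite mulrA ler_pdivrMr// mulrC.
  by apply: ler_wpM2l; [exact: ltW|rewrite lerDl].
rewrite -/x; have Wl : 0 <= W / lambda by rewrite divr_ge0// ltW.
have l0 : 0 < lambda^-1 by rewrite invr_gt0.
(* [Th] depends on [e] and is only known to lie between [lambda^-1] and [B]. A negative [x] uses the
   upper end; otherwise the lower end forces [x = 0]. *)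
have [x0|x0] := leP 0 x.
  have : x * lambda^-1 + W / lambda <= 0.
    apply/ler_addgt0Pr => e /key[Th /andP[H1 _] H2]; rewrite add0r.
    by apply: le_trans H2; rewrite lerD2r; apply: ler_wpM2l.
  have : 0 <= x * lambda^-1 by rewrite mulr_ge0// ltW.
  move=> H1 H2; have /eqP : x * lambda^-1 = 0 by lra.
  rewrite mulf_eq0 invr_eq0 (gt_eqF lambda_gt0) orbF => /eqP xE.
  by rewrite xE mul0r add0r; lra.
apply/ler_addgt0Pr => e /key[Th /andP[_ H1] H2]; rewrite add0r.
by apply: le_trans H2; rewrite lerD2r; apply: ler_wnM2l => //; exact: ltW.
Qed.
End Drift.

(** * Discretization of the density *)

Section IteratedIntegral.
Context {R : realType}.

Lemma lebesgue_iint_ge0 d (g : rvec R d -> \bar R) :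
  (forall v, (0 <= g v)%E) -> (0 <= lebesgue_iint g)%E.
Proof.
elim: d g => [|d IH] g g0 /=; first exact: g0.
by apply: integral_ge0 => t _; apply: IH => v; exact: g0.
Qed.

Lemma le_lebesgue_iint d (g h : rvec R d -> \bar R) :
  (forall v, (0 <= g v)%E) -> (forall v, (g v <= h v)%E) ->
  (lebesgue_iint g <= lebesgue_iint h)%E.
Proof.
elim: d g h => [|d IH] g h g0 gh /=; first exact: gh.
apply: ge0_le_integral_any => t; first by apply: lebesgue_iint_ge0 => v; exact: g0.
by apply: IH => v; [exact: g0|exact: gh].
Qed.

Definition in_box d (lo : 'I_d -> R) (h : R) (v : rvec R d) : bool :=
  [forall l, lo l < tnth v l <= lo l + h].

Lemma in_box_cons d (lo : 'I_d.+1 -> R) h t (v : rvec R d) :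
  in_box lo h [tuple of t :: v] =
  (lo ord0 < t <= lo ord0 + h) && in_box (fun l => lo (lift ord0 l)) h v.
Proof.
apply/forallP/andP => [H|[H0 /forallP H] l].
  split; first by have := H ord0; rewrite tnth0.
  by apply/forallP => l; have := H (lift ord0 l); rewrite tnthS.
by case: (unliftP ord0 l) => [k ->|->]; rewrite ?tnthS ?tnth0.
Qed.

(** The constant stays under the integral through the induction, so that a first coordinate outside
    its side is the same formula with [a = 0]. *)
Lemma lebesgue_iint_box d (lo : 'I_d -> R) h a : 0 <= h -> 0 <= a ->
  lebesgue_iint (fun v => (a * (in_box lo h v)%:R)%:E) = (a * h ^+ d)%:E.
Proof.
move=> h0; elim: d lo a => [|d IH] lo a a0 /=.
  rewrite expr0 mulr1 (_ : in_box _ _ _ = true) ?mulr1//.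
  by apply/forallP => -[].
pose D : set R := `]lo ord0, lo ord0 + h]%classic.
pose c : \bar R := (a * h ^+ d)%:E.
transitivity (\int[lebesgue_measure]_(t in [set: R]) ((cst c : R -> \bar R) \_ D) t)%E;
  last first.
  rewrite -integral_mkcond integral_cst; last exact: measurable_itv.
  have HL := @lebesgue_measure_itv R `]lo ord0, (lo ord0 + h)%R].
  rewrite /D /c [X in (_ * X)%E](_ : _ =
    lebesgue_measure `]lo ord0, (lo ord0 + h)%R]%classic)// HL /= lte_fin.
  case: ifPn => [_|].
    by rewrite -EFinD -EFinM addrC addKr exprSr mulrA.
  rewrite -leNgt gerDl => h0'; have -> : h = 0 by apply/eqP; rewrite eq_le h0' h0.
  by rewrite mule0 expr0n/= mulr0.
apply: eq_integral => t _; rewrite patchE; case: ifPn.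
  rewrite inE /D /= in_itv/= => ht.
  apply: etrans (IH (fun l => lo (lift ord0 l)) a a0); congr lebesgue_iint.
  by apply/funext => v; rewrite in_box_cons ht.
rewrite notin_setE /D /= in_itv/= => /negP/negbTE ht.
rewrite (_ : (fun v => _) = fun v => (0 * (in_box (fun l => lo (lift ord0 l)) h v)%:R)%:E).
  by rewrite (IH _ 0)// mul0r.
by apply/funext => v; rewrite in_box_cons ht mulr0 mul0r.
Qed.
End IteratedIntegral.

Section Density.
Context {disp : measure_display} {Omega : measurableType disp} {R : realType}.
Context {P : probability Omega R} {d : nat} {lambda : R} {f : rvec R d -> R}.
Variable sys : primitives P lambda f.
Hypothesis lambda_gt0 : 0 < lambda.
Local Notation V := (requirement sys).

Variable L : R.
Hypothesis L_ge0 : 0 <= L.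
Hypothesis f_lip : forall u v, unit_cube u -> unit_cube v ->
  `|f u - f v| <= L * sup_dist u v.

Let f_ge0 v : unit_cube v -> 0 <= f v.
Proof. by have [H _] := requirement_law sys 0%N; exact: H. Qed.

Lemma sup_dist_le (u v : rvec R d) h : 0 <= h ->
  (forall l, `|tnth u l - tnth v l| <= h) -> sup_dist u v <= h.
Proof. by move=> h0 H; apply: bigmax_le => // l _. Qed.

Section Grid.
Variable n : nat.
Definition grid : 'I_d -> nat := fun=> n.+1.
Let h : R := n.+1%:R^-1.
Local Notation pt := (type_prob sys (K := grid)).

Let h_gt0 : 0 < h. Proof. by rewrite /h invr_gt0. Qed.

Let grid_gt0 l : (0 < grid l)%N. Proof. by []. Qed.

Let of_typeE (i : job_type grid) v : of_type i v =
  in_box (fun l => (i l)%:R * h) h v.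
Proof.
apply: eq_forallb => l; congr (_ < _ <= _).
by rewrite -natr1 mulrDl mul1r.
Qed.

Let pt_iint (i : job_type grid) : (pt i)%:E =
  lebesgue_iint (fun v => (\1_([set v | of_type i v] `&` @unit_cube R d) v * f v)%:E).
Proof.
have mi := @measurable_of_type R d grid i.
rewrite -PrE; last exact: measurable_V.
by have [_ ->] := requirement_law sys 0%N.
Qed.

Let indicE_cell (i : job_type grid) v :
  \1_([set v | of_type i v] `&` @unit_cube R d) v = (of_type i v)%:R :> R.
Proof.
rewrite indicE; case: (boolP (of_type i v)) => vi.
  by rewrite mem_set//; split=> //; exact: (of_type_cube grid_gt0 vi).
by rewrite memNset// => -[/= vi']; rewrite vi' in vi.
Qed.

Lemma type_prob_le (i : job_type grid) c : 0 <= c ->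
  (forall v, of_type i v -> f v <= c) -> pt i <= c * h ^+ d.
Proof.
move=> c0 H; rewrite -lee_fin pt_iint.
rewrite -(lebesgue_iint_box (fun l => (i l)%:R * h) (ltW h_gt0) c0).
apply: le_lebesgue_iint => v; rewrite indicE_cell -?of_typeE lee_fin;
  case: (boolP (of_type i v)) => vi; rewrite ?mul0r ?mul1r ?mulr0 ?mulr1//.
- by apply: f_ge0; exact: (of_type_cube grid_gt0 vi).
- exact: H.
Qed.

Lemma type_prob_ge (i : job_type grid) c :
  (forall v, of_type i v -> c <= f v) -> c * h ^+ d <= pt i.
Proof.
move=> H; have [c0|c0] := leP 0 c; last first.
  apply: (@le_trans _ _ 0); last exact: type_prob_ge0.
  by rewrite mulr_le0_ge0 ?exprn_ge0// ltW.
rewrite -lee_fin pt_iint.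
rewrite -(lebesgue_iint_box (fun l => (i l)%:R * h) (ltW h_gt0) c0).
apply: le_lebesgue_iint => v; rewrite ?indicE_cell -of_typeE lee_fin;
  case: (boolP (of_type i v)) => vi; rewrite ?mul0r ?mul1r ?mulr0 ?mulr1//.
exact: H.
Qed.

(** The upper corner, which the half-open cell contains. *)
Let corner (i : job_type grid) : rvec R d := [tuple (i l).+1%:R * h | l < d].

Let corner_type i : of_type i (corner i).
Proof.
apply/forallP => l; rewrite tnth_mktuple lexx andbT.
by rewrite ltr_pM2r// ltr_nat.
Qed.

Let corner_cube i : unit_cube (corner i).
Proof. exact: (of_type_cube grid_gt0 (corner_type i)). Qed.

Let near_corner i v : of_type i v -> `|f v - f (corner i)| <= L * h.
Proof.
move=> vi; apply: le_trans (f_lip _ _) _ => //.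
  exact: (of_type_cube grid_gt0 vi).
apply: ler_wpM2l => //; apply: sup_dist_le => [|l]; first exact: ltW.
have /andP[lo hi] := forallP vi l; rewrite tnth_mktuple.
rewrite ler0_norm; last by rewrite subr_le0.
by rewrite opprB -natr1 mulrDl mul1r; move: lo; rewrite -/h; lra.
Qed.

(** The density varies by at most [L * h] inside each of the two cells and between their corners,
    whence the factor 3. *)
Lemma type_prob_shift (i j : job_type grid) : (forall l, j l = (i l).+1 :> nat) ->
  pt i <= pt j + 3 * L * h * h ^+ d.
Proof.
move=> ij; have cc : `|f (corner i) - f (corner j)| <= L * h.
  apply: le_trans (f_lip _ _) _ => //; apply: ler_wpM2l => //.
  apply: sup_dist_le => [|l]; first exact: ltW.
  rewrite !tnth_mktuple ij -mulrBl -[(i l).+2%:R]natr1 opprD addNKr.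
  by rewrite mulN1r normrN ger0_norm// ltW.
have fc : 0 <= f (corner i) by exact: f_ge0.
have Lh : 0 <= L * h by rewrite mulr_ge0// ltW.
have up : pt i <= (f (corner i) + L * h) * h ^+ d.
  apply: type_prob_le => [|v /near_corner]; first exact: addr_ge0.
  by rewrite ler_norml => /andP[_]; lra.
have lo : (f (corner j) - L * h) * h ^+ d <= pt j.
  apply: type_prob_ge => v /near_corner.
  by rewrite ler_norml => /andP[+ _]; lra.
have hd : 0 <= h ^+ d by rewrite exprn_ge0// ltW.
move: cc; rewrite ler_norml => /andP[_ cc].
have : (f (corner i) + L * h) * h ^+ d <=
       (f (corner j) - L * h + 3 * L * h) * h ^+ d.
  by apply: ler_wpM2r => //; lra.
by rewrite mulrDl; lra.
Qed.

(** Bounds the density on the cube, since every point there is within sup distance 1 of the corner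
    [(1, ..., 1)]. *)
Definition density_bound : R := f [tuple 1 | _ < d] + L.

Let one_cube : unit_cube ([tuple 1 | _ < d] : rvec R d).
Proof. by move=> l; rewrite tnth_mktuple ltr01 lexx. Qed.

Lemma density_bound_ge0 : 0 <= density_bound.
Proof. by rewrite addr_ge0// f_ge0. Qed.

Lemma type_prob_max (i : job_type grid) : pt i <= density_bound * h ^+ d.
Proof.
apply: type_prob_le => [|v vi]; first exact: density_bound_ge0.
have vc : unit_cube v by exact: (of_type_cube grid_gt0 vi).
have := f_lip vc one_cube; rewrite ler_norml => /andP[_ H].
rewrite /density_bound -lerBlDl; apply: le_trans H _.
rewrite ler_piMr//; apply: sup_dist_le => // l; rewrite tnth_mktuple.
have /andP[v0 v1] := vc l; rewrite ler0_norm ?subr_le0// opprB.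
by move: v0; lra.
Qed.

Lemma card_grid : (#|job_type grid| = n.+1 ^ d)%N.
Proof.
rewrite card_dep_ffun /image_mem (eq_map (g := fun=> n.+1)).
  rewrite -[in RHS](card_ord d) cardE.
  by elim: (enum _) => //= _ s ->; rewrite expnS.
by move=> l; rewrite card_ord.
Qed.

Let last l : pred (job_type grid) := fun j => j l == n :> nat.

(** Overwriting coordinate [l] of a type in the last layer by an arbitrary value is injective,
    because the lost value is always [n]. *)
Lemma card_last l : (#|last l| * n.+1 <= n.+1 ^ d)%N.
Proof.
rewrite -card_grid -[n.+1 in X in (X <= _)%N]card_ord -cardX.
pose ch (ja : job_type grid * 'I_n.+1) : job_type grid :=
  [ffun k => if k == l then ja.2 else ja.1 k].
apply: (@leq_card_in _ _ ch) => -[j a] [j' a'].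
rewrite !inE /= !andbT => jl jl' E.
have Ek k : ch (j, a) k = ch (j', a') k by rewrite E.
congr (_, _); last by have := Ek l; rewrite !ffunE eqxx.
apply/ffunP => k; have [->|kl] := eqVneq k l.
  by apply: val_inj; rewrite /= (eqP jl) (eqP jl').
by have := Ek k; rewrite !ffunE (negbTE kl).
Qed.

Let inner (j : job_type grid) := [forall l, j l < n]%N.
Let positive_type (i : job_type grid) := [forall l, 0 < i l]%N.
Let succ_type (j : job_type grid) : job_type grid :=
  [ffun l => inord (j l).+1].
Let pred_type (i : job_type grid) : job_type grid :=
  [ffun l => inord (i l).-1].

Variables (q M : job_type grid -> nat).
Hypothesis qM : max_weight q M.
Let W := (\sum_i q i * M i)%N.

Let q_le i : (q i <= W)%N.
Proof. exact: max_weight_ge. Qed.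

Let Wr : R := W%:R.

(** The last layers of the [d] directions contain at most a fraction [d%:R * h] of the cells. *)
Let boundary_load : \sum_(j | ~~ inner j) pt j * (q j)%:R <=
  density_bound * d%:R * h * Wr.
Proof.
have hd : 0 <= h ^+ d by rewrite exprn_ge0// ltW.
have D0 := density_bound_ge0.
apply: (@le_trans _ _ (\sum_(j | ~~ inner j) density_bound * h ^+ d * Wr)).
  apply: ler_sum => j _; apply: ler_pM; rewrite ?type_prob_ge0//.
    exact: type_prob_max.
  by rewrite ler_nat q_le.
rewrite sumr_const -[leLHS]mulr_natr.
have card_le : (#|[pred j | ~~ inner j]| * n.+1 <= d * n.+1 ^ d)%N.
  apply: (@leq_trans (\sum_(l < d) #|last l| * n.+1)); last first.
    rewrite -[d in (_ <= d * _)%N]card_ord -sum_nat_const.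
    by apply: leq_sum => l _; exact: card_last.
  rewrite -big_distrl /= leq_mul2r; apply/orP; right.
  rewrite -sum1_card.
  apply: (@leq_trans (\sum_j \sum_(l < d) last l j)).
    rewrite [leqLHS]big_mkcond /=; apply: leq_sum => j _; case: ifP => //.
    rewrite inE negb_forall => /existsP[l]; rewrite -leqNgt => nj.
    have lj : last l j by rewrite /last eqn_leq nj andbT -ltnS ltn_ord.
    by rewrite (bigD1 l)//= lj.
  rewrite exchange_big /=; apply: leq_sum => l _.
  rewrite -sum1_card [leqRHS]big_mkcond /=; apply: leq_sum => j _.
  by rewrite -[j \in last l]/(last l j); case: (last l j).
have -> : density_bound * d%:R * h * Wr =
          density_bound * h ^+ d * Wr * (d%:R * h * n.+1%:R ^+ d).
  have : h ^+ d * n.+1%:R ^+ d = 1 by rewrite -exprMn /h mulVf ?expr1n// pnatr_eq0.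
  move: (h ^+ d) (n.+1%:R ^+ d) => a b E.
  by rewrite -[LHS]mulr1 -E; ring.
apply: ler_wpM2l; first by rewrite !mulr_ge0.
rewrite mulrAC -ler_pdivrMr// /h invrK -natrX -!natrM ler_nat.
exact: card_le.
Qed.

(** Each inner cell is charged to its successor. The errors [3 * L * h * h ^+ d] add up, over at
    most [n.+1 ^ d] cells, to [3 * L * h]. *)
Let inner_load : \sum_(j | inner j) pt j * (q j)%:R <=
  \sum_i pt i * (if positive_type i then (q (pred_type i))%:R else 0) +
  3 * L * h * Wr.
Proof.
have hd : 0 <= h ^+ d by rewrite exprn_ge0// ltW.
have Lh : 0 <= 3 * L * h by rewrite !mulr_ge0// ltW.
have succP j : inner j -> forall l, succ_type j l = (j l).+1 :> nat.
  by move=> /forallP jn l; rewrite ffunE inordK// ltnS.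
apply: (@le_trans _ _ (\sum_(j | inner j)
    (pt (succ_type j) * (q j)%:R + 3 * L * h * h ^+ d * (q j)%:R))).
  apply: ler_sum => j jn; rewrite -mulrDl; apply: ler_wpM2r => //.
  by apply: type_prob_shift; exact: succP.
rewrite big_split /=; apply: lerD; last first.
  apply: (@le_trans _ _ (\sum_(j : job_type grid) 3 * L * h * h ^+ d * Wr)).
    rewrite [leLHS]big_mkcond; apply: ler_sum => j _; case: ifP => _.
      by apply: ler_wpM2l; [exact: mulr_ge0|rewrite ler_nat q_le].
    by apply: mulr_ge0 => //; exact: mulr_ge0.
  rewrite sumr_const -[leLHS]mulr_natr card_grid natrX.
  have E : h ^+ d * n.+1%:R ^+ d = 1 by rewrite -exprMn /h mulVf ?expr1n// pnatr_eq0.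
  have aux (a b : R) : a * b = 1 -> 3 * L * h * a * Wr * b = 3 * L * h * Wr.
    by move=> ab; rewrite -[RHS]mulr1 -ab; ring.
  by rewrite aux.
under [leRHS]eq_bigr do rewrite (fun_if (fun x => _ * x)) mulr0.
rewrite -big_mkcond /= [leRHS](reindex_onto succ_type pred_type); last first.
  move=> i /forallP ip; apply/ffunP => l; apply: ord_inj.
  rewrite !ffunE; have il := ltn_ord (i l).
  have pl : ((i l).-1 < n.+1)%N := leq_ltn_trans (leq_pred _) il.
  have ipl : (0 < i l)%N by exact: ip.
  by rewrite (inordK pl) (prednK ipl) (@inordK n _ il).
rewrite le_eqVlt; apply/orP; left; apply/eqP; apply: eq_big => [j|j jn].
  apply/idP/andP => [jn|[/forallP H _]].
    split; first by apply/forallP => l; rewrite succP.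
    apply/eqP/ffunP => l; apply: ord_inj; rewrite !ffunE.
    have jl := succP _ jn l; rewrite ffunE in jl; rewrite jl /=.
    by rewrite inordK.
  (* [inord] sends an index out of range to 0, so a successor positive in every direction comes from
     an inner type. *)
  apply/forallP => l; have := H l; rewrite ffunE.
  have [//|jl] := ltnP (j l) n.
  rewrite /inord /insubd insubN//= -leqNgt ltnS; exact: jl.
congr (_ * (q _)%:R); apply/ffunP => l; apply: ord_inj; rewrite !ffunE.
have jl := succP _ jn l; rewrite ffunE in jl; rewrite jl /=.
by rewrite inordK.
Qed.

(** Counting the shifted types of a feasible set of jobs gives an admissible service option [M'],
    whose weight MaxWeight dominates. *)
Let feasible_value s (v : nat -> rvec R d) (ty : nat -> job_type grid) :
  (forall j, j \in s -> of_type (ty j) (v j)) ->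
  (forall l, \sum_(j <- s) tnth (v j) l <= 1) ->
  \sum_(j <- s) (if positive_type (ty j) then (q (pred_type (ty j)))%:R else 0) <= Wr.
Proof.
move=> Hty Hcap.
pose M' (a : job_type grid) := (\sum_(j <- s | positive_type (ty j)) (pred_type (ty j) == a))%N.
have sumM (c : job_type grid -> nat) : (\sum_a c a * M' a =
    \sum_(j <- s | positive_type (ty j)) c (pred_type (ty j)))%N.
  rewrite /M'; under eq_bigr do rewrite big_distrr /=.
  rewrite exchange_big /=; apply: eq_bigr => j _.
  rewrite (bigD1 (pred_type (ty j)))//= eqxx muln1 big1 ?addn0// => a.
  by rewrite eq_sym => /negbTE ->; rewrite muln0.
have sM' : service_option M'.
  move=> l; rewrite (sumM (fun a => (a l).+1)) -(ler_nat R).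
  rewrite natr_sum.
  apply: (@le_trans _ _ (\sum_(j <- s) (grid l)%:R * tnth (v j) l)); last first.
    by rewrite -mulr_sumr ler_piMr.
  rewrite big_mkcond /= big_seq [leRHS]big_seq; apply: ler_sum => j js.
  have /forallP/(_ l)/andP[lo _] := Hty _ js.
  (* The 1-based index of the predecessor is the 0-based index of the type, that is, the lower end
     of its cell in units of [h]. *)
  have vl : (ty j l)%:R <= (grid l)%:R * tnth (v j) l.
    by move: lo; rewrite ltr_pdivrMr// mulrC => /ltW.
  case: ifP => [/forallP/(_ l) tp|_].
    have tl := ltn_ord (ty j l).
    have pl : ((ty j l).-1 < n.+1)%N := leq_ltn_trans (leq_pred _) tl.
    by rewrite ffunE (inordK pl) prednK.
  exact: le_trans vl.
have := qM.2 _ sM'; rewrite sumM -(ler_nat R) natr_sum => H.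
by rewrite -big_mkcond.
Qed.

(** The queue lengths [q] are arbitrary numbers, unrelated to the trajectories of the policy behind
    [nec]; they act only as weights. *)
Lemma grid_load (B : R) : 0 < B ->
  (forall (g : job_type grid -> R) (W : R), (forall i, 0 <= g i) ->
    (forall s (v : nat -> rvec R d) (ty : nat -> job_type grid),
      (forall j, j \in s -> of_type (ty j) (v j)) ->
      (forall l, \sum_(j <- s) tnth (v j) l <= 1) ->
      \sum_(j <- s) g (ty j) <= W) ->
    (lambda * (\sum_i pt i * g i) - W) * B + W / lambda <= 0) ->
  lambda * \sum_i pt i * (q i)%:R <=
  (1 - 1 / (lambda * B) + lambda * (3 * L + density_bound * d%:R) * h) *
  (\sum_i q i * M i)%N%:R.
Proof.
move=> B0 nec.
have := nec (fun i => if positive_type i then (q (pred_type i))%:R else 0) Wr _ feasible_value.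
set S := \sum_i _ => H.
have {}H : (lambda * S - Wr) * B + Wr / lambda <= 0.
  by apply: H => i; case: ifP.
have H1 : lambda * S <= (1 - 1 / (lambda * B)) * Wr.
  rewrite -(ler_pM2r B0) -subr_le0; apply: le_trans H.
  rewrite le_eqVlt; apply/orP; left; apply/eqP; field.
  by rewrite !gt_eqF.
rewrite (bigID inner) /=.
have H2 := lerD inner_load boundary_load; rewrite -/S in H2.
have := ler_wpM2l (ltW lambda_gt0) H2; rewrite -/Wr.
by move: H1; lra.
Qed.
End Grid.
End Density.

(** * Drift under MaxWeight *)

(** The arithmetic of states with few jobs: the 4 in [A] makes up for the division by 2 and for the
    factor [1 - t >= 1 / 2]. *)
Lemma small_state_drift (R : realFieldType) (A t0 t1 t c e w : R) :
  0 <= A -> t0 <= t1 -> A * t0 = 4 * (c + 1) -> t <= 1 / 2 -> 0 <= c ->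
  0 <= e * w -> c - 2 * e * w - A * t1 * (1 - t) / 2 <= -1.
Proof.
move=> A0 t01 At th c0 ew.
have H1 : A * t0 <= A * t1 by exact: ler_wpM2l.
have H2 : A * t1 * (1 / 2) <= A * t1 * (1 - t) by apply: ler_wpM2l; lra.
by rewrite -mulrA; lra.
Qed.

Section MaxWeightDrift.
Context {disp : measure_display} {Omega : measurableType disp} {R : realType}.
Context {P : probability Omega R} {d : nat} {lambda : R} {f : rvec R d -> R}.
Variables (sys : primitives P lambda f) (pi : policy R d).
Variables (K : 'I_d -> nat) (i0 : job_type K) (l0 : 'I_d).
Hypothesis lambda_gt0 : 0 < lambda.
Hypothesis K_gt0 : forall l, (0 < K l)%N.
Hypothesis pi_KMW : is_KMW K pi.
Local Notation V := (requirement sys).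
Local Notation history := (history K).
Local Notation follows := (follows sys pi (K := K)).
Local Notation served_ids := (served_ids sys pi (K := K)).
Local Notation hist_prob := (hist_prob sys pi (K := K)).
Local Notation serving_prob := (serving_prob sys pi (K := K)).
Local Notation mean_holding := (mean_holding sys pi K).
Local Notation typ := (typ i0).
Local Notation pt := (type_prob sys (K := K)).
Local Notation mean_at := (mean_at sys pi (K := K)).
Implicit Types (p : history) (s : seq nat) (w : Omega).

Let pi_ok : markovian_policy pi := pi_KMW.1.

Definition type_num p (i : job_type K) : nat := count (fun j => typ p j == i) (ids p).

Let sum_typ (l : seq nat) p (F : job_type K -> R) :
  \sum_(j <- l) F (typ p j) =
  \sum_i (count (fun j => typ p j == i) l)%:R * F i.
Proof.
have key k : F k = \sum_i (k == i)%:R * F i.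
  rewrite (bigD1 k)//= eqxx mul1r big1 ?addr0// => i.
  by rewrite eq_sym => /negbTE ->; rewrite mul0r.
rewrite (eq_bigr (fun j => \sum_i (typ p j == i)%:R * F i)); last by move=> j _; exact: key.
rewrite exchange_big /=; apply: eq_bigr => i _; rewrite -mulr_suml -sum1_count.
rewrite natr_sum [in RHS]big_mkcond /=; congr (_ * _).
by apply: eq_bigr => j _; case: eqP.
Qed.

Lemma max_weight_service p s : serving_prob p s != 0 -> exists2 M : job_type K -> nat,
  max_weight (type_num p) M &
  forall i, count (fun j => typ p j == i) s = minn (M i) (type_num p i).
Proof.
move=> /serving_prob_witness[w Ew sw].
set x := map_tuple (fun j => V j w) (in_tuple (ids p)).
have typE j i : j \in ids p -> of_type i (V j w) = (typ p j == i).
  move=> jp; have [pw _] := Ew.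
  have H := choices_types i0 pw (ids_lt jp).
  apply/idP/eqP => [H'|<-//]; exact: (of_type_unique K_gt0 H H').
have tnthE (n : 'I_(size (ids p))) i : of_type i (tnth x n) =
    (typ p (nth 0%N (ids p) n) == i).
  by rewrite tnth_map (tnth_nth 0%N) typE// mem_nth.
have [M [HM Hs]] := pi_KMW.2 _ x (is_state_ids i0 K_gt0 Ew).
have cE : type_count x = type_num p.
  apply/funext => i; rewrite /type_count /type_num -sum1_count (big_nth 0%N) big_mkord.
  rewrite -sum1_card; apply: eq_bigl => n.
  by apply/idP/idP; rewrite in_setE /= tnthE.
rewrite cE in HM Hs; exists M => // i; rewrite -Hs.
apply/eqP; rewrite -(eqr_nat R) -sw -!sum1_count -sum1_card !natr_sum.
rewrite big_mkcond /= (sum_served_ids sys pi (fun j => if typ p j == i then 1 else 0)).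
rewrite [eqbRHS](eq_bigl (fun n => (n \in pi x) && (typ p (nth 0%N (ids p) n) == i))).
  by rewrite big_mkcondr.
by move=> n; rewrite inE tnthE.
Qed.

Definition sumsq p : R := \sum_i (type_num p i)%:R ^+ 2.

Lemma sumsq_departure p s j : j \in ids p ->
  sumsq ((s, inl j) :: p) - sumsq p = 1 - 2 * (type_num p (typ p j))%:R.
Proof.
move=> jp.
have E i : (type_num p i)%:R =
    (type_num ((s, inl j) :: p) i)%:R + (typ p j == i)%:R :> R.
  rewrite -natrD; congr (_%:R); rewrite /type_num /= -rem_filter ?ids_uniq//.
  by rewrite (permP (perm_to_rem jp)) /= addnC.
rewrite /sumsq -sumrB.
transitivity (\sum_i (typ p j == i)%:R * (1 - 2 * (type_num p i)%:R : R)).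
  apply: eq_bigr => i _; rewrite E; case: (typ p j == i) => /=; ring.
rewrite (bigD1 (typ p j))//= eqxx mul1r big1 ?addr0// => i.
by rewrite eq_sym => /negbTE ->; rewrite mul0r.
Qed.

Lemma sumsq_arrival p s i :
  sumsq ((s, inr i) :: p) - sumsq p = 1 + 2 * (type_num p i)%:R.
Proof.
have E k : (type_num ((s, inr i) :: p) k)%:R =
    (type_num p k)%:R + (i == k)%:R :> R.
  rewrite -natrD; congr (_%:R); rewrite /type_num /= -cats1 count_cat /= addn0.
  congr (_ + _)%N; last by rewrite typ_arrival.
  by apply: eq_in_count => j jp; rewrite typ_cons// ids_lt.
rewrite /sumsq -sumrB.
transitivity (\sum_k (i == k)%:R * (1 + 2 * (type_num p k)%:R : R)).
  apply: eq_bigr => k _; rewrite E; case: (i == k) => /=; ring.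
rewrite (bigD1 i)//= eqxx mul1r big1 ?addr0// => k.
by rewrite eq_sym => /negbTE ->; rewrite mul0r.
Qed.

Lemma sum_type_num p : (\sum_i type_num p i = size (ids p))%N.
Proof.
apply/eqP; rewrite -(eqr_nat R) natr_sum.
have := sum_typ (ids p) p (fun=> 1); rewrite big_const_seq count_predT iter_addr_0.
by move=> ->; apply/eqP; apply: eq_bigr => i _; rewrite mulr1.
Qed.

Variable eps : R.
Hypothesis eps_gt0 : 0 < eps.
Hypothesis subcritical : forall q M : job_type K -> nat, max_weight q M ->
  lambda * \sum_i pt i * (q i)%:R <= (1 - eps) * (\sum_i q i * M i)%N%:R.

Let kappa := K l0.

(** Every job occupies at least one of the [K l0] units of resource [l0]. *)
Let option_size M : service_option M -> (\sum_(i : job_type K) M i <= kappa)%N.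
Proof.
move=> /(_ l0); apply: leq_trans; apply: leq_sum => i _; exact: leq_pmull.
Qed.

(** Weight is lost only where [q i < M i <= kappa], and then at most [kappa * M i]; summed over the
    types this is at most [kappa ^ 2]. *)
Let served_weight (q M : job_type K -> nat) : max_weight q M ->
  (\sum_i q i * M i <= \sum_i q i * minn (M i) (q i) + kappa ^ 2)%N.
Proof.
move=> [sM _]; have HM := option_size sM.
apply: (@leq_trans (\sum_i (q i * minn (M i) (q i) + M i * kappa))); last first.
  rewrite big_split /= leq_add2l -big_distrl /= -mulnn leq_mul2r HM; exact: orbT.
apply: leq_sum => i _; have [le|lt] := leqP (M i) (q i).
  exact: leq_addr.
apply: leq_trans (leq_addl _ _); rewrite mulnC leq_mul2l; apply/orP; right.
apply: leq_trans (ltnW lt) _; apply: leq_trans HM; rewrite (bigD1 i)//=; exact: leq_addr.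
Qed.

(** Keeps [th] and [lambda * th] at most 1/2, so that arrivals undo at most half of what one
    departure gains in the correction term. *)
Let th : R := (2 * (lambda + 1))^-1.
(** The constant in the drift of [sumsq]: twice the loss in [served_weight], and 1 per unit step for
    departures and arrivals. *)
Let c2 : R := 2 * kappa%:R ^+ 2 + kappa%:R + lambda.
Let nT : R := #|job_type K|%:R.
(** From [N0] jobs on, the quadratic term alone has drift below -1, since the MaxWeight value is at
    least the number of jobs divided by [nT]. *)
Let N0 : nat := (Num.truncn ((c2 + 1) * nT / (2 * eps))).+1.
Let A : R := 4 * (c2 + 1) / th ^+ N0.

(* The second term compensates the bounded positive drift of the quadratic
   function in states with few jobs. *)
Definition lyapunov p : R := sumsq p + A * (1 - th ^+ size (ids p)).

Let th_gt0 : 0 < th. Proof. by rewrite invr_gt0 mulr_gt0// ltr_wpDl// ltW. Qed.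

Let th_half : th <= 1 / 2.
Proof.
have l1 : 0 < lambda + 1 by rewrite ltr_wpDl// ltW.
rewrite /th div1r lef_pV2 ?posrE ?mulr_gt0//; move: lambda_gt0; lra.
Qed.

Let lambda_th : lambda * th <= 1 / 2.
Proof.
have l1 : 0 < lambda + 1 by rewrite ltr_wpDl// ltW.
rewrite /th -ler_pdivlMr ?invr_gt0 ?mulr_gt0// invrK; lra.
Qed.

Let c2_ge0 : 0 <= c2.
Proof. by rewrite !addr_ge0// ?mulr_ge0 ?exprn_ge0// ltW. Qed.

Let A_ge0 : 0 <= A.
Proof. by rewrite divr_ge0 ?mulr_ge0 ?addr_ge0 ?exprn_ge0// ltW. Qed.

Lemma lyapunov_ge0 p : 0 <= lyapunov p.
Proof.
apply: addr_ge0; first by apply: sumr_ge0 => i _; rewrite exprn_ge0.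
rewrite mulr_ge0// subr_ge0 exprn_ile1//; first exact: ltW.
by apply: le_trans th_half _; lra.
Qed.

(** The quadratic part contributes at most [c2 - 2 * eps * W]. The correction contributes at most
    [- D / 2], as at least one job is served; it takes over when [W] is too small. *)
Lemma lyapunov_drift p s : hist_ok p -> ids p != [::] -> subseq s (ids p) ->
  serving_prob p s != 0 ->
  \sum_(j <- s) (lyapunov ((s, inl j) :: p) - lyapunov p) +
     lambda * \sum_i pt i * (lyapunov ((s, inr i) :: p) - lyapunov p) <= -1.
Proof.
move=> ok ne sub /max_weight_service[M qM Hs].
set q := type_num p in qM Hs *; set N := size (ids p).
have N_gt0 : (0 < N)%N by rewrite lt0n size_eq0.
pose m i := minn (M i) (q i).
pose W := (\sum_i q i * M i)%N; pose S := (\sum_i q i * m i)%N.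
have size_s : size s = (\sum_i m i)%N.
  apply/eqP; rewrite -(eqr_nat R) natr_sum.
  have := sum_typ s p (fun=> 1); rewrite big_const_seq count_predT iter_addr_0.
  by move=> ->; apply/eqP; apply: eq_bigr => i _; rewrite mulr1 Hs.
have sum_s : \sum_(j <- s) (q (typ p j))%:R = S%:R :> R.
  rewrite (sum_typ s p (fun i => (q i)%:R)) /S natr_sum; apply: eq_bigr => i _.
  by rewrite Hs natrM mulrC.
(* What the correction loses at a departure; an arrival adds [th * D]. *)
set D := A * th ^+ N.-1 * (1 - th).
have thN : th ^+ N = th * th ^+ N.-1 by rewrite -exprS prednK.
have dep j : j \in s -> lyapunov ((s, inl j) :: p) - lyapunov p =
    1 - 2 * (q (typ p j))%:R - D.
  move=> js; have jp := mem_subseq sub js.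
  have := sumsq_departure s jp; rewrite -/q /lyapunov /D.
  rewrite [ids (_ :: _)]/= size_rem_ids// -/N thN => H.
  rewrite opprD addrACA H; ring.
have arr i : lyapunov ((s, inr i) :: p) - lyapunov p =
    1 + 2 * (q i)%:R + th * D.
  have := sumsq_arrival p s i; rewrite -/q /lyapunov /D.
  rewrite [ids (_ :: _)]/= size_rcons -/N exprS thN => H.
  rewrite opprD addrACA H; ring.
have -> : \sum_(j <- s) (lyapunov ((s, inl j) :: p) - lyapunov p) =
    (size s)%:R * (1 - D) - 2 * S%:R.
  rewrite (eq_big_seq (fun j => (1 - D) - 2 * (q (typ p j))%:R)); last first.
    by move=> j js; rewrite dep//; ring.
  rewrite sumrB -mulr_sumr sum_s big_const_seq count_predT iter_addr_0.
  by rewrite mulr_natl.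
have -> : \sum_i pt i * (lyapunov ((s, inr i) :: p) - lyapunov p) =
    1 + th * D + 2 * \sum_i pt i * (q i)%:R.
  under eq_bigr do rewrite arr.
  rewrite mulr_sumr -[in RHS](mul1r (1 + th * D)) -(type_prob_sum sys K_gt0).
  rewrite mulr_suml -big_split /=; apply: eq_bigr => i _; ring.
have load := subcritical qM; rewrite -/W in load.
have sk : (size s <= kappa)%N.
  rewrite size_s; apply: leq_trans (option_size qM.1).
  by apply: leq_sum => i _; exact: geq_minl.
have WS : (W <= S + kappa ^ 2)%N by exact: served_weight.
have NW : (N <= #|job_type K| * W)%N.
  rewrite /N -sum_type_num -sum_nat_const; apply: leq_sum => i _.
  exact: max_weight_ge.
(* If nothing were served, no type would have both jobs and a share of the option, so the MaxWeight
   value would be 0 in a nonempty state. *)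
have s1 : (0 < size s)%N.
  rewrite lt0n size_s; apply/negP => /eqP m0.
  have mi i : m i = 0%N.
    by apply/eqP; rewrite -leqn0 -m0 (bigD1 i)//=; exact: leq_addr.
  have W0 : W = 0%N.
    rewrite /W big1// => i _; have /eqP := mi i.
    rewrite /m; have [_ /eqP ->|_ /eqP ->] := leqP (M i) (q i); first exact: muln0.
    exact: mul0n.
  by move: NW; rewrite W0 muln0 leqNgt N_gt0.
have D0 : 0 <= D.
  apply: mulr_ge0; first by apply: mulr_ge0 => //; apply: exprn_ge0; exact: ltW.
  by move: th_half; lra.
have Drift : (size s)%:R * (1 - D) - 2 * S%:R +
    lambda * (1 + th * D + 2 * \sum_i pt i * (q i)%:R) <=
    c2 - 2 * eps * W%:R - D / 2.
  have H1 : (size s)%:R <= kappa%:R :> R by rewrite ler_nat.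
  have H2 : 1 <= (size s)%:R :> R by rewrite ler1n.
  have H3 : W%:R <= S%:R + kappa%:R ^+ 2 :> R by rewrite -natrX -natrD ler_nat.
  have H4 : D <= (size s)%:R * D by rewrite ler_peMl.
  have H5 : lambda * th * D <= 1 / 2 * D by apply: ler_wpM2r.
  rewrite /c2; move: load; nra.
apply: le_trans Drift _.
have [N0N|NN0] := leqP N0 N.
  have H : (c2 + 1) * nT / (2 * eps) < N%:R.
    by apply: lt_le_trans (truncnS_gt _) _; rewrite ler_nat.
  have NW' : N%:R <= nT * W%:R by rewrite -natrM ler_nat.
  have nT0 : 0 < nT by rewrite ltr0n; apply/card_gt0P; exists i0.
  have e2 : 0 < 2 * eps by rewrite mulr_gt0.
  move: H; rewrite ltr_pdivrMr// => H.
  have : (c2 + 1) * nT < (2 * eps * W%:R) * nT.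
    apply: lt_le_trans H _; rewrite mulrC -mulrA; apply: ler_wpM2l; first exact: ltW.
    by rewrite mulrC.
  by rewrite ltr_pM2r//; lra.
have W0 : 0 <= eps * W%:R by rewrite mulr_ge0// ltW.
have thN0 : th ^+ N0 <= th ^+ N.-1.
  apply: ler_wiXn2l; [exact: ltW|by apply: le_trans th_half _; lra|].
  by apply: leq_trans (leq_pred _) (ltnW NN0).
have At : A * th ^+ N0 = 4 * (c2 + 1) by exact/divfK/lt0r_neq0/exprn_gt0.
exact: (small_state_drift A_ge0 thN0 At th_half c2_ge0 W0).
Qed.

(** Foster's criterion: the drift of -1 per unit of time telescopes to a bound on the mean cycle
    length. It holds only in nonempty states, so the sum starts after the first arrival and the idle
    period is added separately. *)
Lemma mean_holding_sum_bounded m :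
  \sum_(k < m) mean_holding k <= mean_holding 0 + mean_at lyapunov 1.
Proof.
have step k : mean_at lyapunov k.+2 <= mean_at lyapunov k.+1 - mean_holding k.+1.
  apply: le_trans (mean_at_next sys i0 lambda_gt0 K_gt0 pi_ok _ _) _.
    by move=> p _ _; exact: lyapunov_ge0.
  rewrite lerD2l /mean_holding -sumrN big_seq [leRHS]big_seq.
  apply: ler_sum => p /gtree_ok[ok sp gp].
  have ne : ids p != [::] by move: gp sp; rewrite /going; case: (p).
  rewrite -sumrN big_seq [leRHS]big_seq; apply: ler_sum => s; rewrite mem_subseqs => sub.
  have [->|b0] := eqVneq (serving_prob p s) 0; first by rewrite !mul0r oppr0.
  rewrite -[leRHS]mulrN1; apply: ler_wpM2l; last exact: lyapunov_drift.
  by apply: divr_ge0; [exact: serving_prob_ge0|exact/ltW/rate_pos].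
have mono k : \sum_(1 <= j < k.+1) mean_holding j + mean_at lyapunov k.+1 <=
              mean_at lyapunov 1.
  elim: k => [|k IH]; first by rewrite big_geq// add0r.
  rewrite big_nat_recr//=; apply: le_trans IH; rewrite -addrA lerD2l.
  by have := step k; lra.
have pos k : 0 <= mean_at lyapunov k.
  by apply: sumr_ge0 => p _; rewrite mulr_ge0 ?hist_prob_ge0 ?lyapunov_ge0.
case: m => [|m].
  by rewrite big_ord0 addr_ge0// mean_holding_ge0.
rewrite -(big_mkord xpredT mean_holding) big_ltn// lerD2l.
by have := mono m; have := pos m.+1; lra.
Qed.

Lemma KMW_stable : stable sys pi.
Proof.
rewrite /stable int_return_time//.
apply: (mean_return_finite lambda_gt0 pi_ok i0 K_gt0 mean_holding_sum_bounded) => e e0.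
have [m Hm] := busy_prob_small i0 lambda_gt0 K_gt0 pi_ok mean_holding_sum_bounded e0.
by exists m; exact: Hm.
Qed.
End MaxWeightDrift.

(** * Choice of the mesh and stability of MaxWeight on it *)

Theorem theorem1 (R : realType) (d : nat) (d_gt0 : (0 < d)%N)
    (lambda : R) (lambda_gt0 : 0 < lambda)
    (fV : rvec R d -> R) (fV_lipschitz : lipschitz_on_cube fV)
    (disp : measure_display) (Omega : measurableType disp)
    (P : probability Omega R) (sys : primitives P lambda fV)
    (KMW : ('I_d -> nat) -> policy R d)
    (KMW_spec : forall K : 'I_d -> nat,
        (forall l, (0 < K l)%N) -> is_KMW K (KMW K)) :
  (exists pi : policy R d, markovian_policy pi /\ stable sys pi) ->
  exists K : 'I_d -> nat, (forall l, (0 < K l)%N) /\ stable sys (KMW K).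
Proof.
move=> [pi [pi_ok pi_stable]].
have [L fL] : exists2 L, 0 <= L & forall u v, unit_cube u -> unit_cube v ->
    `|fV u - fV v| <= L * sup_dist u v.
  (* The given Lipschitz constant carries no sign; its absolute value serves as well. *)
  have [L HL] := fV_lipschitz; exists `|L| => // u v uc vc.
  apply: le_trans (HL _ _ uc vc) _; apply: ler_wpM2r; last exact: ler_norm.
  by apply/bigmax_geP; left.
move=> f_lip.
pose B := fine (mean_return sys pi).
have mean_fin : mean_return sys pi \is a fin_num.
  rewrite ge0_fin_numE; first by rewrite -int_return_time.
  by apply: integral_ge0 => w _; exact: funepos_ge0.
pose i0 n : job_type (@grid d n) := [ffun=> ord0].
have gt0 n l : (0 < @grid d n l)%N by [].
have bound n m : \sum_(k < m) mean_holding sys pi (@grid d n) k <= B.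
  rewrite -lee_fin /B fineK//.
  exact: (mean_holding_le_mean_return sys lambda_gt0 pi_ok (i0 n) (gt0 n)).
have B0 : 0 < B.
  have := bound 0%N 1%N; rewrite big_ord1 (mean_holding0 sys (i0 0%N) (gt0 0%N) pi_ok).
  by apply: lt_le_trans; rewrite invr_gt0.
pose C := lambda * (3 * L + @density_bound R d fV L * d%:R).
(* Half of the slack [1 / (lambda * B)]; the other half absorbs the discretization error
   [C / n.+1]. *)
pose eps := 1 / (2 * (lambda * B)).
have eps0 : 0 < eps by rewrite divr_gt0 ?mulr_gt0.
pose n := Num.truncn (C / eps).
have Cn : C * n.+1%:R^-1 <= eps.
  rewrite ler_pdivrMr// mulrC -ler_pdivrMr//; exact/ltW/truncnS_gt.
exists (@grid d n); split=> //.
have spec := KMW_spec _ (gt0 n).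
apply: (KMW_stable (i0 n) (Ordinal d_gt0) lambda_gt0 (gt0 n) spec eps0) => q M qM.
have load := grid_load lambda_gt0 fL f_lip qM B0 (fun g W g0 gW =>
  necessary_load (i0 n) lambda_gt0 (gt0 n) pi_ok (bound n) g0 gW).
apply: le_trans load _; apply: ler_wpM2r => //.
have -> : 1 - eps = 1 - 1 / (lambda * B) + eps.
  by rewrite /eps; field; rewrite !gt_eqF.
by rewrite lerD2l.
Qed.
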